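(* There is a universal constant $C>0$ such that the following holds. Let $\mathcal{X}$ be a finite-dimensional Euclidean space and $\mathcal{H}\subset\mathbb{S}$ a linear subspace of self-adjoint operators on $\mathcal{X}$ satisfying properties (i)–(iii) of the context. Let $\mathcal{L}>0$, $\nu\in[0,1]$, $\sigma>0$, $\mathbf{B}\in\mathbb{S}_{++}\cap\mathcal{H}$ with $\|\mathbf{B}\|_{\mathrm{tr}}=1$, and let $f:\mathcal{X}\to\mathbb{R}$ be convex and $(\mathcal{L},\nu)$-Hölder smooth with respect to $\|\cdot\|_{\mathbf{B}}$, with a stochastic (sub)gradient estimator $\nabla_\xi f(x)=\nabla f(x)+n_\xi(x)$, $\xi\sim\mathcal{D}$, such that for every $x$: $\mathbb{E}_{\xi\sim\mathcal{D}}[n_\xi(x)]=0$ and $\mathbb{E}_{\xi\sim\mathcal{D}}\|n_\xi(x)\|^2_{\mathbf{B}^{-1}}\le\sigma^2$. Let $\mathcal{R}>0$, $f^*=\min_{x\in Q_{\mathcal{R}}}f(x)$, and let $x^*\in Q_{\mathcal{R}}$ satisfy $f(x^* )=f^*$. Let $\eta=\mathcal{R}$, $\delta>0$, $\alpha_k=1+k/2$ for $k\in\mathbb{N}_0$, and $K\in\mathbb{N}_0$. Then the output $\overline{x}_{K+1}$ of the accelerated Generalized Leon algorithm described in the context satisfies $$\mathbb{E}\big[f(\overline{x}_{K+1})-f(x^* )\big]\le C\left[\frac{\mathcal{L}\mathcal{R}^{1+\nu}}{(K+1)^{(3\nu+1)/2}}+\frac{\sigma\mathcal{R}}{(K+1)^{1/2}}+\frac{\delta\mathcal{R}\dim\mathcal{X}}{(K+1)^2}\right].$$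 Hence, for every $\epsilon>0$, to reach the precision $\mathbb{E}[f(\overline{x}_{K+1})-f^*]\le\epsilon$ it is sufficient to perform the following number of iterations of the algorithm (with a universal constant in $\mathcal{O}$): $$K+1=\mathcal{O}\left[\left(\frac{\mathcal{L}\mathcal{R}^{1+\nu}}{\epsilon}\right)^{\frac{2}{1+3\nu}}+\left(\frac{\sigma\mathcal{R}}{\epsilon}\right)^2+\left(\frac{\delta\mathcal{R}\dim\mathcal{X}}{\epsilon}\right)^{\frac12}\right].$$
   Context: $\mathcal{X}$ is a finite-dimensional real Euclidean space with inner product $\langle\cdot,\cdot\rangle$ and norm $\|\cdot\|$. $\mathbb{S}$ is the space of self-adjoint linear operators $\mathcal{X}\to\mathcal{X}$ with inner product $\langle\mathbf{A},\mathbf{B}\rangle=\mathrm{tr}(\mathbf{A}\mathbf{B}^* )$; $\mathbb{S}_{++}\subset\mathbb{S}$ is the set of positive definite operators; $\mathbf{I}$ is the identity operator. $\|\mathbf{A}\|_{\mathrm{tr}}=\mathrm{tr}\sqrt{\mathbf{A}\mathbf{A}^*}$ and $\|\mathbf{A}\|_{\mathrm{op}}=\max_{\|x\|\le1}\|\mathbf{A}x\|$. For $\mathbf{H}\in\mathbb{S}_{++}$, $\|x\|_{\mathbf{H}}^2=\langle x,\mathbf{H}x\rangle$. For $z\in\mathcal{X}$, $\mathbf{out}(z)\in\mathbb{S}$ is the operator $x\mapsto z\langle z,x\rangle$. $\mathrm{proj}_{\mathcal{H}}$ is the orthogonal projection of $\mathbb{S}$ onto $\mathcal{H}$. $\mathbb{N}_0$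 is the set of non-negative integers. The linear subspace $\mathcal{H}\subset\mathbb{S}$ satisfies: (i) $\mathbf{I}\in\mathcal{H}$; (ii) $\mathbf{H}\mathbf{F}\mathbf{H}\in\mathcal{H}$ for all $\mathbf{H},\mathbf{F}\in\mathcal{H}$; (iii) $\mathrm{proj}_{\mathcal{H}}(\mathbf{H})\in\mathbb{S}_{++}$ for all $\mathbf{H}\in\mathbb{S}_{++}$. $\rho(x)=\big\|\sqrt{\mathrm{proj}_{\mathcal{H}}(\mathbf{out}(x))}\big\|_{\mathrm{op}}$ is a norm on $\mathcal{X}$, and $Q_{\mathcal{R}}=\{x\in\mathcal{X}:\rho(x)\le\mathcal{R}\}$. $\nabla f(x)\in\partial f(x)$ denotes a fixed choice of (sub)gradient (the gradient when $f$ is differentiable). $f$ is $(\mathcal{L},\nu)$-Hölder smooth with respect to $\|\cdot\|_{\mathbf{B}}$ if $\|\nabla f(x)-\nabla f(y)\|_{\mathbf{B}^{-1}}\le\mathcal{L}\|x-y\|_{\mathbf{B}}^\nu$ for all $x,y\in\mathcal{X}$ (for $\nu=0$ the right-hand side is $\mathcal{L}$). Accelerated Generalized Leon algorithm (parameters $\eta,\delta>0$ and a deterministic sequence $\alpha_k\ge1$): set $x_0=\overline{x}_0=0$, $\mathbf{S}_0=\delta^2\mathbf{I}$, $m_{-1}=0$. For $k=0,\dots,K$: sample $\xi_k,\xi'_{k+1}\sim\mathcal{D}$ (all samples over all iterations are mutually independent); with $f_k(x)=\alpha_k^2f\big(x/\alpha_k+(1-1/\alpha_k)\overline{x}_k\big)$,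 $\nabla f_k(x)=\alpha_k\nabla f\big(x/\alpha_k+(1-1/\alpha_k)\overline{x}_k\big)$ and $\nabla_\xi f_k(x)=\alpha_k\nabla_\xi f\big(x/\alpha_k+(1-1/\alpha_k)\overline{x}_k\big)$, set - $g_k=\nabla_{\xi_k}f_k(x_k)$, $m_k=m_{k-1}+g_k$; - $x_{k+1}=-\nabla\Psi_k^*(m_k)$, where $\Psi_k^*(m)=\eta\,\big\|\sqrt{\mathrm{proj}_{\mathcal{H}}(\mathbf{out}(m))+\mathbf{S}_k}\big\|_{\mathrm{tr}}$ (differentiable in $m$); - $\overline{x}_{k+1}=x_{k+1}/\alpha_k+(1-1/\alpha_k)\overline{x}_k$; - $\tilde g_{k+1}=\nabla_{\xi'_{k+1}}f_k(x_{k+1})$; - $\mathbf{S}_{k+1}=\mathbf{S}_k+\mathrm{proj}_{\mathcal{H}}(\mathbf{out}(\tilde g_{k+1}-g_k))$. Output $\overline{x}_{K+1}$. *)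

(* Defs.v *)
From HB Require Import structures.
From mathcomp Require Import all_boot all_order all_algebra.
From mathcomp Require Import all_classical all_reals all_analysis.

Set Implicit Arguments.
Unset Strict Implicit.
Unset Printing Implicit Defensive.

Import Order.TTheory GRing.Theory Num.Theory.

Local Open Scope classical_set_scope.
Local Open Scope ring_scope.

(* A Euclidean space is a finite-dimensional real vector space X together with
   an inner product ip : {dot X for idfun} (symmetric bilinear, positive
   definite). *)
Section Euclidean.
Context {R : realType} {X : vectType R} (ip : {dot X for idfun}).
Implicit Types (A B F P Q : 'End(X)) (H : {vspace 'End(X)}) (x y z g h : X).

Definition enorm x : R := Num.sqrt (ip x x).

Definition self_adjoint A := forall x y, ip (A x) y = ip x (A y).

Definition pos_def A :=
  self_adjoint A /\ forall x, x != 0 -> 0 < ip x (A x).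

Definition pos_semidef A :=
  self_adjoint A /\ forall x, 0 <= ip x (A x).

Definition adjoint A : 'End(X) :=
  xget 0 [set B : 'End(X) | forall x y, ip (A x) y = ip x (B y)].

Definition op_trace A : R := \tr (passmx.mxof (vbasis {:X}) (vbasis {:X}) A).

Definition op_dot A B : R := op_trace (A \o adjoint B)%VF.

(* The unique positive semidefinite square root of a positive semidefinite
   operator (a junk value on other operators). *)
Definition op_sqrt A : 'End(X) :=
  xget 0 [set Q : 'End(X) | pos_semidef Q /\ (Q \o Q)%VF = A].

Definition tr_norm A : R := op_trace (op_sqrt (A \o adjoint A)%VF).

Definition op_norm A : R := sup [set enorm (A x) | x in [set x | enorm x <= 1]].

Definition hnorm B x : R := Num.sqrt (ip x (B x)).

Definition outer z : 'End(X) := linfun (fun x => ip z x *: z).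

(* For H made of self-adjoint operators, the orthogonal projection onto H; the
   library's projv projects along an unspecified complement. *)
Definition oproj H A : 'End(X) :=
  xget 0 [set P : 'End(X) |
           P \in H /\ forall F, F \in H -> op_dot (A - P) F = 0].

Definition structured_subspace H :=
  [/\ forall A, A \in H -> self_adjoint A,
      \1%VF \in H,
      forall A F, A \in H -> F \in H -> (A \o F \o A)%VF \in H
    & forall A, pos_def A -> pos_def (oproj H A)].

Definition rho H x : R := op_norm (op_sqrt (oproj H (outer x))).

Definition rho_ball H (r : R) : set X := [set x | rho H x <= r].

Definition is_gradient (F : X -> R) x g :=
  forall e : R, 0 < e -> exists2 d : R, 0 < d &
    forall h, enorm h < d -> `|F (x + h) - F x - ip g h| <= e * enorm h.

(* The value is a junk one where F is not differentiable. *)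
Definition gradient (F : X -> R) x : X := xget 0 [set g | is_gradient F x g].

(* When f is convex and differentiable at x, the only subgradient of f at x is
   its gradient. *)
Definition subgradient (f : X -> R) x g := forall y, f x + ip g (y - x) <= f y.

(* The library has a `^ 0 = 1 for every a, so that for nu = 0 the right-hand
   side is L, also when x = y. *)
Definition holder_smooth (L nu : R) B (grad : X -> X) :=
  forall x y, hnorm (B^-1)%VF (grad x - grad y) <= L * hnorm B (x - y) `^ nu.

End Euclidean.

Section Borel.
Context {R : realType}.

Definition half_spaces (X : vectType R) : set (set X) :=
  [set [set x | c < phi x] | phi in [set: 'Hom(X, R^o)] & c in [set: R]].

(* The Borel sets of a finite-dimensional real vector space are generated by
   the half-spaces. *)
Definition borel_vect (X : vectType R) : Type := X.

Context (X : vectType R).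

HB.instance Definition _ := Choice.on (borel_vect X).
HB.instance Definition _ := isPointed.Build (borel_vect X) (0 : X).
HB.instance Definition _ :=
  @isMeasurable.Build (sigma_display (@half_spaces X)) (borel_vect X)
    <<s @half_spaces X >> (@sigma_algebra0 _ setT (@half_spaces X))
    (@sigma_algebraC (borel_vect X) (@half_spaces X))
    (@sigma_algebra_bigcup _ setT (@half_spaces X)).

End Borel.

(* The stochastic (sub)gradient at x for the sample s is grad x + n s x, with
   variance at most sigma ^ 2.  Its joint measurability in (s, x) makes the
   iterates of the algorithm random variables. *)
Record stochastic_oracle {R : realType} {X : vectType R}
    (ip : {dot X for idfun}) {d : measure_display} {Xi : measurableType d}
    (D : probability Xi R) (B : 'End(X)) (sigma : R) (grad : X -> X)
    (n : Xi -> X -> X) : Prop := StochasticOracle {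
  oracle_measurable : measurable_fun [set: Xi * borel_vect X]
    (fun p => grad p.2 + n p.1 p.2 : borel_vect X) ;
  oracle_unbiased : forall x v : X, ('E_D[fun s => ip v (n s x)] = 0)%E ;
  oracle_variance : forall x : X,
    ('E_D[fun s => (hnorm ip (B^-1)%VF (n s x) ^+ 2)%R] <= (sigma ^+ 2)%:E)%E
}.

Definition mutually_independent {R : realType} {d d' : measure_display}
    {Omega : measurableType d} {Xi : measurableType d'}
    (P : probability Omega R) (I : finType) (Z : I -> Omega -> Xi) :=
  forall (J : {set I}) (A : I -> set Xi),
    (forall i, i \in J -> measurable (A i)) ->
    (P (\bigcap_(i in [set i | i \in J]) (Z i @^-1` A i)) =
     \prod_(i in J) P (Z i @^-1` A i))%E.

(* The samples xi_k (k <= K) and xi'_(k+1) (k <= K) drawn during the run. *)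
Definition run_samples {T : Type} (xi xi' : nat -> T) (K : nat)
    (i : 'I_K.+1 + 'I_K.+1) : T :=
  match i with inl k => xi k | inr k => xi' k.+1 end.

Section AcceleratedLeon.
Context {R : realType} {X : vectType R} (ip : {dot X for idfun}).
Context (H : {vspace 'End(X)}) (eta delta : R) (alpha : nat -> R).
Context {Xi : Type} (sgrad : Xi -> X -> X) (xi xi' : nat -> Xi).

Definition Psi_star (Sk : 'End(X)) (m : X) : R :=
  eta * tr_norm ip (op_sqrt ip (oproj ip H (outer ip m) + Sk)).

(* At the beginning of iteration k: x_k, \overline{x}_k, m_(k-1) and S_k. *)
Record leon_state := LeonState {
  st_x : X ;
  st_xbar : X ;
  st_m : X ;
  st_S : 'End(X)
}.

Definition leon_avg (a : R) (xbar x : X) : X :=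
  a^-1 *: x + (1 - a^-1) *: xbar.

(* Stochastic gradient of f_k (x) = a ^ 2 * f (leon_avg a xbar x) for the
   sample s, where a = alpha_k and xbar = \overline{x}_k. *)
Definition leon_sgrad (a : R) (xbar : X) (s : Xi) (x : X) : X :=
  a *: sgrad s (leon_avg a xbar x).

Definition leon_step (k : nat) (st : leon_state) : leon_state :=
  let: LeonState x xbar m Sk := st in
  let a := alpha k in
  let g := leon_sgrad a xbar (xi k) x in
  let m' := m + g in
  let x' := - gradient ip (Psi_star Sk) m' in
  let xbar' := leon_avg a xbar x' in
  let g' := leon_sgrad a xbar (xi' k.+1) x' in
  let Sk' := Sk + oproj ip H (outer ip (g' - g)) in
  LeonState x' xbar' m' Sk'.

Fixpoint leon (k : nat) : leon_state :=
  if k is k'.+1 then leon_step k' (leon k')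
  else LeonState 0 0 0 (delta ^+ 2 *: \1%VF).

End AcceleratedLeon.

(* Main.v *)
Require Import Defs.
From HB Require Import structures.
From mathcomp Require Import all_boot all_order all_algebra.
From mathcomp Require Import ring lra.
From mathcomp Require Import all_classical all_reals all_analysis.
From mathcomp Require Import measurable_realfun.

Set Implicit Arguments.
Unset Strict Implicit.
Unset Printing Implicit Defensive.

Import Order.TTheory GRing.Theory Num.Theory.
Import numFieldNormedType.Exports.

Local Open Scope classical_set_scope.
Local Open Scope ring_scope.

(** Follow-the-regularized-leader in dual form. The gradient of [Psi_star S] at [m] is
    [r *: A^(-1/2) m] with [A = proj (out m) + S]; since [H] is closed under Jordan products,
    [A^(-1/2)], a limit of Newton iterates, stays in [H], and this also gives the convexity
    and the smoothness of [Psi_star S] by comparing traces of square roots. The submodularity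
    of [tr sqrt] bounds the cost of moving from [S_k] to [S_(k+1)], so the optimistic regret
    telescopes to at most [6 r tr (sqrt S_(K+1))]. Splitting [S_(K+1)] against
    [delta I + tau B] bounds this trace by [delta dim X], [tau], and [1 / tau] times the sum of
    the squared dual norms of [gt_k - g_k].

    Hölder smoothness is used as smoothness with constant [M = 2 L s^(nu - 1)] up to an error
    [L s^(1 + nu)], at the scale [s = r (K + 1)^(-3/2)]. For [tau >= 12 r M] the deterministic
    part of [gt_k - g_k] is absorbed by the Bregman terms of the accelerated scheme; the noise
    part has variance at most [2 sigma^2] at each step, and the terms linear in the noise have
    mean zero because each sample is independent of the past (Fubini). *)

(** * Inner products and the spectral theorem *)

(** Pairing [proj M] with [F] agrees with pairing [M] with [F] only for [F] in [H]. The estimates on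
    [Psi_star] remove the projection in this way, so every test operator (root, inverse, inverse
    root) must be shown to lie in [H]. In general [H] is closed under [A F A] but not under
    composition, hence polynomial approximation in place of a functional calculus on [H]. The same
    Newton iterates later make the inverse root measurable.

    Upper bounds on traces of roots rest on [2 tr (sqrt A) <= tr Z + <A, Z^-1>], an equality at
    [Z = sqrt A]; each use is a choice of [Z].

    The point [xs] is minimal only on the ball, so iterates and averages must be kept there: this
    makes the gap nonnegative and bounds the factors paired with the noise. The iterate [x_(k+1)]
    uses [xi_k] but not [xi'_(k+1)], so each noise vector meets a factor fixed before its sample is
    drawn.

    Only the sum [grad x + n s x] is assumed jointly measurable; the measurability of [f], [grad]
    and [n] is derived. *)

Lemma linfun_linearE (R : realType) (U V : vectType R) (f : U -> V) :
  linear f -> linfun f =1 f.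
Proof.
move=> lf; pose F := GRing.isLinear.Build _ _ _ _ f lf.
pose ff : {linear U -> V} := HB.pack f F.
exact: (lfunE ff).
Qed.

(** The minimum is at [t = - c / d]. When [d = 0] the form is affine in [t] and takes the value -1
    unless [c = 0]. *)
Lemma discriminant_le (R : realFieldType) (a c d : R) : 0 <= d ->
  (forall t, 0 <= a + 2 * t * c + t ^+ 2 * d) -> c ^+ 2 <= a * d.
Proof.
rewrite le_eqVlt => /predU1P[<-|d_gt0] h.
  have [->|c0] := eqVneq c 0; first by rewrite expr0n mulr0.
  have := h (- (a + 1) / (2 * c)).
  have -> : a + 2 * (- (a + 1) / (2 * c)) * c
      + (- (a + 1) / (2 * c)) ^+ 2 * 0 = -1 by field.
  by move=> ?; exfalso; lra.
have := h (- c / d).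
have -> : a + 2 * (- c / d) * c + (- c / d) ^+ 2 * d = (a * d - c ^+ 2) / d.
  by field; rewrite gt_eqF.
by rewrite pmulr_lge0 ?invr_gt0// subr_ge0.
Qed.

(** Meant for [q = <v, A v>], [n = <v, v>], [m = <A v, A v>]: Cauchy-Schwarz and a bound on [A]
    become a bound on the quadratic form. The factor [c + 1] avoids taking the square root of
    [c]. *)
Lemma le_of_sqr_le (R : realFieldType) (q n m c : R) : 0 <= c -> 0 <= n ->
  m <= c * n -> q ^+ 2 <= n * m -> q <= (c + 1) * n.
Proof.
move=> c0 n0 mcn qnm; have cn0 : 0 <= (c + 1) * n by rewrite mulr_ge0// addr_ge0.
rewrite leNgt; apply/negP => lt_q.
have : ((c + 1) * n) ^+ 2 < q ^+ 2 by rewrite ltr_pXn2r// nnegrE (le_trans cn0)// ltW.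
have : n * m <= n * (c * n) by rewrite ler_wpM2l.
have : 0 <= n ^+ 2 by rewrite sqr_ge0.
nra.
Qed.

Section InnerProduct.
Context {R : realType} {V : vectType R}.

(** A predicate on a bare binary function, so that the same lemmas serve [ip] on [X] and the trace
    pairing [op_dot] on ['End(X)]. *)
Definition inner_product (b : V -> V -> R) :=
  [/\ forall x y, b x y = b y x,
      forall a x y z, b (a *: x + y) z = a * b x z + b y z
    & forall x, x != 0 -> 0 < b x x].

Context (b : V -> V -> R) (bP : inner_product b).

Lemma innerC x y : b x y = b y x. Proof. by case: bP. Qed.

Lemma inner0l z : b 0 z = 0.
Proof.
case: bP => _ lb _; have := lb (-1) 0 0 z.
by rewrite scaler0 addr0 mulN1r addNr.
Qed.

Lemma innerDl x y z : b (x + y) z = b x z + b y z.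
Proof. by case: bP => _ lb _; rewrite -[x in LHS]scale1r lb mul1r. Qed.

Lemma innerZl a x z : b (a *: x) z = a * b x z.
Proof. by case: bP => _ lb _; rewrite -[_ *: _]addr0 lb inner0l addr0. Qed.

Lemma innerNl x z : b (- x) z = - b x z.
Proof. by rewrite -scaleN1r innerZl mulN1r. Qed.

Lemma innerBl x y z : b (x - y) z = b x z - b y z.
Proof. by rewrite innerDl innerNl. Qed.

Lemma inner0r z : b z 0 = 0. Proof. by rewrite innerC inner0l. Qed.

Lemma innerDr x y z : b z (x + y) = b z x + b z y.
Proof. by rewrite innerC innerDl !(innerC z). Qed.

Lemma innerZr a x z : b z (a *: x) = a * b z x.
Proof. by rewrite innerC innerZl (innerC z). Qed.

Lemma innerNr x z : b z (- x) = - b z x.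
Proof. by rewrite innerC innerNl (innerC z). Qed.

Lemma innerBr x y z : b z (x - y) = b z x - b z y.
Proof. by rewrite innerDr innerNr. Qed.

Lemma inner_suml I (r : seq I) (P : pred I) (F : I -> V) z :
  b (\sum_(i <- r | P i) F i) z = \sum_(i <- r | P i) b (F i) z.
Proof. by apply: (big_morph (b^~ z)) => [x y|]; rewrite ?innerDl ?inner0l. Qed.

Lemma inner_sumr I (r : seq I) (P : pred I) (F : I -> V) z :
  b z (\sum_(i <- r | P i) F i) = \sum_(i <- r | P i) b z (F i).
Proof. by apply: (big_morph (b z)) => [x y|]; rewrite ?innerDr ?inner0r. Qed.

Lemma inner_gt0 x : x != 0 -> 0 < b x x. Proof. by case: bP => _ _; apply. Qed.

Lemma inner_ge0 x : 0 <= b x x.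
Proof.
by have [->|/inner_gt0/ltW//] := eqVneq x 0; rewrite inner0l.
Qed.

Lemma inner_eq0 x : (b x x == 0) = (x == 0).
Proof.
have [->|x0] := eqVneq x 0; first by rewrite inner0l eqxx.
by rewrite gt_eqF// inner_gt0.
Qed.

Lemma inner_linear u : linear (b u : V -> R^o).
Proof. by move=> a x y; rewrite innerDr innerZr. Qed.

Lemma inner_inj x y : (forall z, b z x = b z y) -> x = y.
Proof.
move=> h; apply/eqP; rewrite -subr_eq0 -inner_eq0 innerBr.
by rewrite h subrr.
Qed.

Lemma cauchy_schwarz x y : b x y ^+ 2 <= b x x * b y y.
Proof.
apply: discriminant_le => [|t]; first exact: inner_ge0.
have := inner_ge0 (x + t *: y).
rewrite innerDl !innerDr !innerZl !innerZr (innerC y x); nra.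
Qed.

Record orthonormal_basis (U : {vspace V}) (s : seq V) : Prop := OrthonormalBasis {
  onb_uniq : uniq s ;
  onb_inner : {in s &, forall x y, b x y = (x == y)%:R} ;
  onb_sub : {subset s <= U} ;
  onb_expand : forall v, v \in U -> v = \sum_(x <- s) b x v *: x
}.

Lemma parseval U s u v : orthonormal_basis U s -> v \in U ->
  b u v = \sum_(x <- s) b x u * b x v.
Proof.
move=> sP vU; rewrite [v in LHS](onb_expand sP vU) inner_sumr.
by apply: eq_bigr => x _; rewrite innerZr mulrC (innerC u).
Qed.

(** Induction on the dimension: normalize an eigenvector [u] in [U]; by symmetry the part of [U]
    orthogonal to [u] is again invariant. The existence of eigenvectors is a hypothesis because the
    analytic proof of it relies on orthonormal bases, which come from the case [A = 0]. *)
Lemma eigenbasis_of_eigenvectors (A : 'End(V)) :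
  (forall x y, b (A x) y = b x (A y)) ->
  (forall U : {vspace V}, U != 0%VS -> {in U, forall v, A v \in U} ->
     exists u a, [/\ u \in U, u != 0 & A u = a *: u]) ->
  forall U : {vspace V}, {in U, forall v, A v \in U} ->
  exists2 s, orthonormal_basis U s & {in s, forall x, A x = b x (A x) *: x}.
Proof.
move=> symA eigA U; have [k] := ubnP (\dim U).
elim: k => // k IH in U *; rewrite ltnS => dimU AU.
have [U0|U0] := eqVneq U 0%VS.
  exists [::] => //; split => // v.
  by rewrite U0 memv0 big_nil => /eqP.
have [u0 [a [u0U u0_neq0 Au0]]] := eigA _ U0 AU.
pose u := (Num.sqrt (b u0 u0))^-1 *: u0.
have buu : b u u = 1.
  rewrite /u innerZl innerZr mulrA -invfM -expr2 sqr_sqrtr ?inner_ge0//.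
  by rewrite mulVf// inner_eq0.
have uU : u \in U by rewrite memvZ.
have Au : A u = a *: u by rewrite linearZ /= Au0 !scalerA mulrC.
pose phi := linfun (b u : V -> R^o).
have phiE v : phi v = b u v by rewrite linfun_linearE//; exact: inner_linear.
pose U' := (U :&: lker phi)%VS.
have memU' v : (v \in U') = (v \in U) && (b u v == 0).
  by rewrite memv_cap memv_ker phiE.
have dimU' : (\dim U' < k)%N.
  apply: leq_trans dimU; rewrite ltn_neqAle dimvS ?capvSl// andbT.
  apply/negP => dU; have : u \in U'.
    have /eqP -> // : U' == U by rewrite eqEdim capvSl (eqP dU) leqnn.
  by rewrite memU' buu oner_eq0 andbF.
have AU' : {in U', forall v, A v \in U'}.
  move=> v; rewrite !memU' => /andP[vU /eqP uv]; rewrite AU//=.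
  by rewrite -symA Au innerZl uv mulr0.
have [s sP eigs] := IH _ dimU' AU'.
have us x : x \in s -> b u x = 0.
  by move=> /(onb_sub sP); rewrite memU' => /andP[_ /eqP].
exists (u :: s).
  split.
  - rewrite /= (onb_uniq sP) andbT; apply/negP => /us /eqP.
    by rewrite buu oner_eq0.
  - have neq x : x \in s -> u == x = false.
      by move=> xs; apply/negP => /eqP ux; have := us _ xs; rewrite -ux buu => /eqP; rewrite oner_eq0.
    move=> x y; rewrite !inE => /predU1P[->|xs] /predU1P[->|ys].
    + by rewrite eqxx.
    + by rewrite us// neq.
    + by rewrite innerC us// eq_sym neq.
    + exact: (onb_inner sP).
  - move=> x; rewrite inE => /predU1P[->//|/(onb_sub sP)].
    by rewrite memU' => /andP[].
  - move=> v vU; rewrite big_cons.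
    have v'U : v - b u v *: u \in U'.
      by rewrite memU' rpredB ?rpredZ//= innerBr innerZr buu mulr1 subrr.
    rewrite -[LHS](subrK (b u v *: u)) addrC; congr (_ + _).
    rewrite [LHS](onb_expand sP v'U) big_seq [RHS]big_seq.
    apply: eq_bigr => x xs.
    by congr (_ *: _); rewrite innerBr innerZr (innerC x u) (us x xs) mulr0 subr0.
move=> x; rewrite inE => /predU1P[->|/eigs//].
by rewrite Au innerZr buu mulr1.
Qed.

(** The zero operator leaves every subspace invariant and has every nonzero vector as
    eigenvector. *)
Lemma gram_schmidt U : exists s, orthonormal_basis U s.
Proof.
have [|||s sP _] := @eigenbasis_of_eigenvectors 0 _ _ U.
- by move=> x y; rewrite !zero_lfunE inner0l inner0r.
- move=> U0 U0_neq0 _; exists (vpick U0), 0.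
  by rewrite memv_pick vpick0 U0_neq0 zero_lfunE scale0r.
- by move=> v _; rewrite zero_lfunE mem0v.
- by exists s.
Qed.

End InnerProduct.

Lemma sum_cauchy_schwarz (R : realFieldType) (I : Type) (s : seq I) (F G : I -> R) :
  (\sum_(i <- s) F i * G i) ^+ 2
    <= (\sum_(i <- s) F i ^+ 2) * (\sum_(i <- s) G i ^+ 2).
Proof.
apply: discriminant_le => [|t]; first by apply: sumr_ge0 => i _; exact: sqr_ge0.
rewrite mulr_sumr mulr_sumr -!big_split/=.
apply: sumr_ge0 => i _.
rewrite (_ : _ + _ = (F i + t * G i) ^+ 2) ?sqr_ge0//; ring.
Qed.

Section Spectral.
Context {R : realType} {V : vectType R} (b : V -> V -> R).
Context (bP : inner_product b).

(** The constant is the squared Hilbert-Schmidt norm of [A] on [U]. *)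
Lemma lfun_bounded (U : {vspace V}) (A : 'End(V)) : exists2 c, 0 <= c &
  {in U, forall v, b (A v) (A v) <= c * b v v}.
Proof.
have [s sP] := gram_schmidt bP U.
exists (\sum_(x <- s) b (A x) (A x)) => [|v vU].
  by apply: sumr_ge0 => x _; exact: inner_ge0.
set w := A v; set c := \sum_(x <- s) _.
have [/eqP ->|w0] := boolP (b w w == 0).
  by rewrite mulr_ge0 ?inner_ge0// sumr_ge0// => x _; exact: inner_ge0.
have w_gt0 : 0 < b w w by rewrite lt_neqAle eq_sym w0 inner_ge0.
have bww : b w w = \sum_(x <- s) b x v * b (A x) w.
  have -> : b w w = b (A (\sum_(x <- s) b x v *: x)) w.
    by rewrite -(onb_expand sP vU).
  rewrite linear_sum (inner_suml bP); apply: eq_bigr => x _.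
  by rewrite linearZ /= (innerZl bP).
have h : b w w ^+ 2 <= b v v * (c * b w w).
  rewrite {1}bww; apply: le_trans (sum_cauchy_schwarz _ _ _) _.
  have -> : b v v = \sum_(x <- s) b x v ^+ 2 by exact: (parseval bP _ sP vU).
  apply: ler_pM.
  - by apply: sumr_ge0 => x _; exact: sqr_ge0.
  - by apply: sumr_ge0 => x _; exact: sqr_ge0.
  - exact: lexx.
  - by rewrite /c mulr_suml; apply: ler_sum => x _; exact: (cauchy_schwarz bP).
by rewrite -(ler_pM2r w_gt0) -expr2 (le_trans h)// mulrA (mulrC c).
Qed.

Lemma semi_cauchy_schwarz (U : {vspace V}) (A : 'End(V)) :
  (forall x y, b (A x) y = b x (A y)) -> {in U, forall v, 0 <= b v (A v)} ->
  {in U &, forall x y, b x (A y) ^+ 2 <= b x (A x) * b y (A y)}.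
Proof.
move=> symA A0 x y xU yU; apply: discriminant_le => [|t]; first exact: A0.
have := A0 (x + t *: y) (rpredD xU (rpredZ _ yU)).
rewrite linearD linearZ /= (innerDl bP) !(innerDr bP) !(innerZl bP) !(innerZr bP).
rewrite -(symA y x) (innerC bP (A y)); nra.
Qed.

(** An injective endomorphism of [U] is onto. A linear inverse [D] is built on an orthonormal basis,
    and the constant is the one that bounds [D]. *)
Lemma lfun_bounded_below (U : {vspace V}) (A : 'End(V)) :
  {in U, forall v, A v \in U} -> {in U, forall v, A v = 0 -> v = 0} ->
  exists2 c, 0 <= c & {in U, forall v, b v v <= c * b (A v) (A v)}.
Proof.
move=> AU injA; have [s sP] := gram_schmidt bP U.
have imA : (A @: U)%VS = U.
  apply/eqP; rewrite eqEdim; apply/andP; split.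
    by apply/subvP => _ /memv_imgP[v vU ->]; exact: AU.
  rewrite limg_dim_eq//; apply/eqP; rewrite -subv0; apply/subvP => v.
  by rewrite memv_cap memv_ker memv0 => /andP[vU /eqP /(injA _ vU) ->].
have [w wP] : exists w : V -> V, forall x, x \in U -> w x \in U /\ A (w x) = x.
  have h x : exists y, x \in U -> y \in U /\ A y = x.
    have [|] := boolP (x \in U); last by exists 0.
    by rewrite -{1}imA => /memv_imgP[y yU ->]; exists y.
  by have [w wP] := choice h; exists w.
pose D := linfun (fun v => \sum_(x <- s) b x v *: w x).
have DE v : D v = \sum_(x <- s) b x v *: w x.
  rewrite linfun_linearE// => a x y; rewrite scaler_sumr -big_split/=.
  by apply: eq_bigr => z _; rewrite (innerDr bP) (innerZr bP) scalerDl scalerA.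
have [c c0 cP] := lfun_bounded U D; exists c => // v vU.
have DAv : D (A v) \in U.
  rewrite DE big_seq rpred_sum // => x xs.
  by rewrite rpredZ// (wP x _).1// (onb_sub sP).
have {1 2}-> : v = D (A v).
  apply/eqP; rewrite -subr_eq0; apply/eqP; apply: injA; first by rewrite rpredB.
  rewrite linearB /= DE linear_sum; apply/eqP; rewrite subr_eq0; apply/eqP.
  rewrite [LHS](onb_expand sP (AU _ vU)) big_seq [RHS]big_seq.
  by apply: eq_bigr => x xs; rewrite linearZ /= (wP x _).2// (onb_sub sP).
by apply: cP; exact: AU.
Qed.

(** The eigenvalue is the infimum [mu] of the Rayleigh quotient, without any compactness argument:
    if [X = A - mu] were injective on [U] it would be bounded below, which forces the quotient to
    exceed [mu] by a fixed positive amount. *)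
Lemma eigenvector (U : {vspace V}) (A : 'End(V)) :
  (forall x y, b (A x) y = b x (A y)) -> U != 0%VS -> {in U, forall v, A v \in U} ->
  exists u a, [/\ u \in U, u != 0 & A u = a *: u].
Proof.
move=> symA U0 AU.
pose E := [set b v (A v) | v in [set v | v \in U /\ b v v = 1]].
have [cA cA0 cAP] := lfun_bounded U A.
have E_lb : lbound E (- (cA + 1)).
  move=> _ [v [vU v1] <-].
  have := cauchy_schwarz bP v (A v); rewrite v1 mul1r => h.
  have := cAP v vU; rewrite v1 mulr1; nra.
have normalize v : v \in U -> v != 0 -> exists u t,
    [/\ u \in U, b u u = 1, v = t *: u & t ^+ 2 = b v v].
  move=> vU v0; have n0 : 0 < Num.sqrt (b v v) by rewrite sqrtr_gt0 (inner_gt0 bP).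
  exists ((Num.sqrt (b v v))^-1 *: v), (Num.sqrt (b v v)); split.
  - by rewrite rpredZ.
  - rewrite (innerZl bP) (innerZr bP) mulrA -invfM -expr2 sqr_sqrtr ?(inner_ge0 bP)//.
    by rewrite mulVf// (inner_eq0 bP).
  - by rewrite scalerA mulfV ?scale1r// gt_eqF.
  - by rewrite sqr_sqrtr ?(inner_ge0 bP).
have E0 : E !=set0.
  have [u [t [uU u1 _ _]]] := normalize _ (memv_pick U) (etrans (congr1 negb (vpick0 U)) U0).
  by exists (b u (A u)), u.
have E_inf : has_inf E by split => //; exists (- (cA + 1)).
set mu := inf E.
pose X := A - mu *: \1%VF.
have XE v : X v = A v - mu *: v.
  by rewrite add_lfunE opp_lfunE scale_lfunE id_lfunE.
have symX x y : b (X x) y = b x (X y).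
  by rewrite !XE (innerBl bP) (innerBr bP) (innerZl bP) (innerZr bP) symA.
have X_ge0 : {in U, forall v, 0 <= b v (X v)}.
  move=> v vU; have [->|v0] := eqVneq v 0; first by rewrite (inner0l bP).
  have [u [t [uU u1 -> _]]] := normalize v vU v0.
  rewrite linearZ /= (innerZl bP) (innerZr bP) mulrA -expr2 mulr_ge0 ?sqr_ge0//.
  rewrite XE (innerBr bP) (innerZr bP) u1 mulr1 subr_ge0.
  by apply: ge_inf; [case: E_inf | exists u].
have XU : {in U, forall v, X v \in U}.
  by move=> v vU; rewrite XE rpredB ?rpredZ ?AU.
have [h|] := pselect (exists u, [/\ u \in U, u != 0 & X u = 0]).
  have [u [uU u0 Xu]] := h; exists u, mu; split => //.
  by apply/eqP; rewrite -subr_eq0 -XE Xu.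
move=> /forallNP nex; exfalso.
have injX : {in U, forall v, X v = 0 -> v = 0}.
  move=> v vU Xv; apply/eqP; apply/negPn/negP => v0; exact: (nex v).
have [c c0 cP] := lfun_bounded_below XU injX.
have [d d0 dP] := lfun_bounded U X.
(* Semidefinite Cauchy-Schwarz at [v] and [X v] gives [|X v|^4 <= <v, X v> <X v, X X v>], hence
   [|X v|^2 <= (d + 1) <v, X v>]; combine with [|v|^2 <= c |X v|^2]. *)
have key v : v \in U -> b v v = 1 -> 1 <= (c * (d + 1)) * b v (X v).
  move=> vU v1; have := cP v vU; rewrite v1 => h1; apply: le_trans h1 _.
  rewrite -mulrA ler_wpM2l//.
  have := semi_cauchy_schwarz symX X_ge0 vU (XU _ vU).
  have -> : b v (X (X v)) = b (X v) (X v) by rewrite symX.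
  have := inner_ge0 bP (X v); rewrite le_eqVlt => /predU1P[<- _|n_gt0 h2].
    by apply: mulr_ge0; [exact: addr_ge0|exact: X_ge0].
  have h3 : b (X v) (X (X v)) <= (d + 1) * b (X v) (X v).
    apply: le_of_sqr_le (dP _ (XU _ vU)) (cauchy_schwarz bP _ _) => //.
    exact: inner_ge0.
  have v_ge0 := X_ge0 v vU.
  rewrite -(ler_pM2r n_gt0) -expr2 (le_trans h2)//.
  by rewrite (mulrC (d + 1)) -mulrA ler_wpM2l.
have [u [t [uU u1 _ _]]] := normalize _ (memv_pick U) (etrans (congr1 negb (vpick0 U)) U0).
have cd_gt0 : 0 < c * (d + 1).
  rewrite lt_neqAle mulr_ge0 ?addr_ge0// andbT eq_sym; apply/eqP => cd0.
  by have := key u uU u1; rewrite cd0 mul0r ler10.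
have : mu + (c * (d + 1))^-1 <= mu.
  rewrite {2}/mu; apply: lb_le_inf => // _ [v [vU v1] <-].
  have := key v vU v1; rewrite XE (innerBr bP) (innerZr bP) v1 mulr1.
  by rewrite mulrC -ler_pdivrMr// div1r lerBrDl.
by rewrite -{2}[mu]addr0 lerD2l invr_le0 leNgt cd_gt0.
Qed.

Lemma spectral_theorem (U : {vspace V}) (A : 'End(V)) :
  (forall x y, b (A x) y = b x (A y)) -> {in U, forall v, A v \in U} ->
  exists2 s, orthonormal_basis b U s & {in s, forall x, A x = b x (A x) *: x}.
Proof.
by move=> symA; apply: (eigenbasis_of_eigenvectors bP symA) => W W0 AW; exact: eigenvector.
Qed.

End Spectral.

(** * Operators on a Euclidean space *)

Section Operators.
Context {R : realType} {X : vectType R} (ip : {dot X for idfun}).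
Implicit Types (A B F P Q : 'End(X)) (x y z : X).

Lemma dot_inner_product : inner_product ip.
Proof.
split=> [x y|a x y z|x].
- by rewrite hermC expr0 mul1r.
- by rewrite linearPl.
- exact: neq0_dnorm_gt0.
Qed.
Local Notation ipP := dot_inner_product.

Lemma self_adjointD A B :
  self_adjoint ip A -> self_adjoint ip B -> self_adjoint ip (A + B).
Proof.
by move=> sA sB x y; rewrite !add_lfunE (innerDl ipP) (innerDr ipP) sA sB.
Qed.

Lemma self_adjointZ a A : self_adjoint ip A -> self_adjoint ip (a *: A).
Proof.
by move=> sA x y; rewrite !scale_lfunE (innerZl ipP) (innerZr ipP) sA.
Qed.

Lemma self_adjointB A B :
  self_adjoint ip A -> self_adjoint ip B -> self_adjoint ip (A - B).
Proof.
by move=> sA sB; rewrite -scaleN1r; apply: self_adjointD => //; exact: self_adjointZ.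
Qed.

Lemma self_adjoint1 : self_adjoint ip \1%VF.
Proof. by move=> x y; rewrite !id_lfunE. Qed.

Lemma self_adjoint_congr A F : self_adjoint ip A -> self_adjoint ip F ->
  self_adjoint ip (A \o F \o A)%VF.
Proof. by move=> sA sF x y; rewrite !comp_lfunE sA sF sA. Qed.

Lemma eigenbasis A : self_adjoint ip A -> exists2 s,
  orthonormal_basis ip {:X} s & {in s, forall x, A x = ip x (A x) *: x}.
Proof. by move=> sA; apply: (spectral_theorem ipP) => // v _; exact: memvf. Qed.

Lemma eq_on_basis s A B : orthonormal_basis ip {:X} s ->
  {in s, A =1 B} -> A = B.
Proof.
move=> sP AB; apply/lfunP => v; rewrite (onb_expand sP (memvf v)) !linear_sum.
by apply: eq_big_seq => x xs; rewrite !linearZ /= AB.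
Qed.

(** The matrix trace is taken in the basis [e]. Expanding [A e_i] along [s], or [x] along [e],
    produces the same double sum. *)
Lemma op_traceE s A : orthonormal_basis ip {:X} s ->
  op_trace A = \sum_(x <- s) ip x (A x).
Proof.
move=> sP; rewrite /op_trace /mxtrace.
set e := vbasis {:X}.
have eB : basis_of {:X} e := vbasisP _.
have -> : \sum_i passmx.mxof e e A i i =
    \sum_(i < \dim {:X}) \sum_(x <- s) ip x (A e`_i) * coord e i x.
  apply: eq_bigr => i _; rewrite !mxE /= passmx.vecof_delta.
  rewrite {1}(onb_expand sP (memvf (A e`_i))) linear_sum.
  by apply: eq_bigr => x _; rewrite linearZ.
rewrite exchange_big; apply: eq_bigr => x _.
have -> : A x = \sum_(i < \dim {:X}) coord e i x *: A e`_i.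
  rewrite [x in LHS](coord_basis eB (memvf x)) linear_sum.
  by apply: eq_bigr => i _; rewrite linearZ.
rewrite (inner_sumr ipP); apply: eq_bigr => i _.
by rewrite (innerZr ipP) mulrC.
Qed.

Lemma onb_exists : exists s, orthonormal_basis ip {:X} s.
Proof. exact: (gram_schmidt ipP). Qed.

Lemma op_trace_linear a A B : op_trace (a *: A + B) = a * op_trace A + op_trace B.
Proof. by rewrite /op_trace passmx.mxof_linear mxtraceD mxtraceZ. Qed.

Lemma op_traceD A B : op_trace (A + B) = op_trace A + op_trace B.
Proof. by rewrite -[A in LHS]scale1r op_trace_linear mul1r. Qed.

Lemma op_traceZ a A : op_trace (a *: A) = a * op_trace A.
Proof.
have t0 : op_trace (0 : 'End(X)) = 0.
  have := op_traceD 0 0; rewrite addr0 => /eqP.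
  by rewrite -subr_eq0 opprD addrA subrr add0r oppr_eq0 => /eqP.
by rewrite -[_ *: _ in LHS]addr0 op_trace_linear t0 addr0.
Qed.

Lemma op_traceB A B : op_trace (A - B) = op_trace A - op_trace B.
Proof. by rewrite op_traceD -scaleN1r op_traceZ mulN1r. Qed.

Lemma op_traceC A B : op_trace (A \o B)%VF = op_trace (B \o A)%VF.
Proof.
rewrite /op_trace !(passmx.mxof_comp (vbasis {:X}) (vbasis {:X}) (vbasisP _)).
by rewrite mxtrace_mulC.
Qed.

Lemma op_trace1 : op_trace (\1%VF : 'End(X)) = (\dim {:X})%:R.
Proof.
by rewrite /op_trace passmx.mxof1 ?mxtrace1// (basis_free (vbasisP _)).
Qed.

Lemma adjointP A x y : ip (A x) y = ip x (adjoint ip A y).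
Proof.
rewrite /adjoint; case: xgetP => [B -> //|/(_ _) none].
have [s sP] := onb_exists; exfalso.
pose B := linfun (fun v => \sum_(z <- s) ip (A z) v *: z).
apply: (none B) => u v.
rewrite /B linfun_linearE; last first.
  move=> a p q; rewrite scaler_sumr -big_split/=; apply: eq_bigr => z _.
  by rewrite (innerDr ipP) (innerZr ipP) scalerDl scalerA.
rewrite [u in LHS](onb_expand sP (memvf u)) linear_sum (inner_suml ipP).
rewrite (inner_sumr ipP); apply: eq_bigr => z _.
by rewrite linearZ /= (innerZl ipP) (innerZr ipP) mulrC (innerC ipP u).
Qed.

Lemma adjoint_self_adjoint A : self_adjoint ip A -> adjoint ip A = A.
Proof.
move=> sA; apply/lfunP => y; apply: (inner_inj ipP) => x.
by rewrite -adjointP sA.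
Qed.

Lemma op_dotE s A B : orthonormal_basis ip {:X} s ->
  op_dot ip A B = \sum_(x <- s) ip (A x) (B x).
Proof.
move=> sP; rewrite /op_dot op_traceC (op_traceE _ sP).
by apply: eq_bigr => x _; rewrite comp_lfunE -adjointP (innerC ipP).
Qed.

Lemma op_dot_inner_product : inner_product (op_dot ip).
Proof.
have [s sP] := onb_exists; split=> [A B|a A B F|A A0].
- by rewrite !(op_dotE _ _ sP); apply: eq_bigr => x _; rewrite (innerC ipP).
- rewrite !(op_dotE _ _ sP) mulr_sumr -big_split/=; apply: eq_bigr => x _.
  by rewrite add_lfunE scale_lfunE (innerDl ipP) (innerZl ipP).
- rewrite (op_dotE _ _ sP) lt_neqAle sumr_ge0 ?andbT => [|x _]; last exact: inner_ge0 ipP _.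
  apply/eqP => /esym /eqP; rewrite psumr_eq0 => [|x _]; last exact: inner_ge0 ipP _.
  move=> /allP h; move/eqP: A0; apply; apply: (eq_on_basis sP) => x xs.
  by apply/eqP; rewrite zero_lfunE -(inner_eq0 ipP); exact: h.
Qed.
Local Notation odP := op_dot_inner_product.

Lemma op_dotEtrace A F : self_adjoint ip F -> op_dot ip A F = op_trace (A \o F)%VF.
Proof. by move=> sF; rewrite /op_dot adjoint_self_adjoint. Qed.

Lemma op_dot1r A : op_dot ip A \1%VF = op_trace A.
Proof. by rewrite op_dotEtrace ?comp_lfun1r//; exact: self_adjoint1. Qed.

Lemma op_dot_outer z F : self_adjoint ip F -> op_dot ip (outer ip z) F = ip z (F z).
Proof.
have [s sP] := onb_exists => sF; rewrite (op_dotE _ _ sP).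
rewrite (parseval ipP _ sP (memvf (F z))).
apply: eq_bigr => x _; rewrite linfun_linearE => [|a u v]; last first.
  by rewrite (innerDr ipP) (innerZr ipP) scalerDl scalerA.
by rewrite (innerZl ipP) -sF (innerC ipP z x) (innerC ipP (F z)).
Qed.

Lemma outerE z x : outer ip z x = ip z x *: z.
Proof.
rewrite linfun_linearE => // a u v.
by rewrite (innerDr ipP) (innerZr ipP) scalerDl scalerA.
Qed.

Lemma pos_semidef_outer z : pos_semidef ip (outer ip z).
Proof.
split=> [x y|x]; rewrite !outerE ?(innerZl ipP) (innerZr ipP).
  by rewrite (innerC ipP x) mulrC.
by rewrite (innerC ipP x) -expr2 sqr_ge0.
Qed.

Lemma pos_defW A : pos_def ip A -> pos_semidef ip A.
Proof.
case=> sA A0; split=> // x; have [->|/A0/ltW//] := eqVneq x 0.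
by rewrite (inner0l ipP).
Qed.

Lemma pos_semidefD A B :
  pos_semidef ip A -> pos_semidef ip B -> pos_semidef ip (A + B).
Proof.
move=> [sA A0] [sB B0]; split; first exact: self_adjointD.
by move=> x; rewrite add_lfunE (innerDr ipP) addr_ge0.
Qed.

Lemma pos_defD A B : pos_semidef ip A -> pos_def ip B -> pos_def ip (A + B).
Proof.
move=> [sA A0] [sB B0]; split; first exact: self_adjointD.
by move=> x x0; rewrite add_lfunE (innerDr ipP) ltr_wpDl// B0.
Qed.

Lemma pos_defZ a A : 0 < a -> pos_def ip A -> pos_def ip (a *: A).
Proof.
move=> a0 [sA A0]; split; first exact: self_adjointZ.
by move=> x x0; rewrite scale_lfunE (innerZr ipP) mulr_gt0// A0.
Qed.

Lemma pos_def1 : pos_def ip \1%VF.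
Proof. by split=> [|x x0]; [exact: self_adjoint1|rewrite id_lfunE (inner_gt0 ipP)]. Qed.

Lemma op_trace_ge0 A : pos_semidef ip A -> 0 <= op_trace A.
Proof.
have [s sP] := onb_exists => -[_ A0].
by rewrite (op_traceE _ sP); apply: sumr_ge0.
Qed.

Lemma op_dot_ge0 A F : pos_semidef ip A -> pos_semidef ip F -> 0 <= op_dot ip A F.
Proof.
move=> [sA A0] [sF F0]; have [s sP eigF] := eigenbasis sF.
rewrite (op_dotE _ _ sP) big_seq; apply: sumr_ge0 => x xs.
by rewrite (eigF x xs) (innerZr ipP) mulr_ge0// sA.
Qed.

Lemma op_sqrtP A : pos_semidef ip A ->
  pos_semidef ip (op_sqrt ip A) /\ (op_sqrt ip A \o op_sqrt ip A)%VF = A.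
Proof.
move=> [sA A0]; rewrite /op_sqrt; case: xgetP => [Q -> //|none]; exfalso.
have [s sP eigA] := eigenbasis sA.
pose Q := linfun (fun v => \sum_(z <- s) (Num.sqrt (ip z (A z)) * ip z v) *: z).
have QE v : Q v = \sum_(z <- s) (Num.sqrt (ip z (A z)) * ip z v) *: z.
  rewrite linfun_linearE// => a p q; rewrite scaler_sumr -big_split/=.
  apply: eq_bigr => z _.
  by rewrite (innerDr ipP) (innerZr ipP) mulrDr scalerDl scalerA mulrCA.
have Qs z : z \in s -> Q z = Num.sqrt (ip z (A z)) *: z.
  move=> zs; rewrite QE (bigD1_seq z)//= ?(onb_uniq sP)//.
  rewrite (onb_inner sP zs zs) eqxx mulr1 big_seq_cond big1 ?addr0// => x /andP[xs xz].
  by rewrite (onb_inner sP xs zs) (negPf xz) mulr0 scale0r.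
have ipQ u v : ip u (Q v) = \sum_(z <- s) Num.sqrt (ip z (A z)) * (ip z u * ip z v).
  rewrite QE (inner_sumr ipP); apply: eq_bigr => z _.
  by rewrite (innerZr ipP) (innerC ipP u) -mulrA [_ * ip z u]mulrC.
apply: (none Q); split; first split.
- by move=> u v; rewrite (innerC ipP) !ipQ; apply: eq_bigr => z _; rewrite [ip z v * _]mulrC.
- move=> v; rewrite ipQ; apply: sumr_ge0 => z _.
  by rewrite mulr_ge0 ?sqrtr_ge0// -expr2 sqr_ge0.
- apply: (eq_on_basis sP) => z zs; rewrite comp_lfunE (Qs z zs) linearZ /= (Qs z zs) scalerA.
  by rewrite -expr2 sqr_sqrtr ?A0// -eigA.
Qed.

(* If [D x = mu x] then [ip x ((Q^2 - P^2) x) = mu * ip x ((P + Q) x)]. *)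
Lemma sqr_sub_eigen P Q x mu : self_adjoint ip P -> self_adjoint ip Q ->
  (Q - P) x = mu *: x ->
  ip x (Q (Q x)) - ip x (P (P x)) = mu * (ip x (P x) + ip x (Q x)).
Proof.
move=> sP sQ; rewrite add_lfunE opp_lfunE => /eqP; rewrite subr_eq => /eqP Qx.
rewrite -(sP x) -(sQ x) Qx !(innerDl ipP) !(innerDr ipP) !(innerZl ipP) !(innerZr ipP).
by rewrite (innerC ipP (P x) x); ring.
Qed.

(** Operator monotonicity of the square root, checked on an eigenbasis of [Q - P]: a negative
    eigenvalue [mu] would force [<z, P z> + <z, Q z> <= 0], so both vanish and so does their
    difference [mu]. *)
Lemma sqr_le_sqrt_le P Q : pos_semidef ip P -> pos_semidef ip Q ->
  (forall x, ip x (P (P x)) <= ip x (Q (Q x))) ->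
  forall x, ip x (P x) <= ip x (Q x).
Proof.
move=> [sP P0] [sQ Q0] PQ.
have sD := self_adjointB sQ sP; have [s sB eigD] := eigenbasis sD.
have mu_ge0 z : z \in s -> 0 <= ip z ((Q - P) z).
  move=> zs; have h := sqr_sub_eigen sP sQ (eigD z zs).
  rewrite leNgt; apply/negP => mu0.
  have : 0 <= ip z ((Q - P) z) * (ip z (P z) + ip z (Q z)).
    by rewrite -h subr_ge0.
  rewrite nmulr_rge0// => h0.
  have := P0 z; have := Q0 z; have : ip z ((Q - P) z) = ip z (Q z) - ip z (P z).
    by rewrite add_lfunE opp_lfunE (innerBr ipP).
  by move: mu0 h0; lra.
move=> x; rewrite -subr_ge0.
have -> : ip x (Q x) - ip x (P x) = ip x ((Q - P) x).
  by rewrite add_lfunE opp_lfunE (innerBr ipP).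
rewrite (parseval ipP _ sB (memvf _)) big_seq; apply: sumr_ge0 => z zs.
by rewrite -sD eigD// (innerZl ipP) mulrCA mulr_ge0 ?mu_ge0// -expr2 sqr_ge0.
Qed.

Lemma op_sqrt_unique P Q : pos_semidef ip P -> pos_semidef ip Q ->
  (P \o P = Q \o Q)%VF -> P = Q.
Proof.
move=> pP pQ PQ.
have sD := self_adjointB pQ.1 pP.1; have [s sB eigD] := eigenbasis sD.
have PQx x : P (P x) = Q (Q x) by rewrite -!comp_lfunE PQ.
have h x : ip x ((Q - P) x) = 0.
  apply/eqP; rewrite add_lfunE opp_lfunE (innerBr ipP) subr_eq0 eq_le.
  by apply/andP; split; apply: sqr_le_sqrt_le => // z; rewrite PQx.
apply/esym/eqP; rewrite -subr_eq0; apply/eqP; apply: (eq_on_basis sB) => z zs.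
by rewrite eigD// h scale0r zero_lfunE.
Qed.

Lemma op_sqrt_sqr A : pos_semidef ip A -> op_sqrt ip (A \o A)%VF = A.
Proof.
move=> pA; have [sA A0] := pA.
have pAA : pos_semidef ip (A \o A)%VF.
  split=> [x y|x]; rewrite !comp_lfunE; first by rewrite !sA.
  by rewrite -sA (inner_ge0 ipP).
by have [p1 p2] := op_sqrtP pAA; exact: op_sqrt_unique.
Qed.

Lemma tr_normE A : pos_semidef ip A -> tr_norm ip A = op_trace A.
Proof.
by move=> pA; rewrite /tr_norm (adjoint_self_adjoint pA.1) op_sqrt_sqr.
Qed.

Lemma op_sqrt_pos_def A : pos_def ip A -> pos_def ip (op_sqrt ip A).
Proof.
move=> pA; have [[sQ Q0] QQ] := op_sqrtP (pos_defW pA); split=> // x x0.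
rewrite lt_neqAle Q0 andbT eq_sym; apply/eqP => Qx0.
(* With [Q] the root: [<x, A x>^2 = <Q x, Q x>^2 <= <Q x, Q Q x> <x, Q x>], and the last factor is
   assumed to vanish. *)
have := semi_cauchy_schwarz ipP (U := fullv) sQ (fun v _ => Q0 v) (memvf (op_sqrt ip A x)) (memvf x).
rewrite Qx0 mulr0 sQ -comp_lfunE QQ => h.
have : 0 < ip x (A x) ^+ 2 by rewrite exprn_gt0// pA.2.
by rewrite ltNge h.
Qed.

Lemma pos_def_ker A : pos_def ip A -> lker A == 0%VS.
Proof.
move=> [sA A0]; apply/lker0P => x y Axy; apply/eqP; rewrite -subr_eq0.
by apply/negPn/negP => /A0; rewrite linearB /= Axy subrr (inner0r ipP) ltxx.
Qed.

Lemma pos_def_invK A : pos_def ip A -> cancel A (A^-1)%VF.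
Proof. by move=> /pos_def_ker; exact: lker0_lfunK. Qed.

Lemma pos_def_invVK A : pos_def ip A -> cancel (A^-1)%VF A.
Proof. by move=> /pos_def_ker; exact: lker0_lfunVK. Qed.

Lemma pos_def_inv A : pos_def ip A -> pos_def ip (A^-1)%VF.
Proof.
move=> pA; have [sA A0] := pA; split=> [x y|x x0].
  by rewrite -{2}(pos_def_invVK pA x) sA pos_def_invVK.
rewrite -{1}(pos_def_invVK pA x) sA pos_def_invVK// (innerC ipP).
rewrite -{1}(pos_def_invVK pA x) (innerC ipP) A0//.
apply: contra x0 => /eqP Ax; by rewrite -(pos_def_invVK pA x) Ax linear0.
Qed.

(* Completion of the square: [0 <= ip (x - A^-1 v) (A (x - A^-1 v))]. *)
Lemma inv_quad_ge A v x : pos_def ip A ->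
  2 * ip v x - ip x (A x) <= ip v (A^-1%VF v).
Proof.
move=> pA; have [sA _] := pA.
have := (pos_defW pA).2 (x - A^-1%VF v).
rewrite linearB /= pos_def_invVK// (innerBl ipP) !(innerBr ipP) -(sA (A^-1%VF v) x).
rewrite pos_def_invVK// (innerC ipP (A^-1%VF v) v) (innerC ipP x v); lra.
Qed.

(** [<v, A^-1 v>] is the maximum over [x] of [2 <v, x> - <x, A x>]; it is tested at [B^-1 v]. *)
Lemma inv_quad_le A B v : pos_def ip A -> pos_def ip B ->
  (forall x, ip x (A x) <= ip x (B x)) ->
  ip v (B^-1%VF v) <= ip v (A^-1%VF v).
Proof.
move=> pA pB AB; have := inv_quad_ge v (B^-1%VF v) pA.
have := AB (B^-1%VF v); rewrite (pos_def_invVK pB) (innerC ipP _ v); lra.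
Qed.

Lemma young_quad A u v : pos_def ip A ->
  2 * ip u v <= ip u (A^-1%VF u) + ip v (A v).
Proof. by move=> pA; have := inv_quad_ge u v pA; lra. Qed.

Lemma op_dot_le A B F : self_adjoint ip A -> self_adjoint ip B ->
  (forall x, ip x (A x) <= ip x (B x)) ->
  pos_semidef ip F -> op_dot ip A F <= op_dot ip B F.
Proof.
move=> sA sB AB pF; rewrite -subr_ge0 -(innerBl odP); apply: op_dot_ge0 => //.
split; first exact: self_adjointB.
by move=> x; rewrite add_lfunE opp_lfunE (innerBr ipP) subr_ge0.
Qed.

End Operators.

(** * Inverse square roots by Newton iteration *)

Section RealNewton.
Context {R : realType}.

(* Newton's division-free iteration for [t^(-1/2)]; it converges for [0 < t <= 1]. *)
Fixpoint newton_root (t : R) (n : nat) : R :=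
  if n is k.+1 then
    3 / 2 * newton_root t k - 2^-1 * t * newton_root t k ^+ 3
  else 1.

(** In terms of [p = s z] a step maps [p] to [p (3 - p^2) / 2], which increases [p] on (0, 1] and
    multiplies the error [1 - p] by [(1 - p) (2 + p) / 2]. This factor is at most [1 - s / 2]
    because [p] never drops below its initial value [s]. *)
Lemma newton_rootP (s : R) n : 0 < s <= 1 ->
  s <= s * newton_root (s ^+ 2) n <= 1 /\
  1 - s * newton_root (s ^+ 2) n <= (1 - s / 2) ^+ n.
Proof.
move=> /andP[s0 s1]; elim: n => [|n [/andP[IH1 IH2] IH3]].
  by rewrite mulr1 lexx expr0 s1 lerBlDr lerDl ltW.
rewrite /=; set z := newton_root _ n in IH1 IH2 IH3 *; set p := s * z in IH1 IH2 IH3 *.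
have -> : s * (3 / 2 * z - 2^-1 * s ^+ 2 * z ^+ 3) = 3 / 2 * p - 2^-1 * p ^+ 3.
  by rewrite /p; field.
have p0 : 0 < p by exact: lt_le_trans IH1.
have e1 : 1 - (3 / 2 * p - 2^-1 * p ^+ 3) = (1 - p) * ((1 - p) * (2 + p) / 2) by field.
split; last first.
  rewrite e1 exprSr; apply: ler_pM => //; nra.
apply/andP; split.
  2: by rewrite -subr_ge0 e1 !mulr_ge0 ?subr_ge0 ?invr_ge0 ?addr_ge0// ltW.
apply: le_trans IH1 _; rewrite -subr_ge0.
have -> : 3 / 2 * p - 2^-1 * p ^+ 3 - p = 2^-1 * p * ((1 - p) * (1 + p)) by field.
by apply: mulr_ge0; [lra|apply: mulr_ge0; lra].
Qed.

Lemma newton_root_cvg (t : R) : 0 < t <= 1 ->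
  newton_root t n @[n --> \oo] --> (Num.sqrt t)^-1.
Proof.
move=> /andP[t0 t1]; set s := Num.sqrt t.
have s0 : 0 < s by rewrite sqrtr_gt0.
have s1 : s <= 1 by rewrite -sqrtr1 ler_wsqrtr.
have -> : t = s ^+ 2 by rewrite sqr_sqrtr// ltW.
have s01 : 0 < s <= 1 by rewrite s0.
suff h : s * newton_root (s ^+ 2) n @[n --> \oo] --> (1 : R).
  have : s^-1 * (s * newton_root (s ^+ 2) n) @[n --> \oo] --> s^-1 * 1.
    by apply: cvgM => //; exact: cvg_cst.
  rewrite mulr1; under eq_cvg do rewrite mulKf ?gt_eqF//.
  exact.
have g : (1 - s / 2) ^+ n @[n --> \oo] --> (0 : R).
  by apply: cvg_expr; rewrite ger0_norm; lra.
have g1 : 1 - (1 - s / 2) ^+ n @[n --> \oo] --> (1 : R).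
  by rewrite -[X in _ --> X]subr0; apply: cvgB => //; exact: cvg_cst.
apply: (squeeze_cvgr _ g1 (cvg_cst (1 : R))).
near=> n; have [/andP[_ h1] h2] := newton_rootP n s01.
by rewrite h1 andbT lerBlDr -lerBlDl.
Unshelve. all: by end_near. Qed.

Lemma cvg_sum_seq (T : eqType) (s : seq T) (f : nat -> T -> R) (l : T -> R) :
  {in s, forall x, f n x @[n --> \oo] --> l x} ->
  \sum_(x <- s) f n x @[n --> \oo] --> \sum_(x <- s) l x.
Proof.
elim: s => [|x s IH] h.
  by rewrite big_nil; under eq_cvg do rewrite big_nil; exact: cvg_cst.
rewrite big_cons; under eq_cvg do rewrite big_cons.
apply: cvgD; first by apply: h; rewrite mem_head.
by apply: IH => y ys; apply: h; rewrite inE ys orbT.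
Qed.

End RealNewton.

(** * The subspace [H], its orthogonal projection and operator Newton iterates *)

Section StructuredSubspace.
Context {R : realType} {X : vectType R} (ip : {dot X for idfun}).
Context (H : {vspace 'End(X)}) (sH : structured_subspace ip H).
Implicit Types (A B F P Q : 'End(X)) (x y z : X).
Local Notation ipP := (dot_inner_product ip).
Local Notation odP := (op_dot_inner_product ip).

Lemma structured_self_adjoint A : A \in H -> self_adjoint ip A.
Proof. by case: sH => h _ _ _; exact: h. Qed.

Lemma structured_congr A F : A \in H -> F \in H -> (A \o F \o A)%VF \in H.
Proof. by case: sH => _ _ h _; exact: h. Qed.

Lemma structured1 : \1%VF \in H. Proof. by case: sH. Qed.

(* Polarization of [A \o F \o A] at [A] and [\1]. *)
Lemma structured_jordan A F : A \in H -> F \in H ->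
  ((A \o F) + (F \o A))%VF \in H.
Proof.
move=> AH FH.
have -> : ((A \o F) + (F \o A))%VF =
    ((A + \1) \o F \o (A + \1))%VF - (A \o F \o A)%VF - F.
  apply/lfunP => v; rewrite !(add_lfunE, opp_lfunE, comp_lfunE, id_lfunE).
  rewrite !linearD /=.
  move: (F v) (F (A v)) => d c; move: (A d) (A c) => p q.
  by rewrite -(addrA q) (addrC q) addrK addrA addrK.
by rewrite !rpredB// structured_congr// rpredD// structured1.
Qed.

Lemma oprojP A : oproj ip H A \in H /\
  forall F, F \in H -> op_dot ip (A - oproj ip H A) F = 0.
Proof.
rewrite /oproj; case: xgetP => [P -> //|none]; exfalso.
have [s sP] := gram_schmidt odP H.
apply: (none (\sum_(F <- s) op_dot ip F A *: F)); split.
  by rewrite big_seq rpred_sum// => F Fs; rewrite rpredZ// (onb_sub sP).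
move=> F FH; rewrite (innerBl odP) (parseval odP A sP FH) (inner_suml odP).
by apply/eqP; rewrite subr_eq0; apply/eqP; apply: eq_bigr => G _; rewrite (innerZl odP).
Qed.

Lemma oproj_in A : oproj ip H A \in H. Proof. exact: (oprojP A).1. Qed.

Lemma op_dot_oproj A F : F \in H -> op_dot ip (oproj ip H A) F = op_dot ip A F.
Proof.
move=> FH; have := (oprojP A).2 F FH; rewrite (innerBl odP) => /eqP.
by rewrite subr_eq0 => /eqP.
Qed.

Lemma oproj_unique A P : P \in H ->
  (forall F, F \in H -> op_dot ip P F = op_dot ip A F) -> oproj ip H A = P.
Proof.
move=> PH h; apply/eqP; rewrite -subr_eq0 -(inner_eq0 odP).
by rewrite (innerBl odP) op_dot_oproj ?h ?subrr ?rpredB// oproj_in.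
Qed.

Lemma oproj_linear : linear (oproj ip H).
Proof.
move=> a A B; apply: oproj_unique => [|F FH].
  by rewrite rpredD ?rpredZ ?oproj_in.
by rewrite !(innerDl odP) !(innerZl odP) !op_dot_oproj.
Qed.

Lemma oprojD A B : oproj ip H (A + B) = oproj ip H A + oproj ip H B.
Proof. by rewrite -[A in LHS]scale1r oproj_linear scale1r. Qed.

Lemma oproj0 : oproj ip H 0 = 0.
Proof. by apply: oproj_unique => [|F FH]; rewrite ?mem0v. Qed.

Lemma oprojZ a A : oproj ip H (a *: A) = a *: oproj ip H A.
Proof. by rewrite -[_ *: _ in LHS]addr0 oproj_linear oproj0 addr0. Qed.

Lemma oprojB A B : oproj ip H (A - B) = oproj ip H A - oproj ip H B.
Proof. by rewrite oprojD -scaleN1r oprojZ scaleN1r. Qed.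

Lemma oproj_id A : A \in H -> oproj ip H A = A.
Proof. by move=> AH; apply: oproj_unique. Qed.

(** The assumption on [H] concerns positive definite operators; a small multiple of the identity is
    added, which the projection fixes, and its size tends to zero. *)
Lemma pos_semidef_oproj A : pos_semidef ip A -> pos_semidef ip (oproj ip H A).
Proof.
move=> pA; split; first by apply: structured_self_adjoint; exact: oproj_in.
move=> x; apply/ler_addgt0Pl => e e0.
have pe : pos_def ip (A + (e / (ip x x + 1)) *: \1%VF).
  apply: pos_defD => //; apply: pos_defZ; last exact: pos_def1.
  by rewrite divr_gt0// ltr_wpDl// (inner_ge0 ipP).
have : pos_def ip (oproj ip H (A + (e / (ip x x + 1)) *: \1%VF)).
  by case: sH => _ _ _; apply.
move=> /pos_defW[_ /(_ x)]; rewrite oprojD oprojZ (oproj_id structured1).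
rewrite add_lfunE scale_lfunE id_lfunE (innerDr ipP) (innerZr ipP) => h.
apply: le_trans h _; rewrite addrC lerD2r -mulrA ger_pMr// mulrC ler_pdivrMr ?mul1r ?lerDl//.
by rewrite ltr_wpDl// (inner_ge0 ipP).
Qed.

(** Congruence by [A] preserves [H] and is symmetric for the trace pairing, so it commutes with the
    orthogonal projection. *)
Lemma oproj_congr A B : A \in H ->
  oproj ip H (A \o B \o A)%VF = (A \o oproj ip H B \o A)%VF.
Proof.
move=> AH; have sA := structured_self_adjoint AH.
apply: oproj_unique; first by rewrite structured_congr// oproj_in.
move=> F FH; have sF := structured_self_adjoint FH.
have key M : op_dot ip (A \o M \o A)%VF F = op_dot ip M (A \o F \o A)%VF.
  rewrite !op_dotEtrace//; last exact: self_adjoint_congr.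
  by rewrite -!comp_lfunA op_traceC -!comp_lfunA.
by rewrite !key op_dot_oproj// structured_congr.
Qed.

(* The cubic term [Z^3 A] is symmetrized so that the iterates are Jordan polynomials in [A]
   and remain in [H]. *)
Fixpoint newton_op (A : 'End(X)) (n : nat) : 'End(X) :=
  if n is k.+1 then
    let Z := newton_op A k in
    (3 / 2) *: Z - 4^-1 *: ((Z \o (Z \o A \o Z)) + ((Z \o A \o Z) \o Z))%VF
  else \1%VF.

Lemma newton_op_in A n : A \in H -> newton_op A n \in H.
Proof.
move=> AH; elim: n => [|n IH] /=; first exact: structured1.
by rewrite rpredB ?rpredZ// structured_jordan// structured_congr.
Qed.

Lemma newton_op_eigen A t x n : A x = t *: x ->
  newton_op A n x = newton_root t n *: x.
Proof.
move=> Ax; elim: n => [|n IH]; first by rewrite id_lfunE scale1r.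
set r := newton_root t n.+1 => /=.
rewrite !(add_lfunE, opp_lfunE, scale_lfunE, comp_lfunE) !IH.
do 6 rewrite ?linearZ /= ?Ax ?IH.
rewrite !scalerA -scalerDl scalerN scalerA -scalerBl; congr (_ *: _).
by rewrite /r /=; field.
Qed.

(** [(Q + r) (Q x - r x) = A x - t x = 0] with [r = sqrt t], and [Q + r] is injective. *)
Lemma op_sqrt_eigen A t x : pos_def ip A -> 0 < t -> A x = t *: x ->
  op_sqrt ip A x = Num.sqrt t *: x.
Proof.
move=> pA t0 Ax; have [pQ QQ] := op_sqrtP (pos_defW pA).
set Q := op_sqrt ip A in pQ QQ *; set r := Num.sqrt t.
have pQr : pos_def ip (Q + r *: \1%VF).
  by apply: pos_defD => //; apply: pos_defZ; rewrite ?sqrtr_gt0//; exact: pos_def1.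
apply/eqP; rewrite -subr_eq0; apply/eqP.
move/lker0P: (pos_def_ker pQr); apply; rewrite linear0.
rewrite add_lfunE scale_lfunE id_lfunE linearB linearZ /= -comp_lfunE QQ Ax.
rewrite scalerBr scalerA -expr2 sqr_sqrtr ?ltW//.
by rewrite addrA addrNK subrr.
Qed.

Lemma pos_def_eigen_gt0 A s : orthonormal_basis ip {:X} s -> pos_def ip A ->
  {in s, forall x, 0 < ip x (A x) <= op_trace A}.
Proof.
move=> sP pA x xs; have x0 : x != 0.
  by rewrite -(inner_eq0 ipP) (onb_inner sP xs xs) eqxx oner_eq0.
rewrite pA.2//= (op_traceE _ sP) (bigD1_seq x) ?(onb_uniq sP)//= lerDl.
by apply: sumr_ge0 => y _; exact: (pos_defW pA).2.
Qed.

Lemma inv_op_sqrt_eigen A s : orthonormal_basis ip {:X} s -> pos_def ip A ->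
  {in s, forall x, A x = ip x (A x) *: x} ->
  {in s, forall x, (op_sqrt ip A)^-1%VF x = (Num.sqrt (ip x (A x)))^-1 *: x}.
Proof.
move=> sP pA eigA x xs; have /andP[l0 _] := pos_def_eigen_gt0 sP pA xs.
apply: (can_inj (pos_def_invK (op_sqrt_pos_def pA))).
rewrite (pos_def_invVK (op_sqrt_pos_def pA)).
rewrite linearZ /= (op_sqrt_eigen pA l0 (eigA x xs)) scalerA mulVf ?scale1r//.
by rewrite gt_eqF// sqrtr_gt0.
Qed.

(** Dividing by the trace moves the spectrum into (0, 1], where the scalar iteration converges; the
    factor [sqrt (tr A)] undoes the scaling. Convergence is stated on scalars [ip u (_ v)], so
    limits are taken in [R] only. *)
Lemma newton_op_cvg A u v : pos_def ip A ->
  ip u (newton_op ((op_trace A)^-1 *: A) n v) @[n --> \oo] -->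
  Num.sqrt (op_trace A) * ip u ((op_sqrt ip A)^-1%VF v).
Proof.
move=> pA; have [s sP eigA] := eigenbasis pA.1; set c := op_trace A.
have ipE (F : 'End(X)) : ip u (F v) = \sum_(x <- s) ip x v * ip u (F x).
  rewrite {1}(onb_expand sP (memvf v)) linear_sum (inner_sumr ipP).
  by apply: eq_bigr => x _; rewrite linearZ /= (innerZr ipP).
rewrite ipE mulr_sumr big_seq; under eq_cvg do rewrite ipE big_seq.
have : {in s, forall x, 0 < ip x (A x) / c <= 1 /\ 0 < c}.
  move=> x xs; have /andP[l0 lc] := pos_def_eigen_gt0 sP pA xs.
  have c0 : 0 < c by exact: lt_le_trans lc.
  by split=> //; rewrite divr_gt0//= ler_pdivrMr// mul1r.
move=> s01.
apply: (@cvg_trans _ ((fun n => \sum_(x <- s | x \in s)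
    ip x v * (newton_root (ip x (A x) / c) n * ip u x)) @ \oo)).
  apply: near_eq_cvg; near=> n; apply: eq_bigr => x xs; congr (_ * _).
  rewrite (@newton_op_eigen _ (ip x (A x) / c)) ?(innerZr ipP)//.
  by rewrite scale_lfunE {1}(eigA x xs) scalerA mulrC.
have h x : x \in s -> ip x v * (newton_root (ip x (A x) / c) n * ip u x)
     @[n --> \oo] --> Num.sqrt c * (ip x v * ip u ((op_sqrt ip A)^-1%VF x)).
  move=> xs; have [l01 c0] := s01 x xs.
  have /andP[l0 _] := pos_def_eigen_gt0 sP pA xs.
  rewrite (inv_op_sqrt_eigen sP pA eigA)// (innerZr ipP).
  have -> : Num.sqrt c * (ip x v * ((Num.sqrt (ip x (A x)))^-1 * ip u x)) =
      ip x v * ((Num.sqrt (ip x (A x) / c))^-1 * ip u x).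
    rewrite sqrtrM ?ltW// sqrtrV ?ltW// invfM invrK.
    ring.
  by apply: cvgM; [exact: cvg_cst|apply: cvgM; [exact: newton_root_cvg|exact: cvg_cst]].
under eq_cvg do rewrite -big_seq.
by rewrite -big_seq; exact: cvg_sum_seq.
Unshelve. all: by end_near. Qed.

End StructuredSubspace.

(** * Traces of square roots *)

Section Potential.
Context {R : realType} {X : vectType R} (ip : {dot X for idfun}).
Implicit Types (A B F P Q M S : 'End(X)) (x y z m v : X).
Local Notation ipP := (dot_inner_product ip).
Local Notation odP := (op_dot_inner_product ip).
Local Notation sqrt_op := (op_sqrt ip).

Lemma op_sqrtK A : pos_def ip A -> (sqrt_op A \o sqrt_op A)%VF = A.
Proof. by move=> /pos_defW /op_sqrtP[]. Qed.

Lemma pos_def_sym A x y : pos_def ip A -> ip (A x) y = ip x (A y).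
Proof. by case=> sA _; exact: sA. Qed.

Lemma op_dot_inv_sqrt A : pos_def ip A ->
  op_dot ip A (sqrt_op A)^-1%VF = op_trace (sqrt_op A).
Proof.
move=> pA; have pQ := op_sqrt_pos_def pA.
rewrite op_dotEtrace; last exact: (pos_def_inv pQ).1.
by rewrite -[A in (A \o _)%VF](op_sqrtK pA) (lker0_compfK (pos_def_ker pQ)).
Qed.

(** Young's inequality in the metric [Z] for [sqrt A x] and [x], summed over an orthonormal basis.
    By [op_dot_inv_sqrt] it is an equality at [Z = sqrt A]. *)
Lemma op_trace_sqrt_le A Z : pos_def ip A -> pos_def ip Z ->
  2 * op_trace (sqrt_op A) <= op_trace Z + op_dot ip A (Z^-1)%VF.
Proof.
move=> pA pZ; have [s sP] := onb_exists ip.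
have pQ := op_sqrt_pos_def pA; have pZi := pos_def_inv pZ.
have -> : op_dot ip A (Z^-1)%VF =
    \sum_(x <- s) ip (sqrt_op A x) (Z^-1%VF (sqrt_op A x)).
  rewrite op_dotEtrace; last exact: pZi.1.
  rewrite -[A in (A \o _)%VF](op_sqrtK pA) -comp_lfunA op_traceC (op_traceE _ sP).
  by apply: eq_bigr => x _; rewrite !comp_lfunE -(pos_def_sym _ _ pQ).
rewrite !(op_traceE _ sP) mulr_sumr -big_split/=; apply: ler_sum => x _.
by rewrite (innerC ipP x (sqrt_op A x)) addrC; exact: young_quad.
Qed.

Lemma op_sqrt_mono A B : pos_def ip A -> pos_def ip B ->
  (forall x, ip x (A x) <= ip x (B x)) ->
  forall x, ip x (sqrt_op A x) <= ip x (sqrt_op B x).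
Proof.
move=> pA pB AB; apply: sqr_le_sqrt_le; try by apply: pos_defW; exact: op_sqrt_pos_def.
by move=> x; rewrite -!comp_lfunE !op_sqrtK.
Qed.

(* With [G = sqrt A + sqrt B] and [D = sqrt B - sqrt A], [G D + D G = 2 (B - A)]. *)
Lemma op_trace_sqrtB A B : pos_def ip A -> pos_def ip B ->
  op_trace (sqrt_op B) - op_trace (sqrt_op A) =
    op_dot ip (B - A) ((sqrt_op A + sqrt_op B)^-1)%VF.
Proof.
move=> pA pB; set a := sqrt_op A; set b := sqrt_op B.
have pa : pos_def ip a by exact: op_sqrt_pos_def.
have pb : pos_def ip b by exact: op_sqrt_pos_def.
have pG : pos_def ip (a + b) by apply: pos_defD => //; exact: pos_defW.
set G := a + b in pG *; set D := b - a.
have e : (B - A) = 2^-1 *: ((G \o D) + (D \o G))%VF.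
  rewrite -(op_sqrtK pA) -(op_sqrtK pB) -/a -/b /G /D.
  apply/lfunP => x.
  rewrite !(add_lfunE, opp_lfunE, scale_lfunE, comp_lfunE) !linearD !linearN /=.
  apply: (inner_inj ipP) => z.
  by rewrite !(innerDr ipP, innerZr ipP, innerNr ipP); field.
have sGi : self_adjoint ip (G^-1)%VF by exact: (pos_def_inv pG).1.
rewrite e (innerZl odP) (innerDl odP) !op_dotEtrace//.
rewrite [op_trace ((G \o D) \o _)%VF]op_traceC (lker0_compKf (pos_def_ker pG)).
rewrite -comp_lfunA (lker0_compfV (pos_def_ker pG)) comp_lfun1r.
by rewrite /D op_traceB; field.
Qed.

(** Both differences pair [B - A] with the inverse of a sum of two roots. Adding [M] enlarges the
    roots and so shrinks that inverse. *)
Lemma op_trace_sqrt_submodular A B M : pos_def ip A -> pos_def ip B ->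
  pos_semidef ip M -> (forall x, ip x (A x) <= ip x (B x)) ->
  op_trace (sqrt_op (M + B)) - op_trace (sqrt_op (M + A)) <=
  op_trace (sqrt_op B) - op_trace (sqrt_op A).
Proof.
move=> pA pB pM AB.
have pMA := pos_defD pM pA; have pMB := pos_defD pM pB.
rewrite !op_trace_sqrtB// opprD addrACA subrr add0r.
have p1 : pos_def ip (sqrt_op A + sqrt_op B).
  by apply: pos_defD; [apply: pos_defW|]; exact: op_sqrt_pos_def.
have p2 : pos_def ip (sqrt_op (M + A) + sqrt_op (M + B)).
  by apply: pos_defD; [apply: pos_defW|]; exact: op_sqrt_pos_def.
rewrite !(innerC odP (B - A)); apply: op_dot_le.
- exact: (pos_def_inv p2).1.
- exact: (pos_def_inv p1).1.
- move=> x; apply: inv_quad_le => // y.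
  rewrite !add_lfunE !(innerDr ipP); apply: lerD; apply: op_sqrt_mono => // z.
    by rewrite add_lfunE (innerDr ipP) lerDr pM.2.
  by rewrite add_lfunE (innerDr ipP) lerDr pM.2.
- split; first by apply: self_adjointB; [exact: pB.1|exact: pA.1].
  by move=> x; rewrite add_lfunE opp_lfunE (innerBr ipP) subr_ge0.
Qed.

(** The variational bound on [tr (sqrt A)] at the test operator [sqrt B]. It makes sums of quadratic
    terms weighted by the current inverse root telescope. *)
Lemma op_dot_increment_le A B : pos_def ip A -> pos_def ip B ->
  op_dot ip (B - A) (sqrt_op B)^-1%VF <=
  2 * (op_trace (sqrt_op B) - op_trace (sqrt_op A)).
Proof.
move=> pA pB; rewrite (innerBl odP) op_dot_inv_sqrt//.
have := op_trace_sqrt_le pA (op_sqrt_pos_def pB); lra.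
Qed.

End Potential.

(** * Roots and inverses stay in [H] *)

Section Structured.
Context {R : realType} {X : vectType R} (ip : {dot X for idfun}).
Context (H : {vspace 'End(X)}) (sH : structured_subspace ip H).
Implicit Types (A B F P Q M S : 'End(X)) (x y z m v : X).
Local Notation ipP := (dot_inner_product ip).
Local Notation odP := (op_dot_inner_product ip).
Local Notation sqrt_op := (op_sqrt ip).
Local Notation proj := (oproj ip H).

(** Let [W] be the component of [A^(-1/2)] orthogonal to [H]. Newton iterates lie in [H], so [W] is
    orthogonal to all of them and, in the limit, to [A^(-1/2)]; then [<W, W> = 0]. *)
Lemma inv_op_sqrt_in A : A \in H -> pos_def ip A -> (sqrt_op A)^-1%VF \in H.
Proof.
move=> AH pA; set Q := (sqrt_op A)^-1%VF.
have [s sP] := onb_exists ip.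
pose W := Q - proj Q.
have W0 F : F \in H -> op_dot ip W F = 0 by exact: (oprojP ip H Q).2.
suff WQ : op_dot ip W Q = 0.
  have : op_dot ip W W = 0.
    by rewrite {2}/W (innerBr odP) WQ W0 ?subrr// oproj_in.
  move/eqP; rewrite (inner_eq0 odP) subr_eq0 => /eqP ->; exact: oproj_in.
set c := op_trace A.
have cvg_dot : op_dot ip W (newton_op (c^-1 *: A) n) @[n --> \oo] -->
    Num.sqrt c * op_dot ip W Q.
  under eq_cvg do rewrite (op_dotE _ _ sP).
  rewrite (op_dotE _ _ sP) mulr_sumr; apply: cvg_sum_seq => x xs.
  exact: newton_op_cvg.
have dot0 n : op_dot ip W (newton_op (c^-1 *: A) n) = 0.
  by rewrite W0//; apply: (newton_op_in sH); rewrite rpredZ.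
have : Num.sqrt c * op_dot ip W Q = 0.
  move: cvg_dot; rewrite (_ : (fun n => _) = cst 0); last exact/funext.
  by move=> /(cvg_lim (@Rhausdorff R)) <-; rewrite lim_cst.
(* A nonpositive trace leaves no vector in the basis, and the pairing is an empty sum. *)
move/eqP; rewrite mulf_eq0 => /orP[|/eqP//]; rewrite sqrtr_eq0 => c0.
rewrite (op_dotE _ _ sP) big_seq big1// => x xs.
by have /andP[/lt_le_trans h /h] := pos_def_eigen_gt0 sP pA xs; rewrite ltNge c0.
Qed.

(** The Jordan product of [A] and [A^(-1/2)] is twice the root. *)
Lemma op_sqrt_in A : A \in H -> pos_def ip A -> sqrt_op A \in H.
Proof.
move=> AH pA; have QH := inv_op_sqrt_in AH pA.
have pZ := op_sqrt_pos_def pA.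
have AQ : (A \o (sqrt_op A)^-1)%VF = sqrt_op A.
  by rewrite -[A in (A \o _)%VF](op_sqrtK pA) (lker0_compfK (pos_def_ker pZ)).
have QA : ((sqrt_op A)^-1 \o A)%VF = sqrt_op A.
  by rewrite -[A in (_ \o A)%VF](op_sqrtK pA) (lker0_compKf (pos_def_ker pZ)).
have := structured_jordan sH AH QH; rewrite AQ QA -mulr2n => ZH.
by rewrite -[sqrt_op A](scalerK (_ : (2 : R) != 0)) ?pnatr_eq0// rpredZ// scaler_nat.
Qed.

Lemma pos_def_inv_in A : A \in H -> pos_def ip A -> (A^-1)%VF \in H.
Proof.
move=> AH pA; have QH := inv_op_sqrt_in AH pA.
have pZ := op_sqrt_pos_def pA.
suff -> : (A^-1)%VF =
    ((sqrt_op A)^-1 \o \1 \o (sqrt_op A)^-1)%VF.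
  by apply: (structured_congr sH) => //; exact: (structured1 sH).
apply/lfunP => x; apply: (can_inj (pos_def_invK pA)).
rewrite (pos_def_invVK pA) -{1}(op_sqrtK pA) !comp_lfunE id_lfunE.
by rewrite !(pos_def_invVK pZ).
Qed.

End Structured.

(** * The dual potential *)

Lemma gradient_unique (R : realType) (X : vectType R) (ip : {dot X for idfun})
    (F : X -> R) x g : is_gradient ip F x g -> gradient ip F x = g.
Proof.
pose ipP := dot_inner_product ip.
move=> gP; rewrite /gradient; case: xgetP => [g' _ g'P|/(_ g)//].
apply/eqP; rewrite -subr_eq0; apply/negPn/negP => u0.
set u := g' - g in u0; have n0 : 0 < enorm ip u by rewrite sqrtr_gt0 (inner_gt0 ipP).
have nn : ip u u = enorm ip u ^+ 2 by rewrite sqr_sqrtr// (inner_ge0 ipP).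
(* Along [h = t u] the two linear parts differ by [t |u|^2], while each remainder is at most
   [t |u|^2 / 4]. *)
have e0 : 0 < enorm ip u / 4 by rewrite divr_gt0.
have [d1 d10 h1] := gP _ e0; have [d2 d20 h2] := g'P _ e0.
pose t := Num.min d1 d2 / (2 * enorm ip u).
have m0 : 0 < Num.min d1 d2 by rewrite lt_min d10.
have t0 : 0 < t by rewrite divr_gt0// mulr_gt0.
have ntu : enorm ip (t *: u) = t * enorm ip u.
  rewrite /enorm (innerZl ipP) (innerZr ipP) mulrA -expr2 sqrtrM ?sqr_ge0//.
  by rewrite sqrtr_sqr gtr0_norm.
have lt_m : enorm ip (t *: u) < Num.min d1 d2.
  rewrite ntu /t invfM mulrA mulrVK ?unitfE ?gt_eqF//.
  by rewrite ltr_pdivrMr// mulr_natr mulr2n ltrDl.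
move: lt_m; rewrite lt_min => /andP[lt1 lt2].
have := h1 _ lt1; have := h2 _ lt2; rewrite ntu !(innerZr ipP).
rewrite !ler_norml => /andP[a1 a2] /andP[a3 a4].
have guu : ip g' u - ip g u = enorm ip u ^+ 2 by rewrite -(innerBl ipP).
have : 0 < t * enorm ip u ^+ 2 by rewrite mulr_gt0// exprn_gt0.
nra.
Qed.

Section Psi.
Context {R : realType} {X : vectType R} (ip : {dot X for idfun}).
Context (H : {vspace 'End(X)}) (sH : structured_subspace ip H).
Context (r : R) (r_gt0 : 0 < r).
Implicit Types (A B F P Q M S : 'End(X)) (x y z m v : X).
Local Notation ipP := (dot_inner_product ip).
Local Notation odP := (op_dot_inner_product ip).
Local Notation sqrt_op := (op_sqrt ip).
Local Notation proj := (oproj ip H).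

Definition leon_op S m := oproj ip H (outer ip m) + S.

Definition leon_inv S m : 'End(X) := ((op_sqrt ip (leon_op S m))^-1)%VF.

Lemma leon_op_in S m : S \in H -> leon_op S m \in H.
Proof. by move=> SH; rewrite rpredD// oproj_in. Qed.

Lemma pos_semidef_oproj_outer m : pos_semidef ip (proj (outer ip m)).
Proof. by apply: (pos_semidef_oproj sH); exact: pos_semidef_outer. Qed.

Lemma pos_def_leon_op S m : pos_def ip S -> pos_def ip (leon_op S m).
Proof. by apply: pos_defD; exact: pos_semidef_oproj_outer. Qed.

Lemma pos_def_leon_inv S m : pos_def ip S -> pos_def ip (leon_inv S m).
Proof. by move=> pS; apply: pos_def_inv; apply: op_sqrt_pos_def; exact: pos_def_leon_op. Qed.

Lemma leon_inv_in S m : S \in H -> pos_def ip S -> leon_inv S m \in H.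
Proof. by move=> SH pS; apply: (inv_op_sqrt_in sH); [exact: leon_op_in|exact: pos_def_leon_op]. Qed.

Lemma Psi_starE S m : pos_def ip S ->
  Psi_star ip H r S m = r * op_trace (sqrt_op (leon_op S m)).
Proof.
by move=> pS; rewrite /Psi_star tr_normE//; apply: pos_defW;
  apply: op_sqrt_pos_def; exact: pos_def_leon_op.
Qed.

Lemma op_dot_leon_op S m F : F \in H ->
  op_dot ip (leon_op S m) F = ip m (F m) + op_dot ip S F.
Proof.
move=> FH; rewrite (innerDl odP) op_dot_oproj// op_dot_outer//.
exact: (structured_self_adjoint sH).
Qed.

Lemma outer_congr Q m : self_adjoint ip Q ->
  outer ip (Q m) = (Q \o outer ip m \o Q)%VF.
Proof.
move=> sQ; apply/lfunP => x; rewrite !(comp_lfunE, outerE) linearZ /=.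
by rewrite -sQ.
Qed.

Lemma op_dot_congr Q M F : self_adjoint ip Q -> self_adjoint ip F ->
  op_dot ip (Q \o M \o Q)%VF F = op_dot ip M (Q \o F \o Q)%VF.
Proof.
move=> sQ sF; rewrite !op_dotEtrace//; last exact: self_adjoint_congr.
by rewrite -!comp_lfunA op_traceC -!comp_lfunA.
Qed.

Lemma leon_inv_congr S m : pos_def ip S ->
  (leon_inv S m \o leon_op S m \o leon_inv S m)%VF = \1%VF.
Proof.
move=> pS; have pA := pos_def_leon_op m pS; have pZ := op_sqrt_pos_def pA.
rewrite -[in X in (_ \o X \o _)%VF](op_sqrtK pA).
apply/lfunP => x; rewrite !comp_lfunE id_lfunE /leon_inv.
by rewrite (pos_def_invVK pZ) (pos_def_invK pZ).
Qed.

Lemma op_trace_leonE S m : S \in H -> pos_def ip S ->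
  op_trace (sqrt_op (leon_op S m)) =
  ip m (leon_inv S m m) + op_dot ip S (leon_inv S m).
Proof.
move=> SH pS; rewrite -op_dot_inv_sqrt ?op_dot_leon_op//; last exact: pos_def_leon_op.
exact: leon_inv_in.
Qed.

(** The operator inequality [2 Q - Q Z Q <= Z^-1], a completed square in the metric [Z], paired with
    [S]. *)
Lemma op_dot_inv_ge S Q Z : pos_def ip S -> self_adjoint ip Q -> pos_def ip Z ->
  2 * op_dot ip S Q - op_dot ip S (Q \o Z \o Q)%VF <= op_dot ip S (Z^-1)%VF.
Proof.
move=> pS sQ pZ; have [s sP] := onb_exists ip; have pT := op_sqrt_pos_def pS.
have key F : self_adjoint ip F ->
    op_dot ip S F = \sum_(x <- s) ip (sqrt_op S x) (F (sqrt_op S x)).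
  move=> sF; rewrite op_dotEtrace// -[S in (S \o _)%VF](op_sqrtK pS) -comp_lfunA.
  rewrite op_traceC (op_traceE _ sP).
  by apply: eq_bigr => x _; rewrite !comp_lfunE (pos_def_sym _ _ pT).
rewrite (key Q)// (key _ (self_adjoint_congr sQ pZ.1)) (key _ (pos_def_inv pZ).1).
rewrite mulr_sumr -sumrB; apply: ler_sum => x _.
by rewrite !comp_lfunE -[X in _ - X]sQ; exact: inv_quad_ge.
Qed.

(** Write [tr Z'], with [Z'] the root at [m'], as [<m', Z'^-1 m'> + <S, Z'^-1>] and bound both terms
    below by completing squares at [Q], the inverse root at [m]. The two quadratic losses add up to
    the pairing of [leon_op S m] with [Q Z' Q], which is again [tr Z']; dropping the projection
    there requires [Q Z' Q] in [H]. *)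
Lemma Psi_star_convex S m m' : S \in H -> pos_def ip S ->
  Psi_star ip H r S m + r * ip (m' - m) (leon_inv S m m) <= Psi_star ip H r S m'.
Proof.
move=> SH pS; rewrite !Psi_starE// -mulrDr ler_pM2l// (innerBl ipP).
have pA' := pos_def_leon_op m' pS; have pZ' := op_sqrt_pos_def pA'.
have pQ := pos_def_leon_inv m pS; have QH := leon_inv_in m SH pS.
have Z'H : sqrt_op (leon_op S m') \in H by apply: (op_sqrt_in sH) => //; exact: leon_op_in.
have sQ := pQ.1; set Q := leon_inv S m in pQ QH sQ *; set Z' := sqrt_op (leon_op S m') in pZ' Z'H *.
have tE : op_trace Z' = ip m' (Z'^-1%VF m') + op_dot ip S (Z'^-1)%VF by exact: op_trace_leonE.
rewrite op_trace_leonE// -/Q.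
have h1 := inv_quad_ge m' (Q m) pZ'.
have h2 := op_dot_inv_ge pS sQ pZ'.
have h3 : ip (Q m) (Z' (Q m)) + op_dot ip S (Q \o Z' \o Q)%VF = op_trace Z'.
  rewrite sQ -!comp_lfunE -op_dot_leon_op; last exact: (structured_congr sH).
  rewrite -op_dot_congr//; last exact: pZ'.1.
  by rewrite leon_inv_congr// (innerC odP) op_dot1r.
move: h1 h2 h3 tE; clear.
move: (ip (Q m) _) (op_dot _ _ (_ \o _ \o _)%VF) (op_dot _ _ (Z'^-1)%VF) (ip m' (Z'^-1%VF _)).
move: (op_dot _ _ Q) (ip m' (Q m)) (ip m (Q m)) (op_trace _) => a b c d e f g h.
lra.
Qed.

(** The variational bound for the root at [m + v], tested at the root at [m], is quadratic in [v];
    its curvature [leon_inv S m] is at most [S^(-1/2)]. *)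
Lemma Psi_star_smooth S m v : S \in H -> pos_def ip S ->
  Psi_star ip H r S (m + v) <= Psi_star ip H r S m + r * ip v (leon_inv S m m) +
    r / 2 * ip v ((sqrt_op S)^-1%VF v).
Proof.
move=> SH pS; rewrite !Psi_starE//.
have pA := pos_def_leon_op m pS; have pA' := pos_def_leon_op (m + v) pS.
have pZ := op_sqrt_pos_def pA.
have QH := leon_inv_in m SH pS; have pQ := pos_def_leon_inv m pS.
have h1 := op_trace_sqrt_le pA' pZ.
move: h1; rewrite -/(leon_inv S m) op_dot_leon_op// linearD /=.
rewrite !(innerDl ipP) !(innerDr ipP) -(pos_def_sym m v pQ) (innerC ipP (leon_inv S m m) v).
have := op_trace_leonE m SH pS.
have : ip v (leon_inv S m v) <= ip v ((sqrt_op S)^-1%VF v).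
  apply: inv_quad_le => //; first exact: op_sqrt_pos_def.
  apply: op_sqrt_mono => // x; rewrite add_lfunE (innerDr ipP) lerDr.
  exact: (pos_semidef_oproj_outer m).2.
move: (ip v ((sqrt_op S)^-1%VF v)) (ip v (leon_inv S m v)) (ip v (leon_inv S m m)).
move: (ip m (leon_inv S m m)) (op_dot ip S (leon_inv S m)).
move: (op_trace _) (op_trace _) => t t1 c d f e a ef t1E h1.
have -> : r * t1 + r * a + r / 2 * f = r * (t1 + a + f / 2) by field.
by rewrite ler_pM2l//; lra.
Qed.

(** Convexity and smoothness squeeze the remainder between 0 and [(r / 2) <h, S^(-1/2) h>]; the
    radius is chosen so that this quadratic stays below [e |h|]. *)
Lemma gradient_Psi_star S m : S \in H -> pos_def ip S ->
  gradient ip (Psi_star ip H r S) m = r *: leon_inv S m m.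
Proof.
move=> SH pS; apply: gradient_unique => e e0.
have pT := pos_def_inv (op_sqrt_pos_def pS).
have [c c0 cP] := lfun_bounded ipP fullv ((sqrt_op S)^-1)%VF.
exists (e / (r * (c + 1))) => [|h hd].
  by rewrite divr_gt0// mulr_gt0// ltr_wpDl.
have h1 := Psi_star_convex m (m + h) SH pS.
have h2 := Psi_star_smooth m h SH pS.
rewrite addrAC subrr add0r in h1.
have hh : ip h h = enorm ip h ^+ 2 by rewrite sqr_sqrtr// (inner_ge0 ipP).
have n_ge0 : 0 <= enorm ip h by exact: sqrtr_ge0.
have h3 : ip h ((sqrt_op S)^-1%VF h) <= (c + 1) * ip h h.
  apply: le_of_sqr_le (cP h (memvf h)) (cauchy_schwarz ipP _ _) => //.
  exact: (inner_ge0 ipP).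
have h4 : r * ((c + 1) * enorm ip h) <= e.
  move: hd => /ltW; rewrite ler_pdivlMr ?mulr_gt0 ?ltr_wpDl//.
  by rewrite mulrC mulrA.
have h5 : r / 2 * ip h ((sqrt_op S)^-1%VF h) <= r / 2 * ((c + 1) * enorm ip h ^+ 2).
  by rewrite -hh ler_wpM2l// divr_ge0// ltW.
have h6 : r * ((c + 1) * enorm ip h) * enorm ip h <= e * enorm ip h by rewrite ler_wpM2r.
have h7 : 0 <= e * enorm ip h by rewrite mulr_ge0// ltW.
have h8 : r / 2 * ((c + 1) * enorm ip h ^+ 2) = 2^-1 * (r * ((c + 1) * enorm ip h) * enorm ip h).
  by field.
rewrite (innerZl ipP) (innerC ipP _ h) ler_norml -addrA -opprD; apply/andP; split.
  by apply: (@le_trans _ _ 0); rewrite ?oppr_le0// subr_ge0.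
rewrite lerBlDl; apply: (le_trans h2); rewrite lerD2l; apply: (le_trans h5); rewrite h8.
rewrite -[leRHS]mul1r; apply: ler_pM => //.
- by rewrite !mulr_ge0 ?addr_ge0 ?(ltW r_gt0).
- by rewrite invf_le1 ?ler1n.
Qed.

(* The ball [rho x <= r], without the square root and the operator norm. *)
Definition proj_ball x := forall v, ip v (proj (outer ip x) v) <= r ^+ 2 * ip v v.

(** Projection commutes with congruence by [Q], and [Q proj (out m) Q <= Q (proj (out m) + S) Q =
    \1]. Hence every step lands in the ball. *)
Lemma proj_ball_step S m : S \in H -> pos_def ip S ->
  proj_ball (- (r *: leon_inv S m m)).
Proof.
move=> SH pS v; have QH := leon_inv_in m SH pS; have pQ := pos_def_leon_inv m pS.
set Q := leon_inv S m in QH pQ *.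
have -> : outer ip (- (r *: Q m)) = r ^+ 2 *: outer ip (Q m).
  apply/lfunP => x; rewrite scale_lfunE !outerE (innerNl ipP) (innerZl ipP).
  by rewrite scalerN scaleNr opprK !scalerA; congr (_ *: _); ring.
rewrite oprojZ scale_lfunE (innerZr ipP) ler_wpM2l ?sqr_ge0//.
rewrite (outer_congr _ pQ.1) (oproj_congr sH _ QH).
have -> : ip v v = ip v ((Q \o leon_op S m \o Q)%VF v).
  by rewrite leon_inv_congr// id_lfunE.
rewrite !comp_lfunE -!(pos_def_sym v _ pQ) add_lfunE (innerDr ipP) lerDl.
exact: (pos_defW pS).2.
Qed.

(** [<x, F x>] is the pairing of [proj (out x)] with [F], and the first operator is at most [r^2]
    times the identity. For [F = B] of trace 1 the ball thus has radius at most [r] in the norm of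
    [B]. *)
Lemma proj_ball_quad x F : F \in H -> pos_semidef ip F -> proj_ball x ->
  ip x (F x) <= r ^+ 2 * op_trace F.
Proof.
move=> FH pF xP; rewrite -op_dot_outer; last exact: pF.1.
rewrite -(op_dot_oproj ip _ FH) -(op_dot1r ip) (innerC odP F) -(innerZl odP).
apply: op_dot_le => //.
- exact: (pos_semidef_oproj_outer x).1.
- by apply: self_adjointZ; exact: self_adjoint1.
- by move=> v; rewrite scale_lfunE id_lfunE (innerZr ipP).
Qed.

(** [Psi_star] dominates the support function of the ball. Young's inequality in the metric [Z], the
    root at [m], bounds [2 r <m, x>] by [r^2 <m, Z^-1 m> + <x, Z x>], and each summand is at most
    [r^2 tr Z]. *)
Lemma proj_ball_pairing S m x : S \in H -> pos_def ip S -> proj_ball x ->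
  ip m x <= Psi_star ip H r S m.
Proof.
move=> SH pS xP; rewrite Psi_starE//.
have pA := pos_def_leon_op m pS; have pZ := op_sqrt_pos_def pA.
have ZH : sqrt_op (leon_op S m) \in H by apply: (op_sqrt_in sH) => //; exact: leon_op_in.
have h1 := young_quad (r *: m) x pZ.
have h2 := proj_ball_quad ZH (pos_defW pZ) xP.
have h3 := op_trace_leonE m SH pS.
have h4 : 0 <= op_dot ip S (leon_inv S m).
  by apply: op_dot_ge0; apply: pos_defW => //; exact: pos_def_leon_inv.
rewrite linearZ /= !(innerZl ipP) (innerZr ipP) -/(leon_inv S m) in h1.
have h5 : r * (r * ip m (leon_inv S m m)) <= r * (r * op_trace (sqrt_op (leon_op S m))).
  by rewrite !ler_pM2l// h3 lerDl.
rewrite -(ler_pM2l r_gt0) -(@ler_pM2l _ 2)//.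
apply: (le_trans h1); rewrite mulr2n mulrDl mul1r; apply: lerD => //.
by apply: (le_trans h2); rewrite expr2 mulrA.
Qed.

(** The outer product of an average is the average of the outer products minus
    [a (1 - a) out (x - y)], whose projection is positive semidefinite. *)
Lemma proj_ball_avg a x y : 0 <= a <= 1 -> proj_ball x -> proj_ball y ->
  proj_ball (a *: x + (1 - a) *: y).
Proof.
move=> /andP[a0 a1] xP yP v.
have -> : outer ip (a *: x + (1 - a) *: y) =
    a *: outer ip x + (1 - a) *: outer ip y - (a * (1 - a)) *: outer ip (x - y).
  apply/lfunP => u; apply: (inner_inj ipP) => w.
  rewrite !(add_lfunE, opp_lfunE, scale_lfunE, outerE).
  rewrite !(innerZr ipP, innerDr ipP, innerNr ipP, innerDl ipP, innerZl ipP, innerNl ipP).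
  by ring.
rewrite oprojB oprojD !oprojZ !(add_lfunE, opp_lfunE, scale_lfunE).
rewrite !(innerZr ipP, innerDr ipP, innerNr ipP).
have h1 := (pos_semidef_oproj_outer (x - y)).2 v.
have h2 : 0 <= a * (1 - a) by rewrite mulr_ge0// subr_ge0.
have h5 : 0 <= a * (1 - a) * ip v (proj (outer ip (x - y)) v) by exact: mulr_ge0.
have h6 : a * ip v (proj (outer ip x) v) <= a * (r ^+ 2 * ip v v) by rewrite ler_wpM2l.
have h7 : (1 - a) * ip v (proj (outer ip y) v) <= (1 - a) * (r ^+ 2 * ip v v).
  by rewrite ler_wpM2l// subr_ge0.
apply: (@le_trans _ _ (a * ip v (proj (outer ip x) v) + (1 - a) * ip v (proj (outer ip y) v))).
  by rewrite gerDl oppr_le0.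
by apply: (le_trans (lerD h6 h7)); rewrite -mulrDl addrC subrK mul1r.
Qed.

Lemma proj_ball0 : proj_ball 0.
Proof.
move=> v; have -> : outer ip 0 = 0.
  by apply/lfunP => u; rewrite outerE zero_lfunE scaler0.
by rewrite oproj0 zero_lfunE (inner0r ipP) mulr_ge0 ?sqr_ge0// (inner_ge0 ipP).
Qed.

(** With [Z] the root of [M = proj (out x)], [<v, M v> = |Z v|^2]: both sides say [|Z v| <= r |v|]
    for all [v]. *)
Lemma rho_ballP x : rho_ball ip H r x <-> proj_ball x.
Proof.
have [pZ ZZ] := op_sqrtP (pos_semidef_oproj_outer x).
set Z := sqrt_op _ in pZ ZZ; set M := proj _ in ZZ.
have Zv v : ip v (M v) = enorm ip (Z v) ^+ 2.
  by rewrite -ZZ comp_lfunE -pZ.1 sqr_sqrtr// (inner_ge0 ipP).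
have vv v : ip v v = enorm ip v ^+ 2 by rewrite sqr_sqrtr// (inner_ge0 ipP).
have en0 v : 0 <= enorm ip v by exact: sqrtr_ge0.
rewrite /rho_ball /= /rho -/M -/Z /op_norm; set E := [set _ | _ in _].
have E0 : E !=set0.
  exists (enorm ip (Z 0)), 0 => //=.
  by rewrite /enorm (inner0l ipP) sqrtr0 ler01.
split=> [h v|h].
  rewrite -/M Zv vv -exprMn ler_sqr ?nnegrE ?mulr_ge0 ?(ltW r_gt0)//.
  have [->|v0] := eqVneq v 0.
    by rewrite linear0 /enorm (inner0l ipP) sqrtr0 mulr0.
  have n0 : 0 < enorm ip v by rewrite sqrtr_gt0 (inner_gt0 ipP).
  rewrite -ler_pdivrMr//; apply: le_trans h; apply: ub_le_sup; last first.
    exists ((enorm ip v)^-1 *: v) => /=.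
      rewrite /enorm (innerZl ipP) (innerZr ipP) mulrA -expr2 sqrtrM ?sqr_ge0//.
      by rewrite sqrtr_sqr ger0_norm ?invr_ge0// mulVf// gt_eqF.
    rewrite linearZ /= /enorm (innerZl ipP) (innerZr ipP) mulrA -expr2 sqrtrM ?sqr_ge0//.
    by rewrite sqrtr_sqr ger0_norm ?invr_ge0 ?sqrtr_ge0// mulrC.
  have [c c0 cP] := lfun_bounded ipP fullv Z.
  exists (c + 1) => _ [u /= u1 <-].
  rewrite -ler_sqr ?nnegrE ?addr_ge0//.
  have := cP u (memvf u); rewrite !vv => /le_trans -> //.
  have u2 : enorm ip u ^+ 2 <= 1 by rewrite expr_le1.
  apply: (@le_trans _ _ (c * 1)); first by rewrite ler_wpM2l.
  rewrite mulr1 expr2 mulrDl mul1r; apply: (@le_trans _ _ (c + 1)); first by rewrite lerDl.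
  by rewrite lerDr mulr_ge0// addr_ge0.
apply: ge_sup => // _ [u /= u1 <-].
rewrite -ler_sqr ?nnegrE ?(ltW r_gt0)// -Zv (le_trans (h u))// vv.
by rewrite ler_piMr ?sqr_ge0// expr_le1.
Qed.

End Psi.

(** * Regret *)

Section Regret.
Context {R : realType} {X : vectType R} (ip : {dot X for idfun}).
Context (H : {vspace 'End(X)}) (sH : structured_subspace ip H).
Context (r : R) (r_gt0 : 0 < r).
Implicit Types (A B F P Q M S : 'End(X)) (x y z m v : X).
Local Notation ipP := (dot_inner_product ip).
Local Notation odP := (op_dot_inner_product ip).
Local Notation sqrt_op := (op_sqrt ip).
Local Notation proj := (oproj ip H).
Local Notation Psi := (Psi_star ip H r).
Local Notation ball := (proj_ball ip H r).

(** Submodularity with [M = proj (out m)]: the cost of replacing [S'] by [S] is bounded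
    independently of [m]. *)
Lemma Psi_star_increment S S' m : pos_def ip S' -> pos_def ip S ->
  (forall x, ip x (S' x) <= ip x (S x)) ->
  Psi S m <= Psi S' m + r * (op_trace (sqrt_op S) - op_trace (sqrt_op S')).
Proof.
move=> pS' pS S'S; rewrite !(Psi_starE sH)// -mulrDr ler_pM2l//.
have := op_trace_sqrt_submodular pS' pS (pos_semidef_oproj_outer sH m) S'S.
by rewrite lerBlDl.
Qed.

(* The quadratic gain is the conjugate of the smoothness of [Psi_star S'] at [m]: compare
   [Psi S] and [Psi S'] at the test point [m - r^-1 * sqrt S' (x - x')]. *)
Lemma leader_step S S' m g (x' := - (r *: leon_inv ip H S' m m))
    (x := - (r *: leon_inv ip H S (m + g) (m + g))) :
  S \in H -> S' \in H -> pos_def ip S' -> pos_def ip S ->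
  (forall y, ip y (S' y) <= ip y (S y)) ->
  ip g x <= Psi S' m - Psi S (m + g) +
    r * (op_trace (sqrt_op S) - op_trace (sqrt_op S')) -
    (2 * r)^-1 * ip (x - x') (sqrt_op S' (x - x')).
Proof.
move=> SH S'H pS' pS S'S; set d := x - x'.
have pT := op_sqrt_pos_def pS'.
pose v := - (r^-1 *: sqrt_op S' d).
have h1 := Psi_star_convex sH r_gt0 (m + g) (m + v) SH pS.
have h2 := Psi_star_increment (m + v) pS' pS S'S.
have h3 := Psi_star_smooth sH r_gt0 m v S'H pS'.
have e1 : r * ip (m + v - (m + g)) (leon_inv ip H S (m + g) (m + g)) = ip g x - ip v x.
  by rewrite opprD addrACA subrr add0r /x !(innerNr ipP) !(innerZr ipP) (innerBl ipP); ring.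
have e2 : r * ip v (leon_inv ip H S' m m) = - ip v x'.
  by rewrite /x' (innerNr ipP) (innerZr ipP) opprK.
have e3 : ip v d = - (r^-1 * ip d (sqrt_op S' d)).
  by rewrite /v (innerNl ipP) (innerZl ipP) (innerC ipP d).
have e4 : ip v ((sqrt_op S')^-1%VF v) = r^-1 ^+ 2 * ip d (sqrt_op S' d).
  have -> : (sqrt_op S')^-1%VF v = - (r^-1 *: d).
    by rewrite linearN linearZ /= (pos_def_invK pT).
  rewrite (innerNl ipP) (innerNr ipP) opprK.
  by rewrite (innerZl ipP) (innerZr ipP) (innerC ipP d) mulrA expr2.
have e5 : ip v d = ip v x - ip v x' by rewrite /d (innerBr ipP).
have e6 : r / 2 * (r^-1 ^+ 2 * ip d (sqrt_op S' d)) =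
    (2 * r)^-1 * ip d (sqrt_op S' d) by field; rewrite gt_eqF.
have e7 : r^-1 * ip d (sqrt_op S' d) = 2 * ((2 * r)^-1 * ip d (sqrt_op S' d)).
  by field; rewrite gt_eqF.
move: h1 h2 h3; rewrite e1 e2 e4 e6; move: e3; rewrite e7 e5.
move: (ip v x) (ip v x') (ip g x) (ip d _) (Psi S (m + g)) (Psi S (m + v)).
move: (Psi S' (m + v)) (Psi S' m) (r * (_ - _)) => a b c p q w y z t.
move: (_^-1 * y) => u; lra.
Qed.

Lemma proj_ball_quadB x y F : F \in H -> pos_semidef ip F -> ball x -> ball y ->
  ip (x - y) (F (x - y)) <= 4 * r ^+ 2 * op_trace F.
Proof.
move=> FH pF xB yB.
have h1 := proj_ball_quad sH FH pF xB; have h2 := proj_ball_quad sH FH pF yB.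
have h3 := pF.2 (x + y); move: h1 h2 h3; rewrite linearB linearD /=.
rewrite -mulrA !(innerDr ipP, innerNr ipP, innerDl ipP, innerNl ipP).
move: (ip x (F x)) (ip x (F y)) (ip y (F x)) (ip y (F y)) (r ^+ 2 * _) => a b c d e.
lra.
Qed.

Context (x m g gt : nat -> X) (S : nat -> 'End(X)) (delta : R) (xs : X).
Hypothesis delta_gt0 : 0 < delta.
Hypothesis x0 : x 0 = 0.
Hypothesis m0 : m 0 = 0.
Hypothesis S0 : S 0 = delta ^+ 2 *: \1%VF.
Hypothesis mS : forall k, m k.+1 = m k + g k.
Hypothesis xS : forall k, x k.+1 = - gradient ip (Psi (S k)) (m k.+1).
Hypothesis SS : forall k, S k.+1 = S k + proj (outer ip (gt k - g k)).

Lemma leon_SP k : S k \in H /\ pos_def ip (S k).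
Proof.
elim: k => [|k [SH pS]].
  rewrite S0; split; first by rewrite rpredZ// (structured1 sH).
  by apply: pos_defZ; [rewrite exprn_gt0|exact: pos_def1].
rewrite SS; split; first by rewrite rpredD// oproj_in.
by rewrite addrC; apply: pos_defD => //; exact: pos_semidef_oproj_outer.
Qed.

Lemma leon_S_mono k y : ip y (S k y) <= ip y (S k.+1 y).
Proof.
by rewrite SS add_lfunE (innerDr ipP) lerDl (pos_semidef_oproj_outer sH _).2.
Qed.

Lemma leon_S_mono_pred k y : ip y (S k.-1 y) <= ip y (S k y).
Proof. by case: k => [|k] //=; exact: leon_S_mono. Qed.

(** Here [m k] sums the first [k] gradients, and [x k] was computed with the previous operator
    [S k.-1]. At [k = 0] the truncated predecessor is harmless, since both sides are zero. *)
Lemma leon_xE k : x k = - (r *: leon_inv ip H (S k.-1) (m k) (m k)).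
Proof.
case: k => [|k]; first by rewrite x0 m0 linear0 scaler0 oppr0.
by have [SH pS] := leon_SP k; rewrite xS (gradient_Psi_star sH r_gt0).
Qed.

Lemma leon_x_ball k : ball (x k).
Proof.
have [SH pS] := leon_SP k.-1.
by rewrite leon_xE; apply: proj_ball_step.
Qed.

Let t k := op_trace (sqrt_op (S k)).

Lemma trace_sqrt_mono A B : pos_def ip A -> pos_def ip B ->
  (forall x, ip x (A x) <= ip x (B x)) ->
  op_trace (sqrt_op A) <= op_trace (sqrt_op B).
Proof.
move=> pA pB AB; have [s sP] := onb_exists ip.
by rewrite !(op_traceE _ sP); apply: ler_sum => z _; exact: op_sqrt_mono.
Qed.

(** With [e = gt k - g k] and [d = x k.+1 - x k], Young's inequality in the metric [sqrt (S k.+1)]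
    splits [<e, d>]. The part in [e] is a trace increment because [S k.+1 - S k = proj (out e)]. The
    part in [d] is cancelled by the gain of [leader_step], up to [sqrt (S k.+1) - sqrt (S k.-1)],
    which the diameter of the ball turns into [2 r (t k.+1 - t k.-1)]. *)
Lemma regret_step k :
  ip (g k) (x k.+1) + ip (gt k - g k) (x k.+1 - x k) <=
  Psi (S k.-1) (m k) - Psi (S k) (m k.+1) + r * (t k - t k.-1) +
  r * (t k.+1 - t k) + 2 * r * (t k.+1 - t k.-1).
Proof.
have [SpH pSp] := leon_SP k.-1; have [SH pS] := leon_SP k.
have [SnH pSn] := leon_SP k.+1.
set e := gt k - g k; set d := x k.+1 - x k.
have h1 : ip (g k) (x k.+1) <= Psi (S k.-1) (m k) - Psi (S k) (m k.+1) +
    r * (t k - t k.-1) - (2 * r)^-1 * ip d (sqrt_op (S k.-1) d).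
  rewrite /d (leon_xE k) (leon_xE k.+1) mS /=.
  by apply: leader_step => //; exact: leon_S_mono_pred.
have pTn := op_sqrt_pos_def pSn.
have h2 : 2 * ip e d <= r * ip e ((sqrt_op (S k.+1))^-1%VF e) +
    r^-1 * ip d (sqrt_op (S k.+1) d).
  have := young_quad (r *: e) d pTn.
  rewrite linearZ /= !(innerZl ipP) (innerZr ipP) => h.
  have : r^-1 * (2 * (r * ip e d)) <= r^-1 * (r * (r * ip e ((sqrt_op (S k.+1))^-1%VF e)) +
     ip d (sqrt_op (S k.+1) d)) by rewrite ler_pM2l ?invr_gt0.
  by rewrite mulrDr mulKf ?gt_eqF// mulrCA mulKf ?gt_eqF.
have h3 : ip e ((sqrt_op (S k.+1))^-1%VF e) <= 2 * (t k.+1 - t k).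
  rewrite -op_dot_outer; last exact: (pos_def_inv pTn).1.
  rewrite -(op_dot_oproj ip _ (inv_op_sqrt_in sH SnH pSn)).
  have -> : proj (outer ip e) = S k.+1 - S k by rewrite SS addrAC subrr add0r.
  exact: op_dot_increment_le.
have mono : forall y, ip y (S k.-1 y) <= ip y (S k.+1 y).
  by move=> y; apply: le_trans (leon_S_mono_pred k y) (leon_S_mono k y).
have pTp := op_sqrt_pos_def pSp.
have h4 : ip d ((sqrt_op (S k.+1) - sqrt_op (S k.-1)) d) <= 4 * r ^+ 2 * (t k.+1 - t k.-1).
  rewrite -op_traceB; apply: proj_ball_quadB; try exact: leon_x_ball.
    by rewrite rpredB// (op_sqrt_in sH).
  split; first by apply: self_adjointB; [exact: pTn.1|exact: pTp.1].
  by move=> y; rewrite add_lfunE opp_lfunE (innerBr ipP) subr_ge0; exact: op_sqrt_mono.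
rewrite add_lfunE opp_lfunE (innerBr ipP) in h4.
have h5 : r^-1 * (ip d (sqrt_op (S k.+1) d) - ip d (sqrt_op (S k.-1) d)) <=
    4 * r * (t k.+1 - t k.-1).
  rewrite mulrC ler_pdivrMr//; apply: le_trans h4 _; rewrite expr2; lra.
have h6 : r * ip e ((sqrt_op (S k.+1))^-1%VF e) <= r * (2 * (t k.+1 - t k)).
  by rewrite ler_pM2l.
move: h1 h2 h5 h6; rewrite invfM -(mulrA 2^-1) -(mulrA 4).
move: (Psi _ _) (Psi _ _) (t k.+1) (t k) (t k.-1) => p p' tn tk tp.
rewrite (mulrBr r^-1); move: (r^-1 * _) (r^-1 * _) (ip _ _) (ip e d) => a b c u.
move: (r * ip _ _) => w h1 h2 h5 h6.
suff: c + u <= p' - p + r * (tk - tp) + r * (tn - tk) + 2 * (r * (tn - tp)) by rewrite mulrA.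
move: h5 h6; rewrite (mulrCA r).
move: (r * (tk - tp)) (r * (tn - tk)) (r * (tn - tp)) h1 => ? ? ? h1 h5 h6.
lra.
Qed.

(** The potential whose increments are the right-hand sides of [regret_step]. It is nonnegative at
    0, where [Psi (S 0) 0 = r * t 0]. *)
Let V k := - Psi (S k.-1) (m k) + r * t k.-1 + r * t k + 2 * r * (t k + t k.-1).

Lemma regret_sum n :
  \sum_(k < n) (ip (g k) (x k.+1) + ip (gt k - g k) (x k.+1 - x k)) <= V n.
Proof.
elim: n => [|n IH].
  rewrite big_ord0 /V /= m0; have [SH pS] := leon_SP 0.
  have -> : Psi (S 0) 0 = r * t 0.
    rewrite (Psi_starE sH r _ pS) /leon_op; have -> : outer ip 0 = 0.
      by apply/lfunP => u; rewrite outerE zero_lfunE scaler0.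
    by rewrite oproj0 add0r.
  have t_ge0 : 0 <= t 0 by apply: (op_trace_ge0 (ip := ip)); apply: pos_defW; exact: op_sqrt_pos_def.
  by rewrite addNr add0r !addr_ge0// !mulr_ge0// ?addr_ge0// ltW.
rewrite big_ord_recr /=; apply: (le_trans (lerD IH (regret_step n))).
rewrite /V /=; move: (Psi _ _) (Psi _ _) (t n.+1) (t n) (t n.-1) => p p' tn tk tp.
by rewrite le_eqVlt; apply/orP; left; apply/eqP; ring.
Qed.

(** The ball is symmetric, so [Psi] also dominates [- <m n, xs>]. After [t n.-1 <= t n] the trace
    coefficients of [V n] add up to 1 + 1 + 4 = 6. *)
Lemma regret_le n : ball xs ->
  \sum_(k < n) (ip (g k) (x k.+1 - xs) + ip (gt k - g k) (x k.+1 - x k))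
    <= 6 * r * t n.
Proof.
move=> xsB.
have mE : \sum_(k < n) ip (g k) xs = ip (m n) xs.
  elim: n => [|n IH]; first by rewrite big_ord0 m0 (inner0l ipP).
  by rewrite big_ord_recr /= IH mS (innerDl ipP).
under eq_bigr do rewrite (innerBr ipP) addrAC.
rewrite sumrB mE; have := regret_sum n; rewrite /V.
have [SpH pSp] := leon_SP n.-1; have [SH pS] := leon_SP n.
have h1 : - ip (m n) xs <= Psi (S n.-1) (m n).
  rewrite -(innerNr ipP); apply: proj_ball_pairing => //.
  move=> v; have -> : outer ip (- xs) = outer ip xs; last exact: xsB.
  by apply/lfunP => u; rewrite !outerE (innerNl ipP) scalerN scaleNr opprK.
have h2 : t n.-1 <= t n by apply: trace_sqrt_mono => //; exact: leon_S_mono_pred.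
have h3 : r * t n.-1 <= r * t n by rewrite ler_pM2l.
move: h1 h3; rewrite -!mulrA mulrDr.
move: (\sum_(i < n) _) (ip _ _) (Psi _ _) (r * _) (r * _) => a b c d e.
lra.
Qed.

End Regret.

(** * Hölder smoothness and the accelerated scheme *)

Section TraceBound.
Context {R : realType} {X : vectType R} (ip : {dot X for idfun}).
Context (H : {vspace 'End(X)}) (sH : structured_subspace ip H).
Local Notation ipP := (dot_inner_product ip).
Local Notation odP := (op_dot_inner_product ip).

Lemma inv_lfunZ (a : R) (A : 'End(X)) : 0 < a -> pos_def ip A ->
  ((a *: A)^-1)%VF = a^-1 *: (A^-1)%VF.
Proof.
move=> a0 pA; apply/lfunP => x; apply: (can_inj (pos_def_invK (pos_defZ a0 pA))).
rewrite (pos_def_invVK (pos_defZ a0 pA)) !scale_lfunE linearZ /= (pos_def_invVK pA).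
by rewrite scalerA mulfV ?scale1r// gt_eqF.
Qed.

Lemma inv_lfun1 : ((\1 : 'End(X))^-1)%VF = \1%VF.
Proof.
apply/lfunP => x; apply: (can_inj (pos_def_invK (pos_def1 ip))).
by rewrite (pos_def_invVK (pos_def1 ip)) !id_lfunE.
Qed.

(* [op_trace_sqrt_le] at the test operator [delta I + tau B]. *)
Lemma op_trace_sqrt_bound (T B : 'End(X)) (delta tau : R) :
  pos_semidef ip T -> pos_def ip B -> op_trace B = 1 -> 0 < delta -> 0 < tau ->
  op_trace (op_sqrt ip (delta ^+ 2 *: \1%VF + T)) <=
    delta * (\dim {:X})%:R + 2^-1 * (tau^-1 * op_dot ip T (B^-1)%VF + tau).
Proof.
move=> pT pB trB d0 t0.
have p1 : pos_def ip (delta *: \1%VF) by apply: pos_defZ => //; exact: pos_def1.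
have pd2 : pos_def ip (delta ^+ 2 *: \1%VF).
  by apply: pos_defZ; [rewrite exprn_gt0|exact: pos_def1].
have ptB := pos_defZ t0 pB.
have pZ : pos_def ip (delta *: \1%VF + tau *: B) by apply: pos_defD => //; exact: pos_defW.
have pS : pos_def ip (delta ^+ 2 *: \1%VF + T) by rewrite addrC; exact: pos_defD.
have := op_trace_sqrt_le pS pZ.
rewrite op_traceD !op_traceZ op_trace1 trB mulr1 (innerDl odP).
have h1 : op_dot ip (delta ^+ 2 *: \1%VF) ((delta *: \1%VF + tau *: B)^-1)%VF <=
    delta * (\dim {:X})%:R.
  apply: (@le_trans _ _ (op_dot ip (delta ^+ 2 *: \1%VF) ((delta *: \1%VF)^-1)%VF)).
    rewrite !(innerC odP (_ *: _)); apply: op_dot_le.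
    - exact: (pos_def_inv pZ).1.
    - exact: (pos_def_inv p1).1.
    - move=> x; apply: inv_quad_le => // y.
      by rewrite [in leRHS]add_lfunE (innerDr ipP) lerDl (pos_defW ptB).2.
    - exact: pos_defW.
  rewrite (inv_lfunZ d0 (pos_def1 ip)) inv_lfun1 (innerZl odP) (innerZr odP).
  by rewrite op_dot1r op_trace1 mulrA expr2 mulfK// gt_eqF.
have h2 : op_dot ip T ((delta *: \1%VF + tau *: B)^-1)%VF <= tau^-1 * op_dot ip T (B^-1)%VF.
  rewrite -(innerZr odP) -(inv_lfunZ t0 pB) !(innerC odP T); apply: op_dot_le => //.
  - exact: (pos_def_inv pZ).1.
  - exact: (pos_def_inv ptB).1.
  - move=> x; apply: inv_quad_le => // y.
    by rewrite [in leRHS]add_lfunE (innerDr ipP) lerDr (pos_defW p1).2.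
move: h1 h2; move: (op_dot _ _ _) (op_dot _ _ _) (tau^-1 * _) (delta * _) (op_trace _).
by move=> a b c d e; lra.
Qed.

End TraceBound.

Lemma gt0_powRD (R : realType) (s x y : R) : 0 < s -> s `^ (x + y) = s `^ x * s `^ y.
Proof. by move=> s0; rewrite powRD ?(gt_eqF s0) ?implybT. Qed.

(** The second term suffices when [T <= s], the first when [T > s], as the exponent [nu - 1] is
    nonpositive. Hölder growth becomes quadratic growth plus a constant. *)
Lemma powR_interp (R : realType) (s T nu : R) : 0 < s -> 0 <= T -> 0 <= nu <= 1 ->
  T `^ nu * T <= s `^ (nu - 1) * T ^+ 2 + s `^ (1 + nu).
Proof.
move=> s0 T0 /andP[nu0 nu1].
have [Ts|sT] := leP T s.
  apply: (@le_trans _ _ (s `^ (1 + nu))).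
    rewrite gt0_powRD// powRr1 ?(ltW s0)// mulrC ler_pM ?powR_ge0//.
    by rewrite ge0_ler_powR// nnegrE// ltW.
  by rewrite lerDr mulr_ge0 ?powR_ge0 ?sqr_ge0.
have T_gt0 : 0 < T by exact: lt_trans sT.
apply: (@le_trans _ _ (s `^ (nu - 1) * T ^+ 2)); last by rewrite lerDl powR_ge0.
have -> : T `^ nu * T = T `^ (nu - 1) * T ^+ 2.
  rewrite -{1}[nu](subrK 1) (gt0_powRD (nu - 1) 1 T_gt0) powRr1 ?(ltW T_gt0)//.
  by rewrite -mulrA expr2.
rewrite ler_wpM2r ?sqr_ge0// -[nu - 1]opprB !powRN lef_pV2 ?posrE ?powR_gt0//.
by rewrite ge0_ler_powR ?subr_ge0// ?nnegrE ltW.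
Qed.

Section Holder.
Context {R : realType} {X : vectType R} (ip : {dot X for idfun}).
Context (L nu : R) (B : 'End(X)) (f : X -> R) (grad : X -> X).
Hypotheses (L_gt0 : 0 < L) (nu01 : 0 <= nu <= 1) (pB : pos_def ip B).
Hypothesis subf : forall x, subgradient ip f x (grad x).
Hypothesis holderf : holder_smooth ip L nu B grad.
Local Notation ipP := (dot_inner_product ip).
Local Notation dual u := (ip u (B^-1%VF u)).

Lemma hnorm_sqr A x : pos_semidef ip A -> hnorm ip A x ^+ 2 = ip x (A x).
Proof. by move=> pA; rewrite sqr_sqrtr// pA.2. Qed.

Lemma hnorm_pairing u v : ip u v <= hnorm ip (B^-1)%VF u * hnorm ip B v.
Proof.
apply: le_trans (ler_norm _) _.
rewrite -ler_sqr ?nnegrE ?mulr_ge0 ?sqrtr_ge0//.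
rewrite exprMn !hnorm_sqr ?real_normK ?num_real//; try by apply: pos_defW => //; exact: pos_def_inv.
have := semi_cauchy_schwarz ipP (U := fullv) pB.1 (fun v _ => (pos_defW pB).2 v)
  (memvf (B^-1%VF u)) (memvf v).
by rewrite -(pos_def_sym _ v pB) (pos_def_invVK pB) (innerC ipP (B^-1%VF u) u).
Qed.

Lemma holder_pairing x y :
  ip (grad x - grad y) (x - y) <= L * (hnorm ip B (x - y) `^ nu * hnorm ip B (x - y)).
Proof.
apply: (le_trans (hnorm_pairing _ _)); rewrite mulrA.
by rewrite ler_wpM2r ?sqrtr_ge0// holderf.
Qed.

(* The convex function [y |-> f y - ip (grad z) y] is minimal at [z]; compare its
   values at [z] and after one gradient step of size [M^-1] from [w]. *)
Lemma bregman_lower s w z (M := 2 * L * s `^ (nu - 1)) : 0 < s ->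
  f z + ip (grad z) (w - z) + (2 * M)^-1 * dual (grad z - grad w)
    <= f w + L * s `^ (1 + nu).
Proof.
move=> s0; set D := grad z - grad w.
have M0 : 0 < M by rewrite !mulr_gt0// powR_gt0.
pose v := M^-1 *: B^-1%VF D.
have h1 := subf z (w + v); have h2 := subf (w + v) w.
have h3 := holder_pairing (w + v) w.
have e1 : w + v - w = v by rewrite addrAC subrr add0r.
have e2 : w - (w + v) = - v by rewrite opprD addrA subrr add0r.
rewrite e1 in h3; rewrite e2 (innerNr ipP) in h2.
have h4 := powR_interp s0 (sqrtr_ge0 (ip v (B v))) nu01; rewrite -/(hnorm ip B v) in h4.
have e3 : hnorm ip B v ^+ 2 = M^-1 ^+ 2 * dual D.
  rewrite hnorm_sqr; last exact: pos_defW.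
  rewrite /v linearZ /= (pos_def_invVK pB) (innerZl ipP) (innerZr ipP) mulrA -expr2.
  by rewrite (innerC ipP D).
have h5 : L * (hnorm ip B v `^ nu * hnorm ip B v) <=
    (2 * M)^-1 * dual D + L * s `^ (1 + nu).
  (* [M] is chosen so that the quadratic error costs exactly half of the decrease
     [<D, v> = M^-1 * dual D]. *)
  have -> : (2 * M)^-1 * dual D = L * (s `^ (nu - 1) * hnorm ip B v ^+ 2).
    rewrite e3 /M; field; rewrite !gt_eqF ?powR_gt0//.
  by rewrite -mulrDr ler_wpM2l// ltW.
have e4 : ip D v = 2 * ((2 * M)^-1 * dual D).
  by rewrite /v (innerZr ipP); field; rewrite gt_eqF.
move: h1 h2 h3 h5 e4; rewrite [w + v - z]addrAC (innerDr ipP) !(innerBl ipP).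
move: (f z) (f w) (f (w + v)) (ip (grad z) (w - z)) (ip (grad z) v) (ip (grad w) v).
move: (ip (grad (w + v)) v) (L * (hnorm _ _ _ `^ _ * _)) ((2 * M)^-1 * dual D).
move: (L * s `^ _) => a b c d e g h i j k.
lra.
Qed.

(** The sum of [a^2] times the Bregman bound between [w] and [z], [a] times the subgradient
    inequality towards [xs] and [a (a - 1)] times the one towards [xb]. The linear terms recombine
    because [w - z = (x - x') / a] and [w] averages [x] and [xb]. *)
Lemma leon_fun_step s a xb x x' xs (w := leon_avg a xb x) (z := leon_avg a xb x')
    (M := 2 * L * s `^ (nu - 1)) : 0 < s -> 1 <= a ->
  a ^+ 2 * (f z - f xs) - a * (a - 1) * (f xb - f xs) <=
  ip (a *: grad w) (x - xs) + ip (a *: grad z) (x' - x) -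
    a ^+ 2 * ((2 * M)^-1 * dual (grad z - grad w)) + a ^+ 2 * (L * s `^ (1 + nu)).
Proof.
move=> s0 a1; have a0 : 0 < a by exact: lt_le_trans a1.
have h1 := bregman_lower w z s0; rewrite -/M in h1.
have h2 := subf w xs; have h3 := subf w xb.
have e1 : w - z = a^-1 *: (x - x').
  rewrite /w /z /leon_avg opprD addrACA subrr addr0 scalerBr//.
rewrite e1 (innerZr ipP) (innerBr ipP) in h1.
rewrite (innerBr ipP) in h2; rewrite (innerBr ipP) in h3.
have e2 : ip (grad w) w = a^-1 * ip (grad w) x + (1 - a^-1) * ip (grad w) xb.
  by rewrite {2}/w /leon_avg (innerDr ipP) !(innerZr ipP).
rewrite e2 in h2 h3; rewrite !(innerZl ipP) !(innerBr ipP).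
have h1' := ler_wpM2l (ltW (exprn_gt0 2 a0)) h1.
have h2' := ler_wpM2l (ltW a0) h2.
have h3' := ler_wpM2l (mulr_ge0 (ltW a0) (_ : 0 <= a - 1)) (h3).
have {}h3' := h3' (ltac:(by rewrite subr_ge0)).
move: h1' h2' h3'.
move: (f z) (f w) (f xb) (f xs) (ip (grad z) x) (ip (grad z) x') (ip (grad w) x).
move: (ip (grad w) xb) (ip (grad w) xs) (_^-1 * dual _) (L * s `^ _).
move=> p q d l fz fw fb fs zx zx' wx h1' h2' h3'.
rewrite -subr_ge0.
have -> : a * (wx - q) + a * (zx' - zx) - a ^+ 2 * d + a ^+ 2 * l -
  (a ^+ 2 * (fz - fs) - a * (a - 1) * (fb - fs)) =
  (a ^+ 2 * (fw + l) - a ^+ 2 * (fz + a^-1 * (zx - zx') + d)) +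
  (a * fs - a * (fw + (q - (a^-1 * wx + (1 - a^-1) * p)))) +
  (a * (a - 1) * fb - a * (a - 1) * (fw + (p - (a^-1 * wx + (1 - a^-1) * p)))).
  by field; rewrite gt_eqF.
by apply: addr_ge0; [apply: addr_ge0|]; rewrite subr_ge0.
Qed.

End Holder.

Section Recursion.
Context {R : realType} {X : vectType R} (ip : {dot X for idfun}).
Context (H : {vspace 'End(X)}) (eta delta : R) (alpha : nat -> R).
Context {T : Type} (sg : T -> X -> X) (xi xi' : nat -> T).

Let st k := leon ip H eta delta alpha sg xi xi' k.

Lemma leon_mS k : st_m (st k.+1) =
  st_m (st k) + leon_sgrad sg (alpha k) (st_xbar (st k)) (xi k) (st_x (st k)).
Proof. by rewrite /st /=; case: (leon _ _ _ _ _ _ _ _ k). Qed.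

Lemma leon_xS k : st_x (st k.+1) =
  - gradient ip (Psi_star ip H eta (st_S (st k))) (st_m (st k.+1)).
Proof. by rewrite /st /=; case: (leon _ _ _ _ _ _ _ _ k). Qed.

Lemma leon_xbarS k : st_xbar (st k.+1) =
  leon_avg (alpha k) (st_xbar (st k)) (st_x (st k.+1)).
Proof. by rewrite /st /=; case: (leon _ _ _ _ _ _ _ _ k). Qed.

Lemma leon_SS k : st_S (st k.+1) = st_S (st k) + oproj ip H (outer ip
   (leon_sgrad sg (alpha k) (st_xbar (st k)) (xi' k.+1) (st_x (st k.+1)) -
    leon_sgrad sg (alpha k) (st_xbar (st k)) (xi k) (st_x (st k)))).
Proof. by rewrite /st /=; case: (leon _ _ _ _ _ _ _ _ k). Qed.

End Recursion.

(** * The gap along a single sample path *)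

Section Pointwise.
Context {R : realType} {X : vectType R} (ip : {dot X for idfun}).
Context (H : {vspace 'End(X)}) (sH : structured_subspace ip H).
Context (L nu r delta : R) (B : 'End(X)) (f : X -> R) (grad : X -> X) (xs : X).
Context {T : Type} (n : T -> X -> X) (xi xi' : nat -> T).
Hypotheses (L_gt0 : 0 < L) (nu01 : 0 <= nu <= 1) (pB : pos_def ip B) (BH : B \in H).
Hypothesis trB : op_trace B = 1.
Hypothesis subf : forall x, subgradient ip f x (grad x).
Hypothesis holderf : holder_smooth ip L nu B grad.
Hypotheses (r_gt0 : 0 < r) (delta_gt0 : 0 < delta).
Hypothesis xs_ball : rho_ball ip H r xs.
Hypothesis xs_min : forall y, rho_ball ip H r y -> f xs <= f y.
Local Notation ipP := (dot_inner_product ip).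
Local Notation odP := (op_dot_inner_product ip).
Local Notation dual u := (ip u (B^-1%VF u)).

Let alpha k : R := 1 + k%:R / 2.
Let st k := leon ip H r delta alpha (fun s x => grad x + n s x) xi xi' k.
Let x k := st_x (st k).
Let xb k := st_xbar (st k).
Let w k := leon_avg (alpha k) (xb k) (x k).
Let nw k := n (xi k) (w k).
Let nz k := n (xi' k.+1) (xb k.+1).
Let g k := leon_sgrad (fun s x => grad x + n s x) (alpha k) (xb k) (xi k) (x k).
Let gt k := leon_sgrad (fun s x => grad x + n s x) (alpha k) (xb k) (xi' k.+1) (x k.+1).

Lemma alpha_ge1 k : 1 <= alpha k.
Proof. by rewrite lerDl divr_ge0. Qed.

Lemma alpha_gt0 k : 0 < alpha k.
Proof. exact: lt_le_trans (alpha_ge1 k). Qed.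

Lemma leon_iterate_ball k : proj_ball ip H r (x k).
Proof.
exact: (@leon_x_ball _ _ ip H sH r r_gt0 x (fun k => st_m (st k)) g gt
  (fun k => st_S (st k)) delta delta_gt0 erefl erefl erefl
  (leon_xS ip H r delta alpha _ xi xi') (leon_SS ip H r delta alpha _ xi xi')).
Qed.

Lemma leon_average_ball k : proj_ball ip H r (xb k).
Proof.
elim: k => [|k IH]; first exact: proj_ball0.
rewrite /xb /st leon_xbarS; apply: proj_ball_avg => //.
  by rewrite invr_ge0 (ltW (alpha_gt0 k)) invf_le1 ?alpha_ge1 ?alpha_gt0.
exact: (leon_iterate_ball k.+1).
Qed.

(** The sign allows terms to be dropped when telescoping, and later makes the gap integrable by
    domination. *)
Lemma leon_gap_ge0 k : 0 <= f (xb k) - f xs.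
Proof.
by rewrite subr_ge0; apply: xs_min; apply/(rho_ballP sH r_gt0); exact: (leon_average_ball k).
Qed.

(** [alpha k.+1 * (alpha k.+1 - 1)] is [alpha k ^+ 2 - 1 / 4], so nonnegative gaps remain at each
    index; the initial gap has weight zero because [alpha 0 = 1]. *)
Lemma leon_telescope K :
  alpha K ^+ 2 * (f (xb K.+1) - f xs) <=
  \sum_(k < K.+1) (alpha k ^+ 2 * (f (xb k.+1) - f xs) -
                   alpha k * (alpha k - 1) * (f (xb k) - f xs)).
Proof.
elim: K => [|K IH].
  by rewrite big_ord_recr big_ord0 /= add0r /alpha mul0r addr0 subrr mulr0 mul0r subr0.
rewrite big_ord_recr /=.
apply: (@le_trans _ _ (alpha K ^+ 2 * (f (xb K.+1) - f xs) +
  (alpha K.+1 ^+ 2 * (f (xb K.+2) - f xs) -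
   alpha K.+1 * (alpha K.+1 - 1) * (f (xb K.+1) - f xs)))); last by rewrite lerD2r.
rewrite addrCA lerDl subr_ge0 ler_wpM2r ?(leon_gap_ge0 K.+1)//.
rewrite /alpha -subr_ge0 -natr1.
set q : R := K%:R; rewrite (_ : _ - _ = 4^-1) ?invr_ge0//.
by field.
Qed.

Lemma dual_sum_le a u v y : dual (a *: (u + (v - y))) <=
  a ^+ 2 * (2 * dual u + 4 * (dual y + dual v)).
Proof.
have pBi := pos_defW (pos_def_inv pB).
have h1 := pBi.2 (u - (v - y)); have h2 := pBi.2 (v + y).
rewrite linearZ /= (innerZl ipP) (innerZr ipP) mulrA -expr2 ler_wpM2l ?sqr_ge0//.
move: h1 h2; rewrite !(linearD, linearN) /=.
rewrite !(innerDr ipP, innerNr ipP, innerDl ipP, innerNl ipP).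
move: (B^-1%VF u) (B^-1%VF v) (B^-1%VF y) => u' v' y'.
move: (ip u u') (ip u v') (ip u y') (ip v u') (ip v v') (ip v y').
by move: (ip y u') (ip y v') (ip y y') => *; lra.
Qed.

Lemma leon_pointwise K s tau (l := L * s `^ (1 + nu)) :
  0 < s -> 0 < tau -> 12 * r * (2 * L * s `^ (nu - 1)) <= tau ->
  alpha K ^+ 2 * (f (xb K.+1) - f xs) <=
  6 * r * delta * (\dim {:X})%:R + 3 * r * tau +
  \sum_(k < K.+1) (alpha k ^+ 2 * l +
     12 * r / tau * alpha k ^+ 2 * (dual (nw k) + dual (nz k)) -
     alpha k * (ip (nw k) (x k - xs) + ip (nz k) (x k.+1 - x k))).
Proof.
move=> s0 t0 tau_ge; set M := 2 * L * _ in tau_ge.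
have M0 : 0 < M by rewrite !mulr_gt0// powR_gt0.
apply: (le_trans (leon_telescope K)).
pose reg k := ip (g k) (x k.+1 - xs) + ip (gt k - g k) (x k.+1 - x k).
(* [reg k] equals [<g k, x k - xs> + <gt k, x k.+1 - x k>]. Its noise part is therefore exactly
   [mart k], where each noise vector is paired with a vector that does not depend on its sample. *)
pose mart k := alpha k * (ip (nw k) (x k - xs) + ip (nz k) (x k.+1 - x k)).
pose D k := dual (grad (xb k.+1) - grad (w k)).
have step k : alpha k ^+ 2 * (f (xb k.+1) - f xs) -
     alpha k * (alpha k - 1) * (f (xb k) - f xs) <=
     reg k + (alpha k ^+ 2 * l - alpha k ^+ 2 * ((2 * M)^-1 * D k) - mart k).
  have := leon_fun_step L_gt0 nu01 pB subf holderf (xb k) (x k) (x k.+1) xs s0 (alpha_ge1 k).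
  have e : leon_avg (alpha k) (xb k) (x k.+1) = xb k.+1 by rewrite /xb /st leon_xbarS.
  rewrite -/(w k) e => h; apply: (le_trans h); rewrite -/l -/M -/(D k).
  rewrite /reg /mart /g /gt /leon_sgrad -/(w k) e -/(nw k) -/(nz k).
  rewrite !(innerZl ipP, innerDl ipP, innerNl ipP, innerDr ipP, innerNr ipP).
  by rewrite le_eqVlt; apply/orP; left; apply/eqP; ring.
apply: (le_trans (ler_sum _ (fun k _ => step (nat_of_ord k)))).
rewrite big_split /=.
have regK : \sum_(k < K.+1) reg k <= 6 * r * op_trace (op_sqrt ip (st_S (st K.+1))).
  apply: (@regret_le _ _ ip H sH r r_gt0 x (fun k => st_m (st k)) g gt
    (fun k => st_S (st k)) delta xs delta_gt0 erefl erefl erefl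
    (leon_mS ip H r delta alpha _ xi xi') (leon_xS ip H r delta alpha _ xi xi')
    (leon_SS ip H r delta alpha _ xi xi')).
  exact/(rho_ballP sH r_gt0).
pose e k := gt k - g k.
have pTr : pos_semidef ip (\sum_(k < K.+1) oproj ip H (outer ip (e k))).
  elim/big_ind: _ => [|A F|k _]; [|exact: pos_semidefD|exact: pos_semidef_oproj_outer].
  by split=> [u v|u]; rewrite !zero_lfunE ?(inner0l ipP) (inner0r ipP).
have SE : st_S (st K.+1) = delta ^+ 2 *: \1%VF + \sum_(k < K.+1) oproj ip H (outer ip (e k)).
  elim: (K.+1) => [|k IH]; first by rewrite big_ord0 addr0.
  by rewrite big_ord_recr /= addrA -IH /st leon_SS.
have trK := op_trace_sqrt_bound pTr pB trB delta_gt0 t0.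
have dotE : op_dot ip (\sum_(k < K.+1) oproj ip H (outer ip (e k))) (B^-1)%VF =
    \sum_(k < K.+1) dual (e k).
  rewrite (inner_suml odP); apply: eq_bigr => k _.
  rewrite op_dot_oproj ?op_dot_outer//; first exact: (pos_def_inv pB).1.
  exact: (pos_def_inv_in sH).
rewrite dotE -SE in trK.
have regK' : \sum_(k < K.+1) reg k <= 6 * r * delta * (\dim {:X})%:R + 3 * r * tau +
    \sum_(k < K.+1) 3 * r / tau * dual (e k).
  apply: (le_trans regK); rewrite -mulr_sumr.
  apply: (le_trans (ler_wpM2l _ trK)); first by rewrite mulr_ge0// ltW.
  by rewrite le_eqVlt; apply/orP; left; apply/eqP; field; rewrite gt_eqF.
apply: (le_trans (lerD regK' (lexx _))).
rewrite -addrA lerD2l -big_split /=; apply: ler_sum => k _.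
have D0 : 0 <= D k by exact: (pos_defW (pos_def_inv pB)).2.
have eE : e k = alpha k *: ((grad (xb k.+1) - grad (w k)) + (nz k - nw k)).
  rewrite /e /g /gt /leon_sgrad -/(w k).
  have -> : leon_avg (alpha k) (xb k) (x k.+1) = xb k.+1 by rewrite /xb /st leon_xbarS.
  by rewrite -scalerBr opprD addrACA.
have h1 : 3 * r / tau * dual (e k) <=
    3 * r / tau * (alpha k ^+ 2 * (2 * D k + 4 * (dual (nw k) + dual (nz k)))).
  by rewrite ler_wpM2l ?eE ?dual_sum_le// divr_ge0 ?mulr_ge0// ltW.
(* [6 r / tau <= 1 / (2 M)] is the condition [12 r M <= tau]. *)
have h2 : 3 * r / tau * 2 <= (2 * M)^-1.
  have -> : 3 * r / tau * 2 = (tau / (6 * r))^-1 by field; rewrite !gt_eqF.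
  have M2 : 0 < 2 * M by exact: mulr_gt0.
  have r6 : 0 < 6 * r by exact: mulr_gt0.
  rewrite lef_pV2 ?posrE ?divr_gt0// ler_pdivlMr//.
  by apply: le_trans tau_ge; rewrite le_eqVlt; apply/orP; left; apply/eqP; ring.
have h3 : 3 * r / tau * 2 * (alpha k ^+ 2 * D k) <= (2 * M)^-1 * (alpha k ^+ 2 * D k).
  by rewrite ler_wpM2r// mulr_ge0// sqr_ge0.
rewrite -/(mart k) addrA lerD2r addrA.
have -> : 12 * r / tau * alpha k ^+ 2 * (dual (nw k) + dual (nz k)) =
   3 * r / tau * (alpha k ^+ 2 * (2 * D k + 4 * (dual (nw k) + dual (nz k)))) -
   3 * r / tau * 2 * (alpha k ^+ 2 * D k).
  by field; rewrite gt_eqF.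
rewrite -subr_ge0; move: h1 h3.
rewrite [alpha k ^+ 2 * (_^-1 * D k)]mulrCA.
move: (3 * r / tau * dual _) (3 * r / tau * (alpha k ^+ 2 * (_ + _))) => a b.
move: (3 * r / tau * 2 * _) (_^-1 * _) (alpha k ^+ 2 * l) => c d i; lra.
Qed.

End Pointwise.

(** * Measurability of the iterates *)

Section VectorMeasurability.
Context {R : realType} {d : measure_display} {T : measurableType d}.

(** Measurability tested on linear functionals, which reduces algebra on vectors and operators to
    real-valued functions; [vec_measurableP] identifies it with Borel measurability. *)
Definition vec_measurable (X : vectType R) (Y : T -> X) :=
  forall phi : 'Hom(X, R^o), measurable_fun setT (fun w => phi (Y w) : R).

Lemma vec_measurableP (X : vectType R) (Y : T -> X) :
  measurable_fun setT (Y : T -> borel_vect X) <-> vec_measurable Y.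
Proof.
split=> [mY phi|mY].
  apply: (measurability _ (RGenOInfty.measurableE R)) => //.
  move=> _ [_ [c ->] <-].
  rewrite (_ : _ `&` _ = setT `&` Y @^-1` [set x | c < phi x]); last first.
    by apply/seteqP; split=> w /=; rewrite in_itv/= andbT.
  apply: mY => //; apply: sub_sigma_algebra.
  by exists phi => //; exists c.
apply: (measurability _ (erefl : (@measurable _ (borel_vect X)) = <<s @half_spaces R X >>)).
move=> _ [_ [phi _ [c _ <-]] <-].
rewrite (_ : _ `&` _ = setT `&` (fun w => phi (Y w) : R) @^-1` `]c, +oo[%classic).
  by apply: mY => //; exact: measurable_itv.
by apply/seteqP; split=> w /=; rewrite in_itv/= andbT.
Qed.

Lemma vec_measurable_lfun (X X' : vectType R) (h : 'Hom(X, X')) (Y : T -> X) :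
  vec_measurable Y -> vec_measurable (fun w => h (Y w)).
Proof.
move=> mY phi; apply: eq_measurable_fun (mY (phi \o h)%VF) => w _.
by rewrite comp_lfunE.
Qed.

Lemma vec_measurable_linear (X X' : vectType R) (h : X -> X') (Y : T -> X) :
  linear h -> vec_measurable Y -> vec_measurable (fun w => h (Y w)).
Proof.
move=> lh mY phi; apply: eq_measurable_fun (vec_measurable_lfun (linfun h) mY phi) => w _.
by rewrite linfun_linearE.
Qed.

Lemma vec_measurable_cst (X : vectType R) (x : X) : vec_measurable (fun=> x).
Proof. by move=> phi; exact: measurable_cst. Qed.

Lemma vec_measurableD (X : vectType R) (Y Z : T -> X) :
  vec_measurable Y -> vec_measurable Z -> vec_measurable (fun w => Y w + Z w).
Proof.
move=> mY mZ phi; apply: eq_measurable_fun (measurable_funD (mY phi) (mZ phi)) => w _.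
by rewrite linearD.
Qed.

Lemma vec_measurable_scale (X : vectType R) (r : T -> R) (x : X) :
  measurable_fun setT r -> vec_measurable (fun w => r w *: x).
Proof.
move=> mr phi; apply: eq_measurable_fun (measurable_funM mr (measurable_cst (phi x))) => w _.
by rewrite linearZ.
Qed.

Lemma vec_measurable_sum (X : vectType R) (I : Type) (s : seq I) (Y : I -> T -> X) :
  (forall i, vec_measurable (Y i)) -> vec_measurable (fun w => \sum_(i <- s) Y i w).
Proof.
move=> mY phi.
apply: eq_measurable_fun (@measurable_sum _ _ _ setT _ s _ (fun i => mY i phi)) => w _.
by rewrite linear_sum.
Qed.

Lemma coord_measurable (X : vectType R) (Y : T -> X) n (e : n.-tuple X) i :
  vec_measurable Y -> measurable_fun setT (fun w => coord e i (Y w)).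
Proof.
move=> mY; apply: eq_measurable_fun (mY (linfun (coord e i : X -> R^o))) => w _.
by rewrite lfunE.
Qed.

(** Expanding both arguments in bases leaves products of measurable coordinates. *)
Lemma vec_measurable_bilinear (X1 X2 X : vectType R) (b : X1 -> X2 -> X)
    (Y : T -> X1) (Z : T -> X2) :
  (forall x, linear (b x)) -> (forall y, linear (b^~ y)) ->
  vec_measurable Y -> vec_measurable Z -> vec_measurable (fun w => b (Y w) (Z w)).
Proof.
move=> lbr lbl mY mZ.
pose e1 := vbasis {:X1}; pose e2 := vbasis {:X2}.
have bE w : b (Y w) (Z w) = \sum_i \sum_j
    (coord e1 i (Y w) * coord e2 j (Z w)) *: b e1`_i e2`_j.
  rewrite {1}(coord_basis (vbasisP {:X1}) (memvf (Y w))).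
  rewrite -(linfun_linearE (lbl (Z w))) linear_sum; apply: eq_bigr => i _.
  rewrite linearZ /= (linfun_linearE (lbl (Z w))).
  rewrite {1}(coord_basis (vbasisP {:X2}) (memvf (Z w))).
  rewrite -(linfun_linearE (lbr e1`_i)) linear_sum scaler_sumr; apply: eq_bigr => j _.
  by rewrite linearZ /= (linfun_linearE (lbr e1`_i)) scalerA.
suff : vec_measurable (fun w => \sum_i \sum_j
    (coord e1 i (Y w) * coord e2 j (Z w)) *: b e1`_i e2`_j).
  by move=> h phi; apply: eq_measurable_fun (h phi) => w _; rewrite bE.
apply: vec_measurable_sum => i; apply: vec_measurable_sum => j.
by apply: vec_measurable_scale; apply: measurable_funM; exact: coord_measurable.
Qed.

Lemma vec_measurable_real (X : vectType R) (h : X -> R) (Y : T -> X) :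
  linear (h : X -> R^o) -> vec_measurable Y -> measurable_fun setT (fun w => h (Y w)).
Proof.
move=> lh mY; apply: eq_measurable_fun (mY (linfun (h : X -> R^o))) => w _.
by rewrite linfun_linearE.
Qed.

Lemma bilinear_measurable (X1 X2 : vectType R) (b : X1 -> X2 -> R)
    (Y : T -> X1) (Z : T -> X2) :
  (forall x, linear (b x : X2 -> R^o)) -> (forall y, linear (b^~ y : X1 -> R^o)) ->
  vec_measurable Y -> vec_measurable Z -> measurable_fun setT (fun w => b (Y w) (Z w)).
Proof.
move=> lbr lbl mY mZ.
have := vec_measurable_bilinear (b := b : X1 -> X2 -> R^o) lbr lbl mY mZ.
move=> /(_ \1%VF); apply: eq_measurable_fun => w _.
by rewrite id_lfunE.
Qed.

End VectorMeasurability.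

Lemma riesz_representation (R : realType) (X : vectType R) (ip : {dot X for idfun})
    (phi : 'Hom(X, R^o)) : exists u, forall v, phi v = ip u v.
Proof.
have ipP := dot_inner_product ip; have [s sP] := onb_exists ip.
exists (\sum_(x <- s) (phi x : R) *: x) => v.
rewrite {1}(onb_expand sP (memvf v)) linear_sum (inner_suml ipP).
by apply: eq_bigr => x _; rewrite linearZ /= (innerZl ipP) mulrC.
Qed.

Section LeonMeasurable.
Context {R : realType} {X : vectType R} (ip : {dot X for idfun}).
Context (H : {vspace 'End(X)}) (sH : structured_subspace ip H).
Context {d : measure_display} {T : measurableType d}.
Local Notation ipP := (dot_inner_product ip).

Lemma lfun_app_measurable (A : T -> 'End(X)) (Y : T -> X) :
  vec_measurable A -> vec_measurable Y -> vec_measurable (fun w => A w (Y w)).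
Proof.
apply: vec_measurable_bilinear => [F|y] a u v; first by rewrite linearP.
by rewrite add_lfunE scale_lfunE.
Qed.

Lemma comp_lfun_measurable (A F : T -> 'End(X)) :
  vec_measurable A -> vec_measurable F -> vec_measurable (fun w => (A w \o F w)%VF).
Proof.
apply: (@vec_measurable_bilinear _ _ _ _ _ _ (@comp_lfun _ X X X)) => A0 a u v.
  by apply/lfunP => x; rewrite !(comp_lfunE, add_lfunE, scale_lfunE) linearP.
by apply/lfunP => x; rewrite !(comp_lfunE, add_lfunE, scale_lfunE).
Qed.

Lemma vec_measurableZ (V : vectType R) (a : R) (Y : T -> V) :
  vec_measurable Y -> vec_measurable (fun w => a *: Y w).
Proof.
by apply: vec_measurable_linear => b u v; rewrite scalerDr !scalerA mulrC.
Qed.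

Lemma vec_measurableB (V : vectType R) (Y Z : T -> V) :
  vec_measurable Y -> vec_measurable Z -> vec_measurable (fun w => Y w - Z w).
Proof.
move=> mY mZ; apply: vec_measurableD => //.
by apply: (vec_measurable_linear (h := -%R) _ mZ) => b u v; rewrite opprD scalerN.
Qed.

Lemma vec_measurable_scaler (V : vectType R) (a : T -> R) (Y : T -> V) :
  measurable_fun setT a -> vec_measurable Y -> vec_measurable (fun w => a w *: Y w).
Proof.
move=> ma mY phi; apply: eq_measurable_fun (measurable_funM ma (mY phi)) => w _.
by rewrite linearZ.
Qed.

Lemma outer_measurable (Y : T -> X) :
  vec_measurable Y -> vec_measurable (fun w => outer ip (Y w)).
Proof.
move=> mY; pose b (u v : X) : 'End(X) := linfun (fun x => ip u x *: v).
have bE u v x : b u v x = ip u x *: v.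
  by rewrite linfun_linearE // => a p q; rewrite (innerDr ipP) (innerZr ipP) scalerDl scalerA.
apply: (vec_measurable_bilinear (b := b) _ _ mY mY) => [u|v] a p q;
  apply/lfunP => x; rewrite add_lfunE scale_lfunE !bE.
  by rewrite scalerDr !scalerA mulrC.
by rewrite (innerDl ipP) (innerZl ipP) scalerDl scalerA.
Qed.

Lemma op_trace_measurable (A : T -> 'End(X)) :
  vec_measurable A -> measurable_fun setT (fun w => op_trace (A w)).
Proof. by apply: vec_measurable_real => a F G; rewrite op_trace_linear. Qed.

Lemma newton_op_measurable (A : T -> 'End(X)) n :
  vec_measurable A -> vec_measurable (fun w => newton_op (A w) n).
Proof.
move=> mA; elim: n => [|n IH] /=; first exact: vec_measurable_cst.
apply: vec_measurableB; apply: vec_measurableZ => //.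
have m1 : vec_measurable (fun w =>
    (newton_op (A w) n \o A w \o newton_op (A w) n)%VF).
  by do 2! [apply: comp_lfun_measurable => //].
by apply: vec_measurableD; exact: comp_lfun_measurable.
Qed.

(** A pointwise limit of Newton iterates, which are polynomial in [A w] divided by its trace. *)
Lemma inv_op_sqrt_measurable (A : T -> 'End(X)) (Y : T -> X) :
  (forall w, pos_def ip (A w)) -> vec_measurable A -> vec_measurable Y ->
  vec_measurable (fun w => (op_sqrt ip (A w))^-1%VF (Y w)).
Proof.
move=> pA mA mY phi; have [u uE] := riesz_representation ip phi.
have mtr := op_trace_measurable mA.
pose c w := op_trace (A w).
have c_ge0 w : 0 <= c w by apply: (op_trace_ge0 (ip := ip)); exact: pos_defW.
have mpow p : measurable_fun setT (fun w => c w `^ p).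
  exact: (measurableT_comp (measurable_powR p) mtr).
apply: (measurable_fun_cvg (h := fun n w => c w `^ (- 2^-1) *
    phi (newton_op ((c w `^ (-1)) *: A w) n (Y w)))).
  move=> n; apply: measurable_funM => //.
  have m1 : vec_measurable (fun w => (c w `^ (-1)) *: A w) by exact: vec_measurable_scaler.
  exact: (lfun_app_measurable (newton_op_measurable n m1) mY).
move=> w _; have h := @newton_op_cvg _ _ ip (A w) u (Y w) (pA w).
have -> : phi ((op_sqrt ip (A w))^-1%VF (Y w)) =
    c w `^ (- 2^-1) * (Num.sqrt (c w) * ip u ((op_sqrt ip (A w))^-1%VF (Y w))).
  rewrite powRN powR12_sqrt// uE mulrA.
  (* A vanishing trace forces the basis to be empty, hence a zero space, where both sides are
     zero. *)
  have [c0|c0] := eqVneq (Num.sqrt (c w)) 0; last by rewrite mulVf// mul1r.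
  rewrite c0 mulr0 mul0r.
  have [s sP] := onb_exists ip.
  suff -> : (op_sqrt ip (A w))^-1%VF (Y w) = 0 by rewrite (inner0r ipP).
  rewrite [LHS](onb_expand sP (memvf _)) big_seq big1// => x xs.
  have /andP[l0 lc] := pos_def_eigen_gt0 sP (pA w) xs.
  by move/eqP: c0; rewrite sqrtr_eq0 leNgt (lt_le_trans l0 lc).
apply: cvgM; first exact: cvg_cst.
by under eq_cvg do rewrite uE powR_inv1//.
Qed.

Context (r delta : R) (r_gt0 : 0 < r) (delta_gt0 : 0 < delta) (alpha : nat -> R).
Context {d' : measure_display} {Xi : measurableType d'} (sg : Xi -> X -> X).
Hypothesis msg : measurable_fun [set: Xi * borel_vect X] (fun p => sg p.1 p.2 : borel_vect X).
Context (xi xi' : nat -> T -> Xi).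

Let st w k := leon ip H r delta alpha sg (xi^~ w) (xi'^~ w) k.

Lemma oracle_comp_measurable (s : T -> Xi) (Y : T -> X) :
  measurable_fun setT s -> vec_measurable Y -> vec_measurable (fun w => sg (s w) (Y w)).
Proof.
move=> ms /vec_measurableP mY; apply/vec_measurableP.
exact: (measurableT_comp msg (measurable_fun_pair ms mY)).
Qed.

Lemma leon_avg_measurable a (Y Z : T -> X) :
  vec_measurable Y -> vec_measurable Z -> vec_measurable (fun w => leon_avg a (Y w) (Z w)).
Proof. by move=> mY mZ; apply: vec_measurableD; exact: vec_measurableZ. Qed.

Lemma leon_sgrad_measurable a (s : T -> Xi) (Y Z : T -> X) :
  measurable_fun setT s -> vec_measurable Y -> vec_measurable Z ->
  vec_measurable (fun w => leon_sgrad sg a (Y w) (s w) (Z w)).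
Proof.
move=> ms mY mZ; apply: vec_measurableZ; apply: oracle_comp_measurable => //.
exact: leon_avg_measurable.
Qed.

(** The sigma-algebra on [T] is a parameter: it is that of [Omega] for the final gap, and the past
    of one sample for the noise terms. *)
Record leon_measurable (k : nat) : Prop := LeonMeasurable {
  lm_x : vec_measurable (fun w => st_x (st w k)) ;
  lm_xbar : vec_measurable (fun w => st_xbar (st w k)) ;
  lm_m : vec_measurable (fun w => st_m (st w k)) ;
  lm_S : vec_measurable (fun w => st_S (st w k))
}.

(** The next iterate and average require [xi k] but not [xi' k.+1], so they are known before the
    second sample of the step is drawn. *)
Lemma leon_half_step k : leon_measurable k -> measurable_fun setT (xi k) ->
  [/\ vec_measurable (fun w => st_m (st w k.+1)),
      vec_measurable (fun w => st_x (st w k.+1)) &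
      vec_measurable (fun w => st_xbar (st w k.+1))].
Proof.
case=> mx mxb mm mS mxi.
have mm' : vec_measurable (fun w => st_m (st w k.+1)).
  have -> : (fun w => st_m (st w k.+1)) = (fun w => st_m (st w k) +
      leon_sgrad sg (alpha k) (st_xbar (st w k)) (xi k w) (st_x (st w k))).
    by apply/funext => w; rewrite /st leon_mS.
  by apply: vec_measurableD => //; exact: leon_sgrad_measurable.
have SP w : st_S (st w k) \in H /\ pos_def ip (st_S (st w k)).
  exact: (@leon_SP _ _ ip H sH
    (fun k => leon_sgrad sg (alpha k) (st_xbar (st w k)) (xi k w) (st_x (st w k)))
    (fun k => leon_sgrad sg (alpha k) (st_xbar (st w k)) (xi' k.+1 w) (st_x (st w k.+1)))
    (fun k => st_S (st w k)) delta delta_gt0 erefl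
    (leon_SS ip H r delta alpha sg (xi^~ w) (xi'^~ w)) k).
have mx' : vec_measurable (fun w => st_x (st w k.+1)).
  have -> : (fun w => st_x (st w k.+1)) = (fun w => (- r) *:
     leon_inv ip H (st_S (st w k)) (st_m (st w k.+1)) (st_m (st w k.+1))).
    apply/funext => w; have [SH pS] := SP w.
    by rewrite /st leon_xS (gradient_Psi_star sH r_gt0 _ SH pS) scaleNr.
  apply: vec_measurableZ; apply: inv_op_sqrt_measurable => //.
    by move=> w; apply: pos_def_leon_op => //; exact: (SP w).2.
  apply: vec_measurableD => //.
  apply: vec_measurable_linear; first exact: oproj_linear.
  exact: outer_measurable.
split=> //.
have -> : (fun w => st_xbar (st w k.+1)) =
    (fun w => leon_avg (alpha k) (st_xbar (st w k)) (st_x (st w k.+1))).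
  by apply/funext => w; rewrite /st leon_xbarS.
exact: leon_avg_measurable.
Qed.

Lemma leon_state_measurable k :
  (forall j, (j < k)%N -> measurable_fun setT (xi j)) ->
  (forall j, (j < k)%N -> measurable_fun setT (xi' j.+1)) -> leon_measurable k.
Proof.
elim: k => [_ _|k IH mxi mxi']; first by split; exact: vec_measurable_cst.
have lm : leon_measurable k.
  by apply: IH => j jk; [apply: mxi|apply: mxi']; exact: ltnW.
have [mm' mx' mxb'] := leon_half_step lm (mxi k (ltnSn k)).
case: lm => mx mxb mm mS; split=> //.
have -> : (fun w => st_S (st w k.+1)) = (fun w => st_S (st w k) + oproj ip H (outer ip
   (leon_sgrad sg (alpha k) (st_xbar (st w k)) (xi' k.+1 w) (st_x (st w k.+1)) -
    leon_sgrad sg (alpha k) (st_xbar (st w k)) (xi k w) (st_x (st w k))))).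
  by apply/funext => w; rewrite /st leon_SS.
apply: vec_measurableD => //; apply: vec_measurable_linear; first exact: oproj_linear.
apply: outer_measurable; apply: vec_measurableB; apply: leon_sgrad_measurable => //.
  exact: mxi'.
exact: mxi.
Qed.

End LeonMeasurable.

Section FunctionMeasurable.
Context {R : realType} {X : vectType R} (ip : {dot X for idfun}).
Context (L nu : R) (B : 'End(X)) (f : X -> R) (grad : X -> X).
Hypotheses (L_gt0 : 0 < L) (nu01 : 0 <= nu <= 1) (pB : pos_def ip B).
Hypothesis subf : forall x, subgradient ip f x (grad x).
Hypothesis holderf : holder_smooth ip L nu B grad.
Context {d : measure_display} {T : measurableType d}.
Local Notation ipP := (dot_inner_product ip).

Lemma rational_approximation (s : seq X) : orthonormal_basis ip {:X} s ->
  forall (x : X) (e : R), 0 < e -> exists q : {ffun 'I_(size s) -> rat},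
    hnorm ip B (x - \sum_(i < size s) ratr (q i) *: s`_i) < e.
Proof.
move=> sP x e e0.
have [c c0 cP] := lfun_bounded ipP fullv B.
pose k : R := (size s)%:R + 1.
have k0 : 0 < k by rewrite ltr_wpDl.
(* Each squared coordinate error is at most [h], so [(c + 1) |u|^2 <= e^2 * size s / k]; taking
   [k = size s + 1] makes this strict. *)
pose h := e ^+ 2 / ((c + 1) * k).
have h0 : 0 < h by rewrite divr_gt0 ?exprn_gt0// mulr_gt0// ltr_wpDl.
pose h' := Num.sqrt h.
have h'0 : 0 < h' by rewrite sqrtr_gt0.
have [q qP] : exists q : 'I_(size s) -> rat, forall i : 'I_(size s), `|ip s`_i x - ratr (q i)| <= h'.
  have a (i : 'I_(size s)) : exists q : rat, `|ip s`_i x - ratr q| <= h'.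
    have lt_i : ip s`_i x - h' < ip s`_i x + h' by rewrite ltrD2l gtrN.
    have [q] := rat_in_itvoo lt_i.
    rewrite in_itv /= => /andP[q1 q2]; exists q.
    by rewrite ler_norml; apply/andP; split; lra.
  by have [q qP] := choice a; exists q.
exists [ffun i => q i]; set y := \sum_(i < _) _; set u := x - y.
have su (i : 'I_(size s)) : ip s`_i u = ip s`_i x - ratr (q i).
  rewrite /u (innerBr ipP); congr (_ - _); rewrite /y (inner_sumr ipP) (bigD1 i)//=.
  rewrite ffunE (innerZr ipP) (onb_inner sP) ?mem_nth// eqxx mulr1 big1 ?addr0// => j ji.
  rewrite (innerZr ipP) (onb_inner sP) ?mem_nth// nth_uniq ?(onb_uniq sP)//.
  by rewrite eq_sym -(inj_eq val_inj) in ji; rewrite (negPf ji) mulr0.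
have uu : ip u u <= (size s)%:R * h.
  rewrite (parseval ipP u sP (memvf u)) (big_nth 0) big_mkord.
  apply: (@le_trans _ _ (\sum_(i < size s) h)); last first.
    by rewrite sumr_const card_ord mulr_natl.
  apply: ler_sum => i _; rewrite su -expr2 -[h]sqr_sqrtr ?(ltW h0)//.
  by rewrite -[leLHS]real_normK ?num_real// ler_sqr ?nnegrE ?(ltW h'0) ?qP.
rewrite -ltr_sqr ?nnegrE ?sqrtr_ge0 ?(ltW e0)// hnorm_sqr; last exact: pos_defW.
apply: (@le_lt_trans _ _ ((c + 1) * ip u u)).
  by apply: le_of_sqr_le (cP u (memvf u)) (cauchy_schwarz ipP _ _) => //; exact: (inner_ge0 ipP).
apply: (@le_lt_trans _ _ ((c + 1) * ((size s)%:R * h))).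
  by rewrite ler_wpM2l// addr_ge0.
have -> : (c + 1) * ((size s)%:R * h) = e ^+ 2 * ((size s)%:R / k).
  by rewrite /h; field; rewrite !gt_eqF ?ltr_wpDl.
by rewrite gtr_pMr ?exprn_gt0// ltr_pdivrMr// mul1r ltrDl.
Qed.

(* [f] is the supremum of its affine minorants at the points with rational coordinates. *)
Lemma convex_fun_measurable (Y : T -> X) :
  vec_measurable Y -> measurable_fun setT (fun w => f (Y w)).
Proof.
move=> mY; have [s sP] := onb_exists ip.
pose pt (q : {ffun 'I_(size s) -> rat}) := \sum_(i < size s) ratr (q i) *: s`_i : X.
pose aff q w := f (pt q) + ip (grad (pt q)) (Y w - pt q).
have maff q : measurable_fun setT (aff q).
  apply: measurable_funD; first exact: measurable_cst.
  apply: (vec_measurable_real (h := ip (grad (pt q)))); first exact: (inner_linear ipP).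
  by apply: vec_measurableB => //; exact: vec_measurable_cst.
apply: (measurability _ (RGenOInfty.measurableE R)) => //.
move=> _ [_ [c ->] <-]; rewrite setTI.
have -> : (fun w => f (Y w)) @^-1` `]c, +oo[ =
    \bigcup_k (if unpickle k is Some q then aff q @^-1` `]c, +oo[ else set0).
  apply/seteqP; split=> w /=; rewrite in_itv/= andbT; last first.
    move=> [k _]; case: unpickle => // q /=; rewrite in_itv/= andbT => h.
    exact: lt_le_trans h (subf _ _).
  (* The bound by 1 gives [T^nu <= 1] for the distance [T], so the loss [L * T^nu * T] is at most
     [L * T], below [f (Y w) - c]. *)
  move=> cf; pose e := Num.min 1 ((f (Y w) - c) / L).
  have e0 : 0 < e by rewrite lt_min ltr01 divr_gt0// subr_gt0.
  have [q qP] := rational_approximation sP (Y w) e0.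
  exists (pickle q) => //=; rewrite pickleK /= in_itv/= andbT /aff -/(pt q).
  rewrite -/(pt q) in qP; move: qP; rewrite lt_min => /andP[q1 q2].
  have h1 := subf (Y w) (pt q).
  have h2 := holder_pairing pB holderf (Y w) (pt q).
  have T0 : 0 <= hnorm ip B (Y w - pt q) by exact: sqrtr_ge0.
  have h3 : L * (hnorm ip B (Y w - pt q) `^ nu * hnorm ip B (Y w - pt q)) < f (Y w) - c.
    rewrite mulrC -ltr_pdivlMr//; apply: le_lt_trans q2.
    rewrite ler_piMl//; have /andP[nu0 _] := nu01.
    have [->|n0] := eqVneq nu 0; first by rewrite powRr0.
    have -> : 1 = 1 `^ nu :> R by rewrite powR1.
    by apply: ge0_ler_powR => //; rewrite ?nnegrE//; exact: ltW.
  move: h1 h2 h3; rewrite -opprB (innerNr ipP) (innerBl ipP).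
  move: (ip (grad (Y w)) _) (ip (grad (pt q)) _) (f (Y w)) (f (pt q)) (L * _).
  by move=> a b p p' l *; lra.
apply: bigcupT_measurable => k; case: unpickle => // q.
by rewrite -[X in measurable X]setTI; apply: maff => //; exact: measurable_itv.
Qed.

End FunctionMeasurable.

(** * Measurability and integrability of the noise *)

Section Oracle.
Context {R : realType} {X : vectType R} (ip : {dot X for idfun}).
Context {d : measure_display} {Xi : measurableType d} (D : probability Xi R).
Context (B : 'End(X)) (sigma : R) (grad : X -> X) (n : Xi -> X -> X).
Hypotheses (pB : pos_def ip B) (orac : stochastic_oracle ip D B sigma grad n).
Local Notation ipP := (dot_inner_product ip).
Local Notation dual u := (ip u (B^-1%VF u)).

Lemma dual_measurable {d' : measure_display} {T : measurableType d'} (Y : T -> X) :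
  vec_measurable Y -> measurable_fun setT (fun w => dual (Y w)).
Proof.
move=> mY; apply: (bilinear_measurable (b := fun u v => ip u (B^-1%VF v))) => //.
  by move=> x a u v; rewrite linearP (innerDr ipP) (innerZr ipP).
by move=> y a u v; rewrite (innerDl ipP) (innerZl ipP).
Qed.

Lemma noise_section_measurable x : vec_measurable (fun s => n s x).
Proof.
have h : vec_measurable (fun s => grad x + n s x).
  apply/vec_measurableP.
  exact: (measurableT_comp (oracle_measurable orac) (pair2_measurable (x : borel_vect X))).
move=> phi; apply: eq_measurable_fun
  (vec_measurableB h (vec_measurable_cst (grad x)) phi) => s _.
by rewrite addrAC subrr add0r.
Qed.

Lemma noise_variance x : (\int[D]_s (dual (n s x))%:E <= (sigma ^+ 2)%:E)%E.
Proof.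
have := oracle_variance orac x; rewrite unlock.
by under eq_integral do rewrite (hnorm_sqr _ (pos_defW (pos_def_inv pB))).
Qed.

Lemma dual_ge0 u : 0 <= dual u.
Proof. exact: (pos_defW (pos_def_inv pB)).2. Qed.

Lemma dual_noise_integrable x : D.-integrable setT (fun s => (dual (n s x))%:E).
Proof.
apply/integrableP; split.
  by apply/measurable_EFinP; apply: dual_measurable; exact: noise_section_measurable.
under eq_integral do rewrite gee0_abs ?lee_fin ?dual_ge0//.
exact: le_lt_trans (noise_variance x) (ltry _).
Qed.

(** Young's inequality for both signs dominates the pairing by [<u, B u>] plus the squared dual norm
    of the noise. *)
Lemma noise_integrable u x : D.-integrable setT (fun s => (ip u (n s x))%:E).
Proof.
have m : measurable_fun setT (fun s => ip u (n s x)).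
  by apply: (vec_measurable_real (h := ip u));
    [exact: (inner_linear ipP)|exact: noise_section_measurable].
have i1 : D.-integrable setT (EFin \o (cst (ip u (B u)) : Xi -> R)).
  exact: finite_measure_integrable_cst.
apply: (le_integrable _ _ _ (integrableD measurableT i1 (dual_noise_integrable x))) => //.
  exact/measurable_EFinP.
move=> s _; rewrite /= lee_fin.
rewrite [leRHS]ger0_norm ?addr_ge0 ?dual_ge0 ?(pos_defW pB).2//.
have h1 := young_quad (n s x) u pB; have h2 := young_quad (- n s x) u pB.
have h3 := dual_ge0 (n s x); have h4 := (pos_defW pB).2 u.
move: h1 h2; rewrite linearN !(innerNl ipP) (innerNr ipP) opprK (innerC ipP _ u).
move: h3 h4; move: (dual (n s x)) (ip u (B u)) (ip u (n s x)) => a b c h3 h4 h1 h2.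
by rewrite ler_norml; apply/andP; split; lra.
Qed.

Lemma noise_mean0 u x : (\int[D]_s (ip u (n s x))%:E = 0)%E.
Proof. by have := oracle_unbiased orac x u; rewrite unlock. Qed.

(* Fubini: [grad x] is the mean of the jointly measurable stochastic gradient. *)
Lemma grad_measurable {d' : measure_display} {T : measurableType d'} (Y : T -> X) :
  vec_measurable Y -> vec_measurable (fun w => grad (Y w)).
Proof.
move=> mY phi; have [u uE] := riesz_representation ip phi.
suff h : measurable_fun [set: borel_vect X] (fun x => ip u (grad x)).
  move/vec_measurableP: mY => mY.
  by apply: eq_measurable_fun (measurableT_comp h mY) => w _; rewrite /= uE.
pose F (p : borel_vect X * Xi) : \bar R := (ip u (grad p.1 + n p.2 p.1))%:E.
have mF : measurable_fun setT F.
  apply/measurable_EFinP.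
  apply: (vec_measurable_real (h := ip u)); first exact: (inner_linear ipP).
  apply/vec_measurableP.
  exact: (measurableT_comp (oracle_measurable orac)
    (measurable_fun_pair measurable_snd measurable_fst)).
have mFp : measurable_fun setT (fubini_F D (F^\+)%E).
  by apply: measurable_fun_fubini_tonelli_F => //; exact: measurable_funepos.
have mFn : measurable_fun setT (fubini_F D (F^\-)%E).
  by apply: measurable_fun_fubini_tonelli_F => //; exact: measurable_funeneg.
apply/measurable_EFinP; apply: eq_measurable_fun (emeasurable_funB mFp mFn) => x _.
transitivity (\int[D]_s F (x, s))%E; first rewrite [RHS]integralE.
  by congr (_ - _)%E; apply: eq_integral => s _; rewrite unlock.
rewrite /F /=.
under eq_integral do rewrite (innerDr ipP) EFinD.
rewrite integralD//; last exact: noise_integrable.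
  by rewrite noise_mean0 adde0 integral_cst//= probability_setT mule1.
exact: finite_measure_integrable_cst.
Qed.

Lemma noise_measurable {d' : measure_display} {T : measurableType d'}
    (s : T -> Xi) (Y : T -> X) :
  measurable_fun setT s -> vec_measurable Y -> vec_measurable (fun w => n (s w) (Y w)).
Proof.
move=> ms mY phi; apply: eq_measurable_fun (vec_measurableB
  (oracle_comp_measurable (sg := fun s x => grad x + n s x)
    (oracle_measurable orac) ms mY) (grad_measurable mY) phi) => w _.
by rewrite /= addrAC subrr add0r.
Qed.

End Oracle.

(** * Independence of the past *)

Section Freezing.
Context {R : realType} {d : measure_display} {Omega : measurableType d}.
Context {d' : measure_display} {Xi : measurableType d'}.
Context (P : probability Omega R) (D : probability Xi R) (G : set (set Omega)).
Context (xi : Omega -> Xi).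
Local Notation Past := (g_sigma_algebraType G).
Hypotheses (mG : G `<=` measurable) (mxi : measurable_fun setT xi).
Hypothesis indep : forall A E, <<s G >> A -> measurable E ->
  P (A `&` xi @^-1` E) = (P A * D E)%E.

Lemma past_measurable (A : set Omega) : <<s G >> A -> measurable A.
Proof. by apply: smallest_sub => //; exact: sigma_algebra_measurable. Qed.

Lemma past_id_measurable : measurable_fun setT (id : Omega -> Past).
Proof. by move=> _ A mA; rewrite setTI; exact: past_measurable. Qed.

(** [Past] is [Omega] with the coarser sigma-algebra. Independence says that [w] seen in [Past] and
    [xi w] have a product law, and Tonelli's theorem integrates out the sample with the past held
    fixed. *)
Lemma freezing (h : Past * Xi -> \bar R) :
  measurable_fun setT h -> (forall z, 0 <= h z)%E ->
  (\int[P]_w h (w : Past, xi w) = \int[P]_w \int[D]_s h (w : Past, s))%E.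
Proof.
move=> mh h0.
(* The identity as a random variable into [Past]; its law is the restriction of [P]. *)
pose X : {RV P >-> Past} := HB.pack (id : Omega -> Past)
  (isMeasurableFun.Build _ _ _ _ (id : Omega -> Past) past_id_measurable).
have mY : measurable_fun setT (fun w : Omega => (w : Past, xi w)).
  exact: measurable_fun_pair past_id_measurable mxi.
pose Y : {RV P >-> (Past * Xi)%type} := HB.pack (fun w : Omega => (w : Past, xi w))
  (isMeasurableFun.Build _ _ _ _ (fun w : Omega => (w : Past, xi w)) mY).
have prodE : forall A, measurable A -> (distribution P X \x D)%E A = distribution P Y A.
  apply: product_measure_unique => A E mA mE.
  exact: indep.
transitivity (\int[distribution P Y]_z h z)%E.
  by rewrite ge0_integral_distribution.
rewrite -(eq_measure_integral (distribution P Y) (m1 := (distribution P X \x D)%E)); last first.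
  by move=> A mA _; exact: prodE.
rewrite fubini_tonelli1// ge0_integral_distribution//.
  exact: measurable_fun_fubini_tonelli_F.
by move=> z; exact: integral_ge0.
Qed.

(** Positive and negative parts are frozen separately. Their inner integrals agree for every past,
    and integrability under [P] makes the difference of the outer ones meaningful. *)
Lemma freezing_mean0 (h : Past * Xi -> R) :
  measurable_fun setT h ->
  P.-integrable setT (fun w => (h (w : Past, xi w))%:E) ->
  (forall w, \int[D]_s (h (w, s))%:E = 0)%E ->
  (forall w, D.-integrable setT (fun s => (h (w, s))%:E)) ->
  (\int[P]_w (h (w : Past, xi w))%:E = 0)%E.
Proof.
move=> mh ih h0 ihw; pose H z := (h z)%:E.
have mH : measurable_fun setT H by exact/measurable_EFinP.
have posneg w : (\int[D]_s (H^\+ (w, s)) = \int[D]_s (H^\- (w, s)))%E.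
  have e : (\int[D]_s (H^\+ (w, s)) - \int[D]_s (H^\- (w, s)) = 0)%E.
    rewrite -(h0 w) [RHS]integralE.
    by congr (_ - _)%E; apply: eq_integral => s _; rewrite unlock.
  have f1 : (\int[D]_s (H^\+ (w, s)))%E \is a fin_num.
    have := integrable_fin_num measurableT (integrable_funepos measurableT (ihw w)).
    by congr (_ \is a fin_num); apply: eq_integral => s _; rewrite unlock.
  have f2 : (\int[D]_s (H^\- (w, s)))%E \is a fin_num.
    have := integrable_fin_num measurableT (integrable_funeneg measurableT (ihw w)).
    by congr (_ \is a fin_num); apply: eq_integral => s _; rewrite unlock.
  move: e; rewrite -(fineK f1) -(fineK f2) -EFinB => -[] /eqP.
  by rewrite subr_eq0 => /eqP ->.
have e1 := freezing (measurable_funepos mH) (fun z => funepos_ge0 H z).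
have e2 := freezing (measurable_funeneg mH) (fun z => funeneg_ge0 H z).
have e3 : (\int[P]_w (H^\+ (w : Past, xi w)) = \int[P]_w (H^\- (w : Past, xi w)))%E.
  by rewrite e1 e2; apply: eq_integral => w _; exact: posneg.
rewrite integralE.
have f3 : (\int[P]_w (fun w => (h (w : Past, xi w))%:E)^\- w)%E \is a fin_num.
  by apply: integrable_fin_num => //; exact: integrable_funeneg.
have -> : (\int[P]_w (fun w => (h (w : Past, xi w))%:E)^\+ w =
    \int[P]_w (fun w => (h (w : Past, xi w))%:E)^\- w)%E; last exact: subee.
transitivity (\int[P]_w (H^\+ (w : Past, xi w)))%E.
  by apply: eq_integral => w _; rewrite unlock.
by rewrite e3; apply: eq_integral => w _; rewrite unlock.
Qed.

End Freezing.

Section Independence.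
Context {R : realType} {d : measure_display} {Omega : measurableType d}.
Context {d' : measure_display} {Xi : measurableType d'}.
Context (P : probability Omega R) (I : finType) (Z : I -> Omega -> Xi).
Hypothesis mZ : forall i, measurable_fun setT (Z i).
Hypothesis indepZ : mutually_independent P Z.

(** A pi-system generating the sigma-algebra of the samples indexed by [J]. *)
Definition cylinders (J : {set I}) : set (set Omega) :=
  [set \bigcap_(i in [set i | i \in J]) (Z i @^-1` A i) |
    A in [set A : I -> set Xi | forall i, measurable (A i)]].

Lemma cylinders_measurable J : cylinders J `<=` measurable.
Proof.
move=> _ [A mA <-]; apply: fin_bigcap_measurable; first exact: finite_finset.
by move=> i _; rewrite -[X in measurable X]setTI; exact: mZ.
Qed.

Lemma cylinders_setI J : setI_closed (cylinders J).
Proof.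
move=> _ _ [A mA <-] [A' mA' <-]; exists (fun i => A i `&` A' i).
  by move=> i; exact: measurableI.
by rewrite -bigcapI; apply: eq_bigcapr => i _; rewrite preimage_setI.
Qed.

Lemma cylinders_sample (J : {set I}) i : i \in J ->
  measurable_fun setT (Z i : g_sigma_algebraType (cylinders J) -> Xi).
Proof.
move=> iJ _ E mE; rewrite setTI; apply: sub_sigma_algebra.
exists (fun j => if j == i then E else setT).
  by move=> j /=; case: ifP.
apply/seteqP; split=> w /=; first by move=> /(_ i iJ); rewrite /= eqxx.
by move=> wE j _ /=; case: eqP => // ->.
Qed.

(** The product formula on cylinders comes from mutual independence over [i0 |: J]; it extends by
    Dynkin's pi-lambda theorem, as it passes to complements and disjoint unions. *)
Lemma cylinders_indep (J : {set I}) i0 A E : i0 \notin J -> <<s cylinders J >> A ->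
  measurable E -> P (A `&` Z i0 @^-1` E) = (P A * P (Z i0 @^-1` E))%E.
Proof.
move=> i0J sA mE; have mZE : measurable (Z i0 @^-1` E).
  by rewrite -[X in measurable X]setTI; exact: mZ.
have fin_PE : P (Z i0 @^-1` E) \is a fin_num by exact: fin_num_measure.
pose good (S : set (g_sigma_algebraType (cylinders J))) :=
  P (S `&` Z i0 @^-1` E) = (P S * P (Z i0 @^-1` E))%E.
have sub S : <<s cylinders J >> S -> measurable (S : set Omega).
  by apply: past_measurable; exact: cylinders_measurable.
apply: (@dynkin_induction _ (g_sigma_algebraType (cylinders J)) (cylinders J) good) sA.
- by [].
- exact: cylinders_setI.
- by rewrite /good setTI probability_setT mul1e.
- move=> _ [F mF <-]; rewrite /good.
  (* Placing [E] at the index [i0] turns the intersection into a cylinder over [i0 |: J]. *)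
  pose F' j := if j == i0 then E else F j.
  have mF' j : measurable (F' j) by rewrite /F'; case: ifP.
  have e1 := indepZ (J := J) (A := F) (fun j _ => mF j).
  have e2 := indepZ (J := i0 |: J) (A := F') (fun j _ => mF' j).
  rewrite e1 muleC -[P (_ @^-1` E)](_ : P (Z i0 @^-1` F' i0) = _); last by rewrite /F' eqxx.
  rewrite big_setU1//= in e2.
  rewrite (eq_bigr (fun j => P (Z j @^-1` F' j))) -?e2; last first.
    by move=> j jJ; rewrite /F'; case: eqP => // ji; rewrite ji (negPf i0J) in jJ.
  congr (P _); apply/seteqP; split=> w /=.
    move=> [wF wE] j /=; rewrite in_setU1 => /orP[/eqP ->|jJ].
      by rewrite /F' eqxx.
    by rewrite /F'; case: eqP => [->//|_]; exact: wF.
  move=> h; split; last by have := h i0; rewrite /F' eqxx; apply; exact: setU11.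
  move=> j /= jJ; have := h j; rewrite /F'; case: eqP => [ji|_].
    by rewrite ji (negPf i0J) in jJ.
  by apply; rewrite /= in_setU1 jJ orbT.
- move=> S /sub mS gS; rewrite /good.
  have -> : ~` S `&` Z i0 @^-1` E = Z i0 @^-1` E `\` (S `&` Z i0 @^-1` E).
    by apply/seteqP; split=> w /= [h1 h2]; split=> //; [case|move=> Sw; exact: h2].
  rewrite measureD//=; [|exact: measurableI|by rewrite -ge0_fin_numE// fin_num_measure].
  rewrite setIC -setIA setIid [X in (_ - X)%E]gS probability_setC//.
  by rewrite muleBl// mul1e.
- move=> F mF tF gF; rewrite /good setI_bigcupl.
  have mF' k : measurable (F k : set Omega) by apply: sub; exact: mF.
  have mFE k : measurable (F k `&` Z i0 @^-1` E : set Omega) by exact: measurableI.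
  rewrite measure_bigcup//; last exact: trivIset_setIr.
  rewrite measure_bigcup// muleC -(fineK fin_PE) -nneseriesZl//.
  by apply: eq_eseriesr => k _; rewrite fineK// muleC; exact: gF.
Qed.

End Independence.

(** * Expectation of the gap *)

Section MeanBound.
Context {R : realType} {d : measure_display} {Omega : measurableType d}.
Context (P : probability Omega R).
Implicit Types f g : Omega -> R.

(** Integrability is carried with the bound, since sums of integrals may be split only for
    integrable functions. *)
Definition mean_le f (c : R) :=
  P.-integrable setT (EFin \o f) /\ (\int[P]_w (f w)%:E <= c%:E)%E.

Lemma mean_leD f g c c' : mean_le f c -> mean_le g c' ->
  mean_le (fun w => f w + g w) (c + c').
Proof.
move=> [intf fc] [intg gc']; split; first exact: (integrableD measurableT intf intg).
under eq_integral do rewrite EFinD.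
by rewrite integralD// EFinD leeD.
Qed.

Lemma mean_leZ a f c : 0 <= a -> mean_le f c -> mean_le (fun w => a * f w) (a * c).
Proof.
move=> a0 [intf fc]; split; first exact: (integrableZl measurableT a intf).
under eq_integral do rewrite EFinM.
by rewrite integralZl// EFinM lee_wpmul2l// lee_fin.
Qed.

Lemma mean_le_cst c : mean_le (fun=> c) c.
Proof.
split; first exact: finite_measure_integrable_cst.
by rewrite integral_cst//= probability_setT mule1.
Qed.

Lemma mean_le_sum n (f : nat -> Omega -> R) (c : nat -> R) :
  (forall k, (k < n)%N -> mean_le (f k) (c k)) ->
  mean_le (fun w => \sum_(k < n) f k w) (\sum_(k < n) c k).
Proof.
elim: n => [|n IH] h.
  rewrite big_ord0 (_ : (fun w => _) = fun=> 0); first exact: mean_le_cst.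
  by apply/funext => w; rewrite big_ord0.
rewrite big_ord_recr (_ : (fun w => _) = fun w => \sum_(k < n) f k w + f n w); last first.
  by apply/funext => w; rewrite big_ord_recr.
by apply: mean_leD; [apply: IH => k kn; apply: h; exact: ltnW|exact: h].
Qed.

Lemma mean_le_mean0 a f : P.-integrable setT (EFin \o f) ->
  (\int[P]_w (f w)%:E = 0)%E -> mean_le (fun w => a * f w) 0.
Proof.
move=> intf f0; split; first exact: (integrableZl measurableT a intf).
under eq_integral do rewrite EFinM.
by rewrite integralZl// f0 mule0.
Qed.

Lemma le_mean_le f g c : measurable_fun setT f -> (forall w, 0 <= f w <= g w) ->
  mean_le g c -> mean_le f c.
Proof.
move=> mf fg [intg gc].
have intf : P.-integrable setT (EFin \o f).
  apply: le_integrable intg => //; first exact/measurable_EFinP.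
  move=> w _; have /andP[f0 fgw] := fg w.
  by rewrite /= lee_fin !ger0_norm// (le_trans f0).
split=> //; apply: le_trans gc; apply: le_integral => // w _.
by rewrite lee_fin; have /andP[] := fg w.
Qed.

End MeanBound.

Lemma vec_measurable_comp (R : realType) (X : vectType R) (d d' : measure_display)
    (T : measurableType d) (T' : measurableType d') (h : T' -> T) (Y : T -> X) :
  measurable_fun setT h -> vec_measurable Y -> vec_measurable (fun w => Y (h w)).
Proof. by move=> mh mY phi; exact: (measurableT_comp (mY phi) mh). Qed.

Section FrozenNoise.
Context {R : realType} {X : vectType R} (ip : {dot X for idfun}).
Context {d : measure_display} {Xi : measurableType d} (D : probability Xi R).
Context (B : 'End(X)) (sigma : R) (grad : X -> X) (n : Xi -> X -> X).
Hypotheses (pB : pos_def ip B) (orac : stochastic_oracle ip D B sigma grad n).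
Context {d' : measure_display} {Omega : measurableType d'} (P : probability Omega R).
Context (G : set (set Omega)) (xi : Omega -> Xi).
Hypotheses (mG : G `<=` measurable) (mxi : measurable_fun setT xi).
Hypothesis indep : forall A E, <<s G >> A -> measurable E ->
  P (A `&` xi @^-1` E) = (P A * D E)%E.
Local Notation Past := (g_sigma_algebraType G).
Local Notation ipP := (dot_inner_product ip).
Local Notation dual u := (ip u (B^-1%VF u)).
Context (a b : Past -> X) (ma : vec_measurable a) (mb : vec_measurable b).

Let mn : vec_measurable (fun z : Past * Xi => n z.2 (a z.1)).
Proof.
apply: (noise_measurable pB orac measurable_snd).
exact: (vec_measurable_comp measurable_fst ma).
Qed.

Let mY : measurable_fun setT (fun w : Omega => (w : Past, xi w)).
Proof. exact: measurable_fun_pair (past_id_measurable mG) mxi. Qed.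

Lemma frozen_noise_variance :
  mean_le P (fun w => dual (n (xi w) (a w))) (sigma ^+ 2).
Proof.
have mh : measurable_fun setT (fun z : Past * Xi => (dual (n z.2 (a z.1)))%:E).
  by apply/measurable_EFinP; exact: dual_measurable.
have e := freezing mG mxi indep mh (fun z => dual_ge0 pB _ : (0 <= _%:E)%E).
have le : (\int[P]_w (dual (n (xi w) (a w)))%:E <= (sigma ^+ 2)%:E)%E.
  rewrite e /=; apply: (@le_trans _ _ (\int[P]_w (sigma ^+ 2)%:E)%E); last first.
    by rewrite integral_cst//= probability_setT mule1.
  apply: ge0_le_integral => //.
  - by move=> w _; apply: integral_ge0 => s _; rewrite lee_fin dual_ge0.
  - apply: (measurableT_comp (measurable_fun_fubini_tonelli_F _ mh _) (past_id_measurable mG)).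
    by move=> z; rewrite lee_fin dual_ge0.
  - by move=> w _; exact: (noise_variance pB orac).
split=> //; apply/integrableP; split.
  by apply/measurable_EFinP; apply: dual_measurable; exact: (vec_measurable_comp mY mn).
under eq_integral do rewrite /= ger0_norm ?(dual_ge0 pB)//.
exact: le_lt_trans le (ltry _).
Qed.

(** The uniform bound on [b] and the variance bound make the pairing integrable by Young's
    inequality; freezing the past then leaves the mean of the noise at a fixed point. *)
Lemma frozen_noise_mean0 c : (forall w, ip (b w) (B (b w)) <= c) ->
  P.-integrable setT (EFin \o (fun w => ip (n (xi w) (a w)) (b w))) /\
  (\int[P]_w (ip (n (xi w) (a w)) (b w))%:E = 0)%E.
Proof.
move=> bc.
have mh : measurable_fun setT (fun z : Past * Xi => ip (n z.2 (a z.1)) (b z.1)).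
  apply: (bilinear_measurable (b := fun u v => ip u v)) => //.
  - by move=> x r u v; rewrite (innerDr ipP) (innerZr ipP).
  - by move=> y r u v; rewrite (innerDl ipP) (innerZl ipP).
  - exact: (vec_measurable_comp measurable_fst mb).
have int_n : P.-integrable setT (EFin \o (fun w => ip (n (xi w) (a w)) (b w))).
  have [i1 _] := mean_leD frozen_noise_variance (mean_le_cst P c).
  apply: le_integrable i1 => //.
    by apply/measurable_EFinP; exact: (measurableT_comp mh mY).
  move=> w _; rewrite /= lee_fin.
  have h1 := young_quad (n (xi w) (a w)) (b w) pB.
  have h2 := young_quad (- n (xi w) (a w)) (b w) pB.
  have h3 := dual_ge0 pB (n (xi w) (a w)); have h4 := (pos_defW pB).2 (b w).
  have h5 := bc w; rewrite [leRHS]ger0_norm ?addr_ge0// ?(le_trans h4)//.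
  move: h1 h2; rewrite linearN !(innerNl ipP) (innerNr ipP) opprK.
  move: h3 h4 h5; move: (dual _) (ip (b w) _) (ip _ (b w)) => p q t h3 h4 h5 h1 h2.
  by rewrite ler_norml; apply/andP; split; lra.
split=> //; apply: (freezing_mean0 mG mxi indep mh) => // w /=.
  under eq_integral do rewrite (innerC ipP _ (b w)).
  exact: (noise_mean0 orac).
under eq_fun do rewrite (innerC ipP _ (b w)).
exact: (noise_integrable pB orac).
Qed.

End FrozenNoise.

Section LeonExpectation.
Context {R : realType} {X : vectType R} (ip : {dot X for idfun}).
Context (H : {vspace 'End(X)}) (L nu sigma : R) (B : 'End(X)) (f : X -> R) (grad : X -> X).
Context {d : measure_display} {Xi : measurableType d} (D : probability Xi R).
Context (n : Xi -> X -> X) (r : R) (xs : X) (delta : R) (K : nat).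
Context {d' : measure_display} {Omega : measurableType d'} (P : probability Omega R).
Context (xi xi' : nat -> {RV P >-> Xi}).
Hypotheses (sH : structured_subspace ip H) (L_gt0 : 0 < L) (nu01 : 0 <= nu <= 1).
Hypotheses (pB : pos_def ip B) (BH : B \in H).
Hypotheses (trB : tr_norm ip B = 1) (subf : forall x, subgradient ip f x (grad x)).
Hypotheses (holderf : holder_smooth ip L nu B grad).
Hypotheses (orac : stochastic_oracle ip D B sigma grad n) (r_gt0 : 0 < r).
Hypotheses (xs_ball : rho_ball ip H r xs).
Hypothesis xs_min : forall y, rho_ball ip H r y -> f xs <= f y.
Hypothesis delta_gt0 : 0 < delta.
Hypothesis distr : forall k A, (k <= K)%N -> measurable A ->
  distribution P (xi k) A = D A /\ distribution P (xi' k.+1) A = D A.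
Let Z := @run_samples (Omega -> Xi) (fun k => xi k) (fun k => xi' k) K.
Hypothesis indepZ : mutually_independent P Z.
Local Notation ipP := (dot_inner_product ip).
Local Notation dual u := (ip u (B^-1%VF u)).

Let alpha k : R := 1 + k%:R / 2.
Let st w k := leon ip H r delta alpha (fun s x => grad x + n s x)
  (fun k => xi k w) (fun k => xi' k w) k.
Let x k w := st_x (st w k).
Let xb k w := st_xbar (st w k).
Let nw k w := n (xi k w) (leon_avg (alpha k) (xb k w) (x k w)).
Let nz k w := n (xi' k.+1 w) (xb k.+1 w).

Let mZ i : measurable_fun setT (Z i).
Proof. by case: i => k; rewrite /Z /=; exact: measurable_funPT. Qed.

Let DZ i E : measurable E -> P (Z i @^-1` E) = D E.
Proof. by move=> mE; case: i => k; have [] := distr (ltn_ord k) mE. Qed.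

Let trB1 : op_trace B = 1.
Proof. by rewrite -(tr_normE (pos_defW pB)). Qed.

(* [past k k] is drawn before [xi k], and [past k.+1 k] before [xi' k.+1]. *)
Let past (a b : nat) : {set 'I_K.+1 + 'I_K.+1} :=
  [set i : 'I_K.+1 + 'I_K.+1 |
    match i with inl j => (j < a)%N | inr j => (j < b)%N end]%SET.
Local Notation Past a b := (g_sigma_algebraType (cylinders Z (past a b))).

Let xi_past a b j : (j < a)%N -> (j < K.+1)%N ->
  measurable_fun (T := Past a b) (U := Xi) setT (xi j).
Proof.
move=> ja jK; have := @cylinders_sample _ _ _ _ _ Z (past a b) (inl (Ordinal jK)).
by rewrite inE; exact.
Qed.

Let xi'_past a b j : (j < b)%N -> (j < K.+1)%N ->
  measurable_fun (T := Past a b) (U := Xi) setT (xi' j.+1).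
Proof.
move=> jb jK; have := @cylinders_sample _ _ _ _ _ Z (past a b) (inr (Ordinal jK)).
by rewrite inE; exact.
Qed.

Let past_indep a b i : i \notin past a b -> forall A E,
  <<s cylinders Z (past a b) >> A -> measurable E ->
  P (A `&` Z i @^-1` E) = (P A * D E)%E.
Proof. by move=> ip0 A E sA mE; rewrite (cylinders_indep mZ indepZ ip0 sA mE) DZ. Qed.

Let x_ball k w : proj_ball ip H r (x k w).
Proof.
exact: (leon_iterate_ball sH grad n (fun k => xi k w) (fun k => xi' k w) r_gt0 delta_gt0 k).
Qed.

(** As [tr B = 1], the ball has diameter at most [2 r] in the norm of [B]; this supplies the uniform
    bound for the noise pairings. *)
Let diff_bound u v : proj_ball ip H r u -> proj_ball ip H r v ->
  ip (u - v) (B (u - v)) <= 4 * r ^+ 2.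
Proof.
by move=> uB vB; have := proj_ball_quadB sH BH (pos_defW pB) uB vB; rewrite trB1 mulr1.
Qed.

Let noise_at_x k : (k <= K)%N -> mean_le P (fun w => dual (nw k w)) (sigma ^+ 2) /\
  (P.-integrable setT (EFin \o (fun w => ip (nw k w) (x k w - xs))) /\
   (\int[P]_w (ip (nw k w) (x k w - xs))%:E = 0)%E).
Proof.
move=> kK; have i0 : (inl (Ordinal (kK : (k < K.+1)%N)) : 'I_K.+1 + 'I_K.+1) \notin past k k.
  by rewrite inE ltnn.
have lm : leon_measurable (T := Past k k) ip H r delta alpha
    (fun s x => grad x + n s x) xi xi' k.
  apply: (leon_state_measurable sH r_gt0 delta_gt0 alpha (oracle_measurable orac)) => j jk.
    exact: (xi_past jk (leq_trans jk (leqW kK))).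
  exact: (xi'_past jk (leq_trans jk (leqW kK))).
have ma : vec_measurable (T := Past k k) (fun w => leon_avg (alpha k) (xb k w) (x k w)).
  exact: (leon_avg_measurable (alpha k) (lm_xbar lm) (lm_x lm)).
have mb : vec_measurable (T := Past k k) (fun w => x k w - xs).
  exact: (vec_measurableB (lm_x lm) (vec_measurable_cst xs)).
have mG := @cylinders_measurable _ _ _ _ _ Z mZ (past k k).
split.
  exact: (frozen_noise_variance pB orac mG (mZ _) (past_indep i0) ma).
apply: (frozen_noise_mean0 pB orac mG (mZ _) (past_indep i0) ma mb (c := 4 * r ^+ 2)) => w.
by apply: diff_bound; [exact: x_ball|exact/(rho_ballP sH r_gt0)].
Qed.

Let noise_at_avg k : (k <= K)%N -> mean_le P (fun w => dual (nz k w)) (sigma ^+ 2) /\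
  (P.-integrable setT (EFin \o (fun w => ip (nz k w) (x k.+1 w - x k w))) /\
   (\int[P]_w (ip (nz k w) (x k.+1 w - x k w))%:E = 0)%E).
Proof.
move=> kK; have i0 : (inr (Ordinal (kK : (k < K.+1)%N)) : 'I_K.+1 + 'I_K.+1) \notin past k.+1 k.
  by rewrite inE ltnn.
have lm : leon_measurable (T := Past k.+1 k) ip H r delta alpha
    (fun s x => grad x + n s x) xi xi' k.
  apply: (leon_state_measurable sH r_gt0 delta_gt0 alpha (oracle_measurable orac)) => j jk.
    exact: (xi_past (leqW jk) (leq_trans jk (leqW kK))).
  exact: (xi'_past jk (leq_trans jk (leqW kK))).
(* [x k.+1] and [xb k.+1] are measurable for [past k.+1 k], which contains [xi k] but not
   [xi' k.+1]. *)
have [_ mx' mxb'] := leon_half_step sH r_gt0 delta_gt0 (oracle_measurable orac) lm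
  (xi_past (ltnSn k) kK).
have mb : vec_measurable (T := Past k.+1 k) (fun w => x k.+1 w - x k w).
  exact: (vec_measurableB mx' (lm_x lm)).
have mG := @cylinders_measurable _ _ _ _ _ Z mZ (past k.+1 k).
split.
  exact: (frozen_noise_variance pB orac mG (mZ _) (past_indep i0) mxb').
apply: (frozen_noise_mean0 pB orac mG (mZ _) (past_indep i0) mxb' mb (c := 4 * r ^+ 2)) => w.
by apply: diff_bound; exact: x_ball.
Qed.

(** The right-hand side of [leon_pointwise] is integrable and dominates the nonnegative weighted
    gap, which gives integrability together with the bound. The linear noise terms contribute zero
    and each squared noise at most [sigma ^+ 2]. *)
Lemma leon_gap_mean s tau (l := L * s `^ (1 + nu)) :
  0 < s -> 0 < tau -> 12 * r * (2 * L * s `^ (nu - 1)) <= tau ->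
  mean_le P (fun w => alpha K ^+ 2 * (f (xb K.+1 w) - f xs))
    (6 * r * delta * (\dim {:X})%:R + 3 * r * tau +
     \sum_(k < K.+1) (alpha k ^+ 2 * l + 12 * r / tau * alpha k ^+ 2 * (sigma ^+ 2 + sigma ^+ 2))).
Proof.
move=> s0 t0 tau_ge.
have mgap : measurable_fun setT (fun w => alpha K ^+ 2 * (f (xb K.+1 w) - f xs)).
  apply: measurable_funM; first exact: measurable_cst.
  apply: measurable_funB; last exact: measurable_cst.
  apply: (convex_fun_measurable L_gt0 nu01 pB subf holderf).
  have lm : leon_measurable ip H r delta alpha (fun s x => grad x + n s x)
      (fun j => xi j : Omega -> Xi) (fun j => xi' j : Omega -> Xi) K.+1.
    by apply: (leon_state_measurable sH r_gt0 delta_gt0 alpha (oracle_measurable orac)) => j _;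
      exact: measurable_funPT.
  exact: (lm_xbar lm).
apply: (le_mean_le mgap (g := fun w => 6 * r * delta * (\dim {:X})%:R + 3 * r * tau +
   \sum_(k < K.+1) (alpha k ^+ 2 * l +
     12 * r / tau * alpha k ^+ 2 * (dual (nw k w) + dual (nz k w)) -
     alpha k * (ip (nw k w) (x k w - xs) + ip (nz k w) (x k.+1 w - x k w))))).
  move=> w; apply/andP; split.
    rewrite mulr_ge0 ?sqr_ge0//.
    exact: (leon_gap_ge0 sH grad n (fun k => xi k w) (fun k => xi' k w) r_gt0 delta_gt0 xs_min K.+1).
  exact: (leon_pointwise sH n (fun k => xi k w) (fun k => xi' k w) L_gt0 nu01 pB BH trB1
    subf holderf r_gt0 delta_gt0 xs_ball xs_min K s0 t0 tau_ge).
apply: mean_leD; first exact: mean_le_cst.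
apply: (mean_le_sum (f := fun k w => alpha k ^+ 2 * l +
     12 * r / tau * alpha k ^+ 2 * (dual (nw k w) + dual (nz k w)) -
     alpha k * (ip (nw k w) (x k w - xs) + ip (nz k w) (x k.+1 w - x k w)))
  (c := fun k => alpha k ^+ 2 * l + 12 * r / tau * alpha k ^+ 2 * (sigma ^+ 2 + sigma ^+ 2))).
move=> k kK; have [v1 [i1 m1]] := noise_at_x kK; have [v2 [i2 m2]] := noise_at_avg kK.
have c0 : 0 <= 12 * r / tau * alpha k ^+ 2.
  by rewrite mulr_ge0 ?sqr_ge0// divr_ge0 ?mulr_ge0// ltW.
have h := mean_leD (mean_leD (mean_le_cst P (alpha k ^+ 2 * l)) (mean_leZ c0 (mean_leD v1 v2)))
  (mean_leD (mean_le_mean0 (- alpha k) i1 m1) (mean_le_mean0 (- alpha k) i2 m2)).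
rewrite !addr0 in h.
have e : (fun w => alpha k ^+ 2 * l +
     12 * r / tau * alpha k ^+ 2 * (dual (nw k w) + dual (nz k w)) -
     alpha k * (ip (nw k w) (x k w - xs) + ip (nz k w) (x k.+1 w - x k w))) =
   (fun w => alpha k ^+ 2 * l + 12 * r / tau * alpha k ^+ 2 * (dual (nw k w) + dual (nz k w)) +
     (- alpha k * ip (nw k w) (x k w - xs) + - alpha k * ip (nz k w) (x k.+1 w - x k w))).
  by apply/funext => w; congr (_ + _); rewrite !mulNr -opprD -mulrDr.
by rewrite e.
Qed.

End LeonExpectation.

(** * Rates *)

Section Rates.
Context {R : realType}.
Implicit Types (L nu r sigma delta q n : R).

(** The smoothness cost [r^2 s^(nu - 1)] and the accumulated approximation error [n^3 s^(1 + nu)]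
    coincide exactly when [s^2 = r^2 / n^3]. *)
Lemma step_size_scale r n nu (s := r * n `^ (- (3 / 2))) : 0 < r -> 0 < n ->
  r ^+ 2 * s `^ (nu - 1) = r `^ (1 + nu) * (n ^+ 2 / n `^ ((3 * nu + 1) / 2)) /\
  n ^+ 3 * s `^ (1 + nu) = r `^ (1 + nu) * (n ^+ 2 / n `^ ((3 * nu + 1) / 2)).
Proof.
move=> r0 n0; have r0' := ltW r0; have n0' := ltW n0.
have nE : n ^+ 2 / n `^ ((3 * nu + 1) / 2) = n `^ (3 / 2 * (1 - nu)).
  by rewrite -powRN -powR_mulrn// -gt0_powRD//; congr (_ `^ _); field.
rewrite nE /s !powRM ?powR_ge0// -!powRrM; split.
  by rewrite mulrA -powR_mulrn// -gt0_powRD//; congr (_ `^ _ * _ `^ _); field.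
rewrite mulrCA; congr (_ * _); rewrite -powR_mulrn// -gt0_powRD//.
by congr (_ `^ _); field.
Qed.

(** The second part of [tau] balances [r tau] against [r sigma^2 n^3 / tau]. The three error terms
    get coefficients 72 + 1, 3 + 24 and 6, all at most 73; [n ^+ 2 <= 4 * alpha K ^+ 2] then gives 4
    * 73 = 292. *)
Lemma leon_rate L nu sigma r delta (dim : R) (K : nat) (n : R := K.+1%:R)
    (alpha := fun k : nat => 1 + k%:R / 2 : R)
    (s := r * n `^ (- (3 / 2))) (tau := 12 * r * (2 * L * s `^ (nu - 1)) + sigma * n `^ (3 / 2))
    (l := L * s `^ (1 + nu)) :
  0 < L -> 0 < r -> 0 < sigma -> 0 < delta -> 0 <= dim ->
  6 * r * delta * dim + 3 * r * tau +
     \sum_(k < K.+1) (alpha k ^+ 2 * l + 12 * r / tau * alpha k ^+ 2 * (sigma ^+ 2 + sigma ^+ 2))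
  <= alpha K ^+ 2 * (292 * (L * r `^ (1 + nu) / n `^ ((3 * nu + 1) / 2)
       + sigma * r / n `^ (1 / 2) + delta * r * dim / n ^+ 2)).
Proof.
move=> L0 r0 sg0 d0 dim0.
have n0 : 0 < n by rewrite ltr0n.
have [e1 e2] := step_size_scale nu r0 n0; rewrite -/s in e1 e2.
set E1 := L * r `^ (1 + nu) / _; set E2 := sigma * r / _; set E3 := delta * r * dim / _.
have E1_ge0 : 0 <= E1 by rewrite divr_ge0 ?powR_ge0// mulr_ge0 ?powR_ge0// ltW.
have E2_ge0 : 0 <= E2 by rewrite divr_ge0 ?powR_ge0// mulr_ge0// ltW.
have E3_ge0 : 0 <= E3.
  by apply: divr_ge0; [apply: mulr_ge0 => //; apply: mulr_ge0; exact: ltW|exact: sqr_ge0].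
have n32 : sigma * r * n `^ (3 / 2) = n ^+ 2 * E2.
  have -> : n `^ (3 / 2) = n ^+ 2 / n `^ (1 / 2).
    by rewrite -powRN -powR_mulrn ?(ltW n0)// -gt0_powRD//; congr (_ `^ _); field.
  by rewrite /E2; ring.
have f1 : L * (r ^+ 2 * s `^ (nu - 1)) = n ^+ 2 * E1 by rewrite e1 /E1; ring.
have f2 : n ^+ 3 * l = n ^+ 2 * E1 by rewrite /l mulrCA e2 /E1; ring.
have f3 : 6 * r * delta * dim = 6 * (n ^+ 2 * E3).
  by rewrite /E3; field; rewrite gt_eqF.
have s0 : 0 < s by rewrite mulr_gt0// powR_gt0.
have n32_gt0 : 0 < n `^ (3 / 2) by rewrite powR_gt0.
have M0 : 0 <= 12 * r * (2 * L * s `^ (nu - 1)).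
  by rewrite !mulr_ge0 ?powR_ge0// ltW.
have tau_ge : sigma * n `^ (3 / 2) <= tau by rewrite lerDr.
have sn0 : 0 < sigma * n `^ (3 / 2) by rewrite mulr_gt0.
have tau0 : 0 < tau by exact: lt_le_trans tau_ge.
have f4 : 3 * r * tau = 72 * (n ^+ 2 * E1) + 3 * (n ^+ 2 * E2).
  by rewrite -f1 -n32 /tau; ring.
have l0 : 0 <= l by rewrite mulr_ge0 ?powR_ge0// ltW.
have sum_alpha : \sum_(k < K.+1) alpha k ^+ 2 <= n ^+ 3.
  apply: (@le_trans _ _ (\sum_(k < K.+1) n ^+ 2)); last first.
    by rewrite sumr_const card_ord -[leRHS]mulr1 -mulr_natl exprS mulr1.
  apply: ler_sum => k _; rewrite ler_sqr ?nnegrE ?(ltW n0) ?addr_ge0 ?divr_ge0//.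
  have kK : (k%:R : R) <= K%:R by rewrite ler_nat -ltnS.
  have k0 : 0 <= k%:R :> R by exact: ler0n.
  rewrite /alpha /n -[K.+1%:R]natr1; move: kK k0; clear.
  by move: (k%:R : R) (K%:R : R) => p q *; lra.
pose c := l + 12 * r / tau * (sigma ^+ 2 + sigma ^+ 2).
have c0 : 0 <= c.
  by rewrite addr_ge0// mulr_ge0 ?addr_ge0 ?sqr_ge0// divr_ge0 ?mulr_ge0// ltW.
have -> : \sum_(k < K.+1) (alpha k ^+ 2 * l +
    12 * r / tau * alpha k ^+ 2 * (sigma ^+ 2 + sigma ^+ 2)) =
    (\sum_(k < K.+1) alpha k ^+ 2) * c.
  by rewrite mulr_suml; apply: eq_bigr => k _; rewrite /c; ring.
have sumc : (\sum_(k < K.+1) alpha k ^+ 2) * c <= n ^+ 3 * c by rewrite ler_wpM2r.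
have f5 : n ^+ 3 * c <= n ^+ 2 * E1 + 24 * (n ^+ 2 * E2).
  rewrite /c mulrDr f2 lerD2l -n32.
  have -> : n ^+ 3 * (12 * r / tau * (sigma ^+ 2 + sigma ^+ 2)) =
     24 * (sigma * r * (n `^ (3 / 2) * (sigma * n `^ (3 / 2) / tau))).
    have -> : n ^+ 3 = n `^ (3 / 2) * n `^ (3 / 2).
      by rewrite -gt0_powRD// -powR_mulrn ?(ltW n0)//; congr (_ `^ _); field.
    by field; rewrite gt_eqF.
  rewrite ler_pM2l// ler_pM2l ?mulr_gt0// ler_piMr ?(ltW n32_gt0)//.
  by rewrite ler_pdivrMr// mul1r.
have aK : n ^+ 2 <= 4 * alpha K ^+ 2.
  have -> : 4 * alpha K ^+ 2 = (2 * alpha K) ^+ 2 by ring.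
  have -> : 2 * alpha K = n + 1.
    by rewrite /alpha /n -natr1; field.
  by rewrite ler_sqr ?nnegrE ?addr_ge0 ?(ltW n0)// lerDl.
apply: (@le_trans _ _ (n ^+ 2 * (73 * (E1 + E2 + E3)))).
  have n2 : 0 <= n ^+ 2 by exact: sqr_ge0.
  have g1 : 0 <= n ^+ 2 * E1 by exact: mulr_ge0.
  have g2 : 0 <= n ^+ 2 * E2 by exact: mulr_ge0.
  have g3 : 0 <= n ^+ 2 * E3 by exact: mulr_ge0.
  rewrite f3 f4 [leRHS]mulrCA ![in leRHS]mulrDr; move: sumc f5 g1 g2 g3.
  move: (_ * c) (_ * c) (n ^+ 2 * E1) (n ^+ 2 * E2) (n ^+ 2 * E3) => *; lra.
have -> : alpha K ^+ 2 * (292 * (E1 + E2 + E3)) = 4 * alpha K ^+ 2 * (73 * (E1 + E2 + E3)) by ring.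
by rewrite ler_wpM2r// mulr_ge0// !addr_ge0.
Qed.

(** Each term is brought below [eps / 3]. With [c = 3 * C], the factor [c ^+ 2] becomes
    [c^(1 + 3 nu)], [c] and [c^4] once [n] is raised to the powers [(3 nu + 1) / 2], [1 / 2] and 2;
    each is at least [c] because [c >= 1]. *)
Lemma leon_complexity L nu sigma r delta (dim n eps : R) (C : R := 292) :
  0 < L -> 0 <= nu <= 1 -> 0 < r -> 0 < sigma -> 0 < delta -> 0 <= dim -> 0 < n -> 0 < eps ->
  (3 * C) ^+ 2 * ((L * r `^ (1 + nu) / eps) `^ (2 / (1 + 3 * nu))
     + (sigma * r / eps) ^+ 2 + (delta * r * dim / eps) `^ (1 / 2)) <= n ->
  C * (L * r `^ (1 + nu) / n `^ ((3 * nu + 1) / 2)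
       + sigma * r / n `^ (1 / 2) + delta * r * dim / n ^+ 2) <= eps.
Proof.
move=> L0 /andP[nu0 nu1] r0 sg0 d0 dim0 n0 eps0.
set c := 3 * C; have c1 : 1 <= c by rewrite /c /C; lra.
have c0 : 0 < c by exact: lt_le_trans c1.
set X1 := L * _ / eps; set X2 := sigma * r / eps; set X3 := delta * r * dim / eps => h.
have X1_gt0 : 0 < X1 by rewrite divr_gt0// mulr_gt0// powR_gt0.
have X2_gt0 : 0 < X2 by rewrite divr_gt0// mulr_gt0.
have X3_ge0 : 0 <= X3.
  by apply: divr_ge0; [apply: mulr_ge0 => //; apply: mulr_ge0; exact: ltW|exact: ltW].
have t1 : 0 <= X1 `^ (2 / (1 + 3 * nu)) by exact: powR_ge0.
have t2 : 0 <= X2 ^+ 2 by exact: sqr_ge0.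
have t3 : 0 <= X3 `^ (1 / 2) by exact: powR_ge0.
have h1 : c ^+ 2 * X1 `^ (2 / (1 + 3 * nu)) <= n.
  by apply: le_trans h; rewrite ler_wpM2l ?sqr_ge0// -addrA lerDl addr_ge0.
have h2 : c ^+ 2 * X2 ^+ 2 <= n.
  by apply: le_trans h; rewrite ler_wpM2l ?sqr_ge0// addrAC lerDr addr_ge0.
have h3 : c ^+ 2 * X3 `^ (1 / 2) <= n.
  by apply: le_trans h; rewrite ler_wpM2l ?sqr_ge0// lerDr addr_ge0.
have third A N : 0 < N -> c * (A / eps) <= N -> C * (A / N) <= eps / 3.
  move=> N0; rewrite mulrA ler_pdivrMr// => hA.
  rewrite ler_pdivlMr// (_ : C * (A / N) * 3 = c * A / N); last first.
    by rewrite /c; field; rewrite gt_eqF.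
  by rewrite ler_pdivrMr// [leRHS]mulrC.
pose p := (3 * nu + 1) / 2.
have p0 : 0 < p by rewrite divr_gt0// ltr_wpDl// mulr_ge0.
have b1 : C * (L * r `^ (1 + nu) / n `^ p) <= eps / 3.
  apply: third; rewrite ?powR_gt0//.
  have : (c ^+ 2 * X1 `^ (2 / (1 + 3 * nu))) `^ p <= n `^ p.
    by apply: ge0_ler_powR => //; rewrite ?nnegrE ?(ltW p0) ?(ltW n0) ?mulr_ge0 ?sqr_ge0.
  rewrite powRM ?sqr_ge0// -powRrM.
  have -> : 2 / (1 + 3 * nu) * p = 1.
    by rewrite /p; field; rewrite gt_eqF// ltr_wpDr// mulr_ge0.
  rewrite powRr1 ?(ltW X1_gt0)//; apply: le_trans; rewrite ler_pM2r//.
  rewrite -powR_mulrn ?(ltW c0)// -powRrM.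
  have -> : 2 * p = 1 + 3 * nu by rewrite /p; field.
  by rewrite le1r_powR// lerDl mulr_ge0.
have b2 : C * (sigma * r / n `^ (1 / 2)) <= eps / 3.
  apply: third; first by rewrite powR_gt0.
  have cX2 : 0 <= c * X2 by rewrite mulr_ge0// ltW.
  rewrite div1r powR12_sqrt ?(ltW n0)// -[leLHS]ger0_norm// -sqrtr_sqr.
  by rewrite ler_wsqrtr// exprMn.
have b3 : C * (delta * r * dim / n ^+ 2) <= eps / 3.
  apply: third; rewrite ?exprn_gt0//.
  have : (c ^+ 2 * X3 `^ (1 / 2)) ^+ 2 <= n ^+ 2.
    by rewrite ler_sqr ?nnegrE ?(ltW n0) ?mulr_ge0 ?sqr_ge0.
  rewrite exprMn div1r powR12_sqrt// sqr_sqrtr//; apply: le_trans.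
  rewrite ler_wpM2r// -exprM -[leLHS]expr1; exact: ler_weXn2l.
rewrite !mulrDr; move: b1 b2 b3; rewrite -/p.
by move: (C * _) (C * _) (C * _) => *; lra.
Qed.

End Rates.

Theorem theorem5 (R : realType) :
  exists C C' : R, [/\ 0 < C, 0 < C' &
  forall (X : vectType R) (ip : {dot X for idfun}) (H : {vspace 'End(X)})
         (L nu sigma : R) (B : 'End(X)) (f : X -> R) (grad : X -> X)
         (d : measure_display) (Xi : measurableType d) (D : probability Xi R)
         (n : Xi -> X -> X) (r : R) (xs : X) (delta : R) (K : nat)
         (d' : measure_display) (Omega : measurableType d')
         (P : probability Omega R) (xi xi' : nat -> {RV P >-> Xi}),
    structured_subspace ip H ->
    0 < L -> 0 <= nu <= 1 -> 0 < sigma ->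
    pos_def ip B -> B \in H -> tr_norm ip B = 1 ->
    convex_function [set: convex_lmodType X] f ->
    (forall x, subgradient ip f x (grad x)) ->
    holder_smooth ip L nu B grad ->
    stochastic_oracle ip D B sigma grad n ->
    0 < r ->
    rho_ball ip H r xs -> (forall y, rho_ball ip H r y -> f xs <= f y) ->
    0 < delta ->
    (forall k A, (k <= K)%N -> measurable A ->
       distribution P (xi k) A = D A /\ distribution P (xi' k.+1) A = D A) ->
    mutually_independent P
      (@run_samples (Omega -> Xi) (fun k => xi k) (fun k => xi' k) K) ->
    let alpha k : R := 1 + k%:R / 2 in
    let xbar w := st_xbar
      (leon ip H r delta alpha (fun s x => grad x + n s x)
         (fun k => xi k w) (fun k => xi' k w) K.+1) in
    let gap w : R := f (xbar w) - f xs in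
    let dimX : R := (\dim {:X})%:R in
    [/\ P.-integrable setT (EFin \o gap),
        ('E_P[gap] <=
          (C * (L * r `^ (1 + nu) / K.+1%:R `^ ((3 * nu + 1) / 2)
                + sigma * r / K.+1%:R `^ (1 / 2)
                + delta * r * dimX / K.+1%:R ^+ 2))%:E)%E
      & forall eps : R, 0 < eps ->
          C' * ((L * r `^ (1 + nu) / eps) `^ (2 / (1 + 3 * nu))
                + (sigma * r / eps) ^+ 2
                + (delta * r * dimX / eps) `^ (1 / 2)) <= K.+1%:R ->
          ('E_P[gap] <= eps%:E)%E]].
Proof.
have [C C0 CE] : exists2 C : R, 0 < C & C = 292 by exists 292; [rewrite ltr0n|].
exists C, ((3 * C) ^+ 2); split; first exact: C0.
  by rewrite exprn_gt0// mulr_gt0.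
rewrite {}CE.
move=> X ip H L nu sigma B f grad d Xi D n r xs delta K d' Omega P xi xi'.
move=> sH L0 nu01 sg0 pB BH trB _ subf holderf orac r0 xsB xs_min d0 distr indep.
move=> alpha xbar gap dimX.
have K0 : 0 < K.+1%:R :> R by rewrite ltr0n.
pose s := r * K.+1%:R `^ (- (3 / 2)) : R.
pose tau := 12 * r * (2 * L * s `^ (nu - 1)) + sigma * K.+1%:R `^ (3 / 2).
have s0 : 0 < s by rewrite mulr_gt0// powR_gt0.
have tau_ge : 12 * r * (2 * L * s `^ (nu - 1)) <= tau.
  by rewrite lerDl mulr_ge0 ?powR_ge0// ltW.
have tau0 : 0 < tau by apply: lt_le_trans tau_ge; rewrite !mulr_gt0// powR_gt0.
have aK : 0 < alpha K ^+ 2 by rewrite exprn_gt0// alpha_gt0.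
have [intg leg] := leon_gap_mean sH L0 nu01 pB BH trB subf holderf orac r0 xsB xs_min d0
  distr indep s0 tau0 tau_ge.
have rate := leon_rate nu K L0 r0 sg0 d0 (ler0n R (\dim {:X})).
have [int_gap le_gap] : mean_le P gap (292 * (L * r `^ (1 + nu) / K.+1%:R `^ ((3 * nu + 1) / 2)
     + sigma * r / K.+1%:R `^ (1 / 2) + delta * r * dimX / K.+1%:R ^+ 2)).
  have h := mean_leZ (_ : 0 <= (alpha K ^+ 2)^-1) (conj intg (le_trans leg _)).
  have -> : gap = (fun w => (alpha K ^+ 2)^-1 * (alpha K ^+ 2 * gap w)).
    by apply/funext => w; rewrite mulKf// gt_eqF.
  rewrite -[X in mean_le _ _ X](mulKf (lt0r_neq0 aK)).
  by apply: h; rewrite ?invr_ge0 ?(ltW aK)// lee_fin.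
split=> //; first by rewrite unlock.
move=> eps eps0 hK; rewrite unlock; apply: (le_trans le_gap); rewrite lee_fin.
exact: leon_complexity.
Qed.
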